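(* Fix $\epsilon>0$ and $p>0$. There exists a (randomized) algorithm that, given $\mathbf{x}_1,\dots,\mathbf{x}_n\in\mathbb{R}^d$ and the estimate $\hat\delta$ as in the context, finds with probability at least $1-p$ a unit vector $\mathbf{w}\in\mathbb{R}^d$ such that $(\mathbf{w}^{\top}\mathbf{u})^2\ge 1-\epsilon$, in total time $\tilde{O}\left(\frac{d}{\delta^2}+N\right)$.
   Context: Setting: $\mathbf{x}_1,\dots,\mathbf{x}_n\in\mathbb{R}^d$ with $n>d$ and $\|\mathbf{x}_i\|\le 1$ for all $i$; $\mathbf{X}=\frac1n\sum_{i=1}^n\mathbf{x}_i\mathbf{x}_i^{\top}$ has eigenvalues $\lambda_1\ge\lambda_2\ge\dots\ge\lambda_d$ with eigengap $\delta=\lambda_1-\lambda_2>0$, and $\mathbf{u}=\mathbf{u}_1$ is its (unit) leading eigenvector. $N$ is the total number of non-zero entries in $\mathbf{x}_1,\dots,\mathbf{x}_n$. An estimate $\hat\delta$ is given with $c_1\delta\le\hat\delta\le c_2\delta$ for universal constants $c_1,c_2$ satisfying $c_2-c_1=\Theta(1)$. $\tilde O(\cdot)$ hides poly-logarithmic dependencies on $d,\epsilon^{-1},p^{-1},\delta^{-1}$. Time is measured in elementary (arithmetic) operations. *)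

(* Defs.v *)
From mathcomp Require Import all_boot all_order all_algebra.
From mathcomp Require Import all_classical reals exp.

Set Implicit Arguments.
Unset Strict Implicit.
Unset Printing Implicit Defensive.

Import Order.TTheory GRing.Theory Num.Theory.
Local Open Scope ring_scope.

(** * The data *)

(* The Euclidean norm: the norm `|v| of the libraries on matrices is the
   sup norm. *)
Definition enorm (R : realType) (d : nat) (v : 'cV[R]_d) : R :=
  Num.sqrt (\sum_(j < d) v j 0 ^+ 2).

Definition cov (R : realType) (n d : nat) (x : 'I_n -> 'cV[R]_d) : 'M[R]_d :=
  n%:R^-1 *: \sum_(i < n) (x i *m (x i)^T).

(* [lam] lists the eigenvalues of [A] with their multiplicities, in
   nonincreasing order: lam`_0 is lambda_1, lam`_1 is lambda_2, and so on. *)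
Definition eigenvalues_of (R : realType) (d : nat) (A : 'M[R]_d)
    (lam : seq R) : Prop :=
  char_poly A = \prod_(l <- lam) ('X - l%:P) /\ sorted (fun a b => b <= a) lam.

Definition nnz (R : realType) (n d : nat) (x : 'I_n -> 'cV[R]_d) : nat :=
  #|[pred ij : 'I_n * 'I_d | x ij.1 ij.2 0 != 0]|.

(** * Finitely branching random computations *)

(* [Unif m f] draws i uniformly from the m+1 values 0, ..., m and goes on
   as [f i]. *)
Inductive rtree (A : Type) : Type :=
| Leaf of A
| Unif (m : nat) of ('I_m.+1 -> rtree A).

(* A leaf [None] is a run that was cut off before it halted. *)
Fixpoint rbind (A B : Type) (t : rtree (option A)) (f : A -> rtree (option B))
    : rtree (option B) :=
  match t with
  | Leaf (Some a) => f a
  | Leaf None => Leaf None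
  | Unif m g => Unif (fun i : 'I_m.+1 => rbind (g i) f)
  end.

(* The probability that the run halts with an outcome in [E]. *)
Fixpoint Pr (R : realType) (A : Type) (t : rtree (option A)) (E : A -> bool)
    : R :=
  match t with
  | Leaf (Some a) => (E a)%:R
  | Leaf None => 0
  | Unif m g => m.+1%:R^-1 * \sum_(i < m.+1) Pr R (g i) E
  end.

(* Whatever the random draws, the run halts with an outcome in [E]. *)
Fixpoint surely (A : Type) (t : rtree (option A)) (E : A -> bool) : Prop :=
  match t with
  | Leaf (Some a) => E a
  | Leaf None => False
  | Unif m g => forall i : 'I_m.+1, surely (g i) E
  end.

(** * A randomized real RAM *)

(* The memory consists of integer arrays and real arrays, both numbered by nat
   and unbounded. A scalar variable is a cell of an array. Programs contain
   only integer and rational constants, and there is no floor operation from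
   the reals to the integers. *)
Inductive iexp : Type :=
| ICst of nat
| IGet of nat & iexp
| IAdd of iexp & iexp
| ISub of iexp & iexp
| IMul of iexp & iexp.

Inductive rexp : Type :=
| RCst of rat
| RGet of nat & iexp
| RNat of iexp
| RAdd of rexp & rexp
| RSub of rexp & rexp
| RMul of rexp & rexp
| RDiv of rexp & rexp
| RSqrt of rexp.

Inductive bexp : Type :=
| BILt of iexp & iexp
| BRLt of rexp & rexp
| BNot of bexp.

Inductive cmd : Type :=
| Skip
| IPut of nat & iexp & iexp
| RPut of nat & iexp & rexp
| Draw of nat & iexp & iexp
| Seq of cmd & cmd
| If of bexp & cmd & cmd
| While of bexp & cmd.

(* [clock] counts the elementary operations executed so far; programs cannot
   read it. *)
Record state (R : realType) : Type := State {
  imem : nat -> nat -> nat;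
  rmem : nat -> nat -> R;
  clock : nat }.

Definition upd (A : Type) (m : nat -> nat -> A) (a i : nat) (v : A)
    : nat -> nat -> A :=
  fun b j => if (b == a) && (j == i) then v else m b j.

Definition tick (R : realType) (c : nat) (s : state R) : state R :=
  State (imem s) (rmem s) (clock s + c).

Definition iput (R : realType) (a i v : nat) (s : state R) : state R :=
  State (upd (imem s) a i v) (rmem s) (clock s).

Definition rput (R : realType) (a i : nat) (v : R) (s : state R) : state R :=
  State (imem s) (upd (rmem s) a i v) (clock s).

Fixpoint ieval (R : realType) (s : state R) (e : iexp) : nat :=
  match e with
  | ICst k => k
  | IGet a e1 => imem s a (ieval s e1)
  | IAdd e1 e2 => (ieval s e1 + ieval s e2)%N
  | ISub e1 e2 => (ieval s e1 - ieval s e2)%N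
  | IMul e1 e2 => (ieval s e1 * ieval s e2)%N
  end.

Fixpoint reval (R : realType) (s : state R) (e : rexp) : R :=
  match e with
  | RCst q => ratr q
  | RGet a e1 => rmem s a (ieval s e1)
  | RNat e1 => (ieval s e1)%:R
  | RAdd e1 e2 => reval s e1 + reval s e2
  | RSub e1 e2 => reval s e1 - reval s e2
  | RMul e1 e2 => reval s e1 * reval s e2
  | RDiv e1 e2 => reval s e1 / reval s e2
  | RSqrt e1 => Num.sqrt (reval s e1)
  end.

Fixpoint beval (R : realType) (s : state R) (e : bexp) : bool :=
  match e with
  | BILt e1 e2 => (ieval s e1 < ieval s e2)%N
  | BRLt e1 e2 => reval s e1 < reval s e2
  | BNot e1 => ~~ beval s e1
  end.

(* Every constant, memory access and operation in an expression has cost 1. *)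
Fixpoint icost (e : iexp) : nat :=
  match e with
  | ICst _ => 1
  | IGet _ e1 => (icost e1).+1
  | IAdd e1 e2 | ISub e1 e2 | IMul e1 e2 => (icost e1 + icost e2).+1
  end.

Fixpoint rcost (e : rexp) : nat :=
  match e with
  | RCst _ => 1
  | RGet _ e1 | RNat e1 => (icost e1).+1
  | RAdd e1 e2 | RSub e1 e2 | RMul e1 e2 | RDiv e1 e2 =>
      (rcost e1 + rcost e2).+1
  | RSqrt e1 => (rcost e1).+1
  end.

Fixpoint bcost (e : bexp) : nat :=
  match e with
  | BILt e1 e2 => (icost e1 + icost e2).+1
  | BRLt e1 e2 => (rcost e1 + rcost e2).+1
  | BNot e1 => (bcost e1).+1
  end.

(* [fuel] bounds the number of tests made by each execution of a loop; it only
   makes the definition structurally recursive, and a run that exhausts it ends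
   in [None]. [Draw a i m] stores in cell i of integer array a a uniform
   element of {0, ..., m}, independent of the earlier draws. *)
Fixpoint run (R : realType) (fuel : nat) (c : cmd) (s : state R)
    : rtree (option (state R)) :=
  match c with
  | Skip => Leaf (Some (tick 1 s))
  | IPut a i e =>
      Leaf (Some (tick (icost i + icost e).+1
                    (iput a (ieval s i) (ieval s e) s)))
  | RPut a i e =>
      Leaf (Some (tick (icost i + rcost e).+1
                    (rput a (ieval s i) (reval s e) s)))
  | Draw a i m =>
      Unif (fun v : 'I_(ieval s m).+1 =>
        Leaf (Some (tick (icost i + icost m).+1 (iput a (ieval s i) v s))))
  | Seq c1 c2 => rbind (run fuel c1 s) (run fuel c2)
  | If b c1 c2 =>
      if beval s b then run fuel c1 (tick (bcost b) s)
      else run fuel c2 (tick (bcost b) s)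
  | While b c1 =>
      (fix loop (k : nat) (s : state R) : rtree (option (state R)) :=
         match k with
         | 0%N => Leaf None
         | k'.+1 =>
             if beval s b
             then rbind (run fuel c1 (tick (bcost b) s)) (loop k')
             else Leaf (Some (tick (bcost b) s))
         end) fuel s
  end.

(** * Input and output conventions *)

(* The positions of the nonzero entries, in row-major order. *)
Definition entries (R : realType) (n d : nat) (x : 'I_n -> 'cV[R]_d)
    : seq ('I_n * 'I_d) :=
  [seq ij <- [seq (i, j) | i <- enum 'I_n, j <- enum 'I_d]
  | x ij.1 ij.2 0 != 0].

(* The data are given in sparse form:
     integer array 0 : n, d, and the number of nonzero entries;
     integer array 1 : cell i holds the position in [entries x] of the first
                       entry of row i (row i ends where row i+1 starts);
     integer array 2 : the rows of the nonzero entries;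
     integer array 3 : the columns of the nonzero entries;
     real array 0    : the values of the nonzero entries;
     real array 1    : the estimate of the eigengap, in cell 0.
   All other cells contain 0. *)
Definition init_state (R : realType) (n d : nat) (x : 'I_n -> 'cV[R]_d)
    (hdelta : R) : state R :=
  State
    (fun a i => match a with
       | 0 => nth 0 [:: n; d; nnz x] i
       | 1 => count (fun ij : 'I_n * 'I_d => ij.1 < i) (entries x)
       | 2 => nth 0 [seq nat_of_ord ij.1 | ij <- entries x] i
       | 3 => nth 0 [seq nat_of_ord ij.2 | ij <- entries x] i
       | _ => 0
       end)%N
    (fun a i => match a with
       | 0%N => nth 0 [seq x ij.1 ij.2 0 | ij <- entries x] i
       | 1%N => nth 0 [:: hdelta] i
       | _ => 0
       end)
    0.

(* The answer is read from the first d cells of real array 2. *)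
Definition output (R : realType) (d : nat) (s : state R) : 'cV[R]_d :=
  \col_(j < d) rmem s 2 j.

(* Main.v *)
Require Import Defs.
From mathcomp Require Import all_boot all_order all_algebra.
From mathcomp Require Import all_classical reals exp.
From mathcomp Require Import ring lra zify.
(** The algorithm is a power method for the inverse of a shifted matrix
    sigma - X, where X is the covariance matrix and sigma is slightly larger
    than its top eigenvalue lambda_1. Write g = sigma - lambda_1. If g is at
    most the eigengap delta, then (sigma - X)^-1 multiplies the component along
    u by 1/g and is at most 1/(g + delta) <= 1/(2g) on the orthogonal
    complement, so that logarithmically many multiplications suffice. Two things
    remain to be found: a cheap approximate multiplication by the inverse, and
    the shift sigma.

    Multiplication by the inverse means solving (sigma - X) z = w. This is done
    in epochs of stochastic gradient steps with variance reduction. An epoch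
    computes the exact residual of its reference point once, in time
    proportional to the number of nonzero entries, and then makes T steps, each
    of which replaces X by x_i x_i^T for one random row i. The random matrix is
    applied only to the displacement from the reference point, so the noise
    shrinks along with the error. If g is at least a constant times delta, a
    number T of order delta^-2 of steps of cost d halves the expected squared
    error ([svrg_epoch_contract]); this is where d/delta^2 comes from. After
    logarithmically many epochs, Markov's inequality gives a tiny relative
    error with high probability ([solve_pr]).

    The shift is lowered in stages, starting from sigma = 2. A stage runs the
    power method from a random start vector. The ratio of the norms of the last
    two iterates lies between g/2 and 2g, because the norms of exact
    iterates form a log-convex sequence ([power_ratio], [gap_estimate]).
    Subtracting a quarter of that ratio from sigma and adding theta/16, where
    theta <= delta is a rescaled estimate of the gap, maps g into the interval from
    g/2 + theta/16 to 7g/8 + theta/16: the shift never gets closer than theta/16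
    to lambda_1, and after logarithmically many stages g <= delta. The iterate
    of the last stage is then the answer ([accurate], [stages_pr]).

    The start vector has independent coordinates uniform in 0, ..., m. Its
    component along u is not small, except with probability 1/(m+1), because
    that is already so when all coordinates are fixed but one at which u is
    large ([anticoncentration]).

    All this concerns a process that draws from finite uniform distributions. A
    small program logic shows that the tree of the runs of a program branches
    exactly like the tree of this process, with the outcome of the process in
    memory at the end ([main_sim]). The lengths of all loops are independent of
    the draws, or bounded in terms of d, so the time bound holds surely. *)

Import Order.TTheory GRing.Theory Num.Theory.
Local Open Scope ring_scope.

Set Implicit Arguments.
Unset Strict Implicit.
Unset Printing Implicit Defensive.

(** * Inner products and the spectral theorem *)
Section InnerProduct.
Variables (R : realType) (d : nat).
Implicit Types (u v w : 'cV[R]_d) (A : 'M[R]_d).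

Definition dot u v : R := (u^T *m v) 0 0.

Lemma dotE u v : dot u v = \sum_j u j 0 * v j 0.
Proof. by rewrite /dot !mxE; apply: eq_bigr => j _; rewrite !mxE. Qed.

Lemma dotC u v : dot u v = dot v u.
Proof. by rewrite !dotE; apply: eq_bigr => j _; rewrite mulrC. Qed.

Lemma dotDr u v w : dot u (v + w) = dot u v + dot u w.
Proof. by rewrite /dot mulmxDr mxE. Qed.

Lemma dotDl u v w : dot (v + w) u = dot v u + dot w u.
Proof. by rewrite ![dot _ u]dotC dotDr. Qed.

Lemma dotZr a u v : dot u (a *: v) = a * dot u v.
Proof. by rewrite /dot -scalemxAr mxE. Qed.

Lemma dotZl a u v : dot (a *: v) u = a * dot v u.
Proof. by rewrite ![dot _ u]dotC dotZr. Qed.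

Lemma dotNr u v : dot u (- v) = - dot u v.
Proof. by rewrite -scaleN1r dotZr mulN1r. Qed.

Lemma dotNl u v : dot (- v) u = - dot v u.
Proof. by rewrite -scaleN1r dotZl mulN1r. Qed.

Lemma dot0r u : dot u 0 = 0.
Proof. by rewrite -(scale0r 0) dotZr mul0r. Qed.

Lemma dot_sumr (I : finType) u (F : I -> 'cV[R]_d) :
  dot u (\sum_i F i) = \sum_i dot u (F i).
Proof. by apply: (big_morph (dot u)) => [v w|]; rewrite ?dotDr ?dot0r. Qed.

Lemma dot_mulmx A u v : dot u (A *m v) = dot (A^T *m u) v.
Proof. by rewrite /dot trmx_mul trmxK mulmxA. Qed.

Lemma dotvv_ge0 v : 0 <= dot v v.
Proof. by rewrite dotE; apply: sumr_ge0 => j _; rewrite -expr2 sqr_ge0. Qed.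

Lemma dotvv_eq0 v : dot v v = 0 -> v = 0.
Proof.
rewrite dotE => /eqP; rewrite psumr_eq0 => [/allP h|j _]; last first.
  by rewrite -expr2 sqr_ge0.
apply/colP => j; rewrite mxE; apply/eqP.
by have := h j (mem_index_enum j); rewrite mulf_eq0 orbb.
Qed.

Lemma dotvvD u v : dot (u + v) (u + v) = dot u u + 2 * dot u v + dot v v.
Proof. by rewrite !dotDr !dotDl (dotC v u); ring. Qed.

Lemma dotvvD_le u v : dot (u + v) (u + v) <= 2 * dot u u + 2 * dot v v.
Proof.
have := dotvv_ge0 (u - v); rewrite dotvvD dotNr dotNr dotNl dotvvD; lra.
Qed.

Lemma cauchy_schwarz u v : dot u v ^+ 2 <= dot u u * dot v v.
Proof.
have [v0|v0] := eqVneq (dot v v) 0.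
  by rewrite (dotvv_eq0 v0) !dot0r expr0n mulr0.
have vp : 0 < dot v v by rewrite lt0r v0 dotvv_ge0.
have := dotvv_ge0 (dot v v *: u - dot u v *: v).
rewrite dotvvD !(dotNr, dotNl, dotZr, dotZl) => h.
have {}h : 0 <= dot v v * (dot u u * dot v v - dot u v ^+ 2).
  by apply: le_trans h _; rewrite le_eqVlt; apply/orP; left; apply/eqP; ring.
by rewrite -subr_ge0 -(pmulr_rge0 _ vp).
Qed.

Lemma enormE v : enorm v = Num.sqrt (dot v v).
Proof. by rewrite /enorm dotE; congr Num.sqrt; apply: eq_bigr => j _. Qed.

Lemma enorm_ge0 v : 0 <= enorm v.
Proof. by rewrite enormE sqrtr_ge0. Qed.

Lemma sqr_enorm v : enorm v ^+ 2 = dot v v.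
Proof. by rewrite enormE sqr_sqrtr ?dotvv_ge0. Qed.

Lemma ler_dot_enorm u v : `|dot u v| <= enorm u * enorm v.
Proof.
rewrite -(@ler_pXn2r _ 2) ?nnegrE ?normr_ge0 ?mulr_ge0 ?enorm_ge0 //.
by rewrite exprMn !sqr_enorm real_normK ?num_real// cauchy_schwarz.
Qed.

Lemma ler_enormD u v : enorm (u + v) <= enorm u + enorm v.
Proof.
rewrite -(@ler_pXn2r _ 2) ?nnegrE ?addr_ge0 ?enorm_ge0 //.
rewrite sqrrD !sqr_enorm dotvvD.
have := ler_dot_enorm u v; have := ler_norm (dot u v); lra.
Qed.

Lemma enormZ a v : enorm (a *: v) = `|a| * enorm v.
Proof.
by rewrite !enormE dotZl dotZr mulrA -expr2 sqrtrM ?sqr_ge0 // sqrtr_sqr.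
Qed.

Lemma enormN v : enorm (- v) = enorm v.
Proof. by rewrite -scaleN1r enormZ normrN1 mul1r. Qed.

Lemma ler_enormB u v : enorm u - enorm v <= enorm (u + v).
Proof.
rewrite lerBlDr; have := ler_enormD (u + v) (- v).
by rewrite enormN addrK.
Qed.

Lemma enorm0 : enorm (0 : 'cV[R]_d) = 0.
Proof. by rewrite enormE dot0r sqrtr0. Qed.

End InnerProduct.

Section Spectral.
Variable R : realType.

(** The reflection along v - e, where e is the first basis vector, exchanges
    the unit vectors v and e. *)
Lemma householder d (v : 'rV[R]_d.+1) : (v *m v^T) 0 0 = 1 ->
  exists H : 'M[R]_d.+1, [/\ H^T = H, H *m H = 1%:M &
    delta_mx 0 0 *m H = v].
Proof.
move=> v1; have [ve|vne] := eqVneq (delta_mx 0 0) v.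
  by exists 1%:M; rewrite trmx1 !mulmx1 ve.
set e := delta_mx 0 0 : 'rV_d.+1; pose w := v - e.
have vv : v *m v^T = 1%:M by apply/matrixP => i j; rewrite !ord1 v1 mxE.
have ee : e *m e^T = 1%:M :> 'M[R]_1.
  by rewrite trmx_delta mul_delta_mx; apply/matrixP => i j; rewrite !ord1 !mxE.
have ev : e *m v^T = (v 0 0)%:M :> 'M[R]_1.
  by apply/matrixP => i j; rewrite !ord1 -rowE !mxE.
have ve : v *m e^T = (v 0 0)%:M :> 'M[R]_1.
  by rewrite -[v *m _]trmxK trmx_mul trmxK ev tr_scalar_mx.
set c := v 0 0 in ev ve.
have ww : w *m w^T = (2 - 2 * c)%:M.
  rewrite /w linearB /= mulmxBr !mulmxBl vv ve ev ee -!raddfB /=.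
  by congr (_ %:M); ring.
have ew : e *m w^T = (c - 1)%:M.
  by rewrite /w linearB /= mulmxBr ev ee -raddfB.
have c1 : 1 - c != 0.
  apply/eqP => c10; have w0 : w *m w^T = 0.
    by rewrite ww -{1}[2]mulr1 -mulrBr c10 mulr0 raddf0.
  case/eqP: vne; apply/esym/eqP; rewrite -subr_eq0 -/w; apply/eqP.
  have := @dotvv_eq0 _ _ w^T; rewrite /dot trmxK w0 mxE => /(_ erefl) h.
  by rewrite -[w]trmxK h trmx0.
pose k := (1 - c)^-1.
have kc : k * (2 - 2 * c) = 2 by rewrite /k; field.
exists (1%:M - k *: (w^T *m w)); split.
- by rewrite linearB /= trmx1 linearZ /= trmx_mul trmxK.
- have PP : w^T *m w *m (w^T *m w) = (2 - 2 * c) *: (w^T *m w).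
    by rewrite -mulmxA (mulmxA w) ww mul_scalar_mx -scalemxAr.
  rewrite mulmxBr mulmx1 mulmxBl mul1mx -scalemxAl -scalemxAr PP !scalerA.
  by rewrite -mulrA kc mulr2n mulrDr !mulr1 scalerDl opprB addrK subrK.
- rewrite mulmxBr mulmx1 -scalemxAr mulmxA ew mul_scalar_mx scalerA.
  rewrite (_ : k * (c - 1) = -1); last by rewrite /k; field.
  by rewrite scaleN1r opprK /w addrC subrK.
Qed.

Lemma char_poly_conj d (H A : 'M[R]_d) : H *m H = 1%:M ->
  char_poly (H *m A *m H) = char_poly A.
Proof.
move=> HH; rewrite /char_poly /char_poly_mx.
set Hx := map_mx polyC H.
have HHx : Hx *m Hx = 1%:M by rewrite -map_mxM HH map_mx1.
rewrite !map_mxM -/Hx.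
have -> : 'X%:M - Hx *m map_mx polyC A *m Hx
        = Hx *m ('X%:M - map_mx polyC A) *m Hx.
  by rewrite mulmxBr mulmxBl scalar_mxC -[_%:M *m Hx *m Hx]mulmxA HHx mulmx1.
rewrite !det_mulmx mulrC mulrA -det_mulmx HHx det1 mul1r //.
Qed.

Lemma char_poly_block d (l : R) (B : 'M[R]_d) :
  char_poly (block_mx l%:M 0 0 B : 'M_(1 + d)) = ('X - l%:P) * char_poly B.
Proof.
rewrite /char_poly /char_poly_mx map_block_mx !map_mx0 map_scalar_mx /=.
rewrite -[('X%:M : 'M_(1 + d))]/(scalar_mx 'X) scalar_mx_block opp_block_mx.
by rewrite add_block_mx !subr0 det_ublock -raddfB /= det_scalar1.
Qed.

(** Deflation. A reflection H carries the first basis vector to a unit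
    eigenvector of A for an eigenvalue l. By symmetry the first row and the first
    column of H A H both vanish off the diagonal, and the remaining block has
    the characteristic polynomial of A with the factor 'X - l removed. *)
Lemma symmetric_diagonalizable d (A : 'M[R]_d) (lam : seq R) : A^T = A ->
  char_poly A = \prod_(l <- lam) ('X - l%:P) ->
  exists Q : 'M[R]_d, [/\ Q^T *m Q = 1%:M, Q *m Q^T = 1%:M &
    A = Q *m diag_mx (\row_i lam`_i) *m Q^T].
Proof.
elim: d A lam => [|d IH] A lam symA charA.
  by exists 1%:M; rewrite trmx1 mul1mx !mulmx1; split=> //; apply/matrixP => - [].
have := congr1 (fun p : {poly R} => size p) charA.
rewrite size_char_poly size_prod_XsubC => -[].
case: lam charA => [//|l lam] charA /= [slam].
have : eigenvalue A l.
  by rewrite eigenvalue_root_char charA root_prod_XsubC mem_head.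
case/eigenvalueP => v0 Av0 v0n.
have vp : 0 < dot v0^T v0^T.
  rewrite lt0r dotvv_ge0 andbT; apply: contra v0n => /eqP/dotvv_eq0 h.
  by rewrite -[v0]trmxK h trmx0.
pose v := (Num.sqrt (dot v0^T v0^T))^-1 *: v0.
have v1 : (v *m v^T) 0 0 = 1.
  rewrite /v linearZ /= -scalemxAl -scalemxAr !mxE -[X in _ * (_ * X)]/(\sum_j _).
  have -> : \sum_j v0 0 j * v0^T j 0 = dot v0^T v0^T.
    by rewrite dotE; apply: eq_bigr => j _; rewrite !mxE.
  by rewrite mulrA -invfM -expr2 sqr_sqrtr ?ltW // mulVf // gt_eqF.
have Av : v *m A = l *: v by rewrite /v -scalemxAl Av0 !scalerA mulrC.
have [H [HT HH eH]] := householder v1.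
have [M [MT eM charM AM]] : exists M : 'M[R]_(1 + d), [/\ M^T = M,
    delta_mx 0 0 *m M = l *: delta_mx 0 0 :> 'rV_(1 + d),
    char_poly M = char_poly A & A = H *m M *m H].
  exists (H *m A *m H); split.
  - by rewrite !trmx_mul HT symA mulmxA.
  - by rewrite !mulmxA eH Av -scalemxAl -eH -mulmxA HH mulmx1.
  - exact: char_poly_conj.
  - by rewrite !mulmxA HH mul1mx -mulmxA HH mulmx1.
have Mblock : M = block_mx l%:M 0 0 (drsubmx M).
  have rM j : M 0 j = l * (j == 0)%:R.
    have := congr1 (fun B : 'rV_(1 + d) => B 0 j) eM.
    by rewrite -rowE !mxE eqxx.
  have cM j : M j 0 = l * (j == 0)%:R by rewrite -MT mxE rM.
  have l0 : lshift d 0 = 0 :> 'I_(1 + d) by exact: val_inj.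
  rewrite -[LHS]submxK; congr block_mx; apply/matrixP => i j; rewrite ?ord1 !mxE.
  - by rewrite l0 rM eqxx mulr1 mulr1n.
  - by rewrite l0 rM -val_eqE /= mulr0.
  - by rewrite l0 cM -val_eqE /= mulr0.
pose B := drsubmx M.
have BT : B^T = B by rewrite /B trmx_drsub MT.
have charB : char_poly B = \prod_(l <- lam) ('X - l%:P).
  move: charM; rewrite charA big_cons Mblock char_poly_block.
  by move/(mulfI (negbT (polyXsubC_eq0 l))).
have [Q [QQ QQ' BQ]] := IH B lam BT charB.
pose Q1 : 'M[R]_(1 + d) := block_mx 1%:M 0 0 Q.
have Q1T : Q1^T = block_mx 1%:M 0 0 Q^T by rewrite tr_block_mx trmx1 !trmx0.
have QQ1 : Q1^T *m Q1 = 1%:M.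
  rewrite Q1T mulmx_block !mulmx0 !mul0mx !addr0 !add0r mulmx1 QQ.
  by rewrite -scalar_mx_block.
have QQ1' : Q1 *m Q1^T = 1%:M.
  rewrite Q1T mulmx_block !mulmx0 !mul0mx !addr0 !add0r mulmx1 QQ'.
  by rewrite -scalar_mx_block.
have D1 : diag_mx (\row_i (l :: lam)`_i)
    = block_mx l%:M 0 0 (diag_mx (\row_i lam`_i)) :> 'M[R]_(1 + d).
  rewrite (_ : \row_i _ = row_mx l%:M (\row_i lam`_i) :> 'rV[R]_(1 + d)); last first.
    apply/rowP => i; rewrite !mxE; case: splitP => j ->; rewrite !mxE //=.
    by rewrite !ord1 eqxx.
  rewrite diag_mx_row; congr block_mx.
  by apply/matrixP => i j; rewrite !ord1 !mxE eqxx.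
exists (H *m Q1); split.
- by rewrite trmx_mul HT -mulmxA (mulmxA H) HH mul1mx.
- by rewrite trmx_mul HT -mulmxA (mulmxA Q1) QQ1' mul1mx.
- have MQ : M = Q1 *m block_mx l%:M 0 0 (diag_mx (\row_i lam`_i)) *m Q1^T.
    rewrite Q1T !mulmx_block !(mulmx0, mul0mx, addr0, add0r, mulmx1, mul1mx).
    by rewrite -BQ.
  by rewrite D1 trmx_mul HT [LHS]AM MQ !mulmxA.
Qed.

Lemma sorted_ge_nth (lam : seq R) i j :
  sorted (fun a b => b <= a) lam -> (i <= j < size lam)%N -> lam`_j <= lam`_i.
Proof.
move=> slam /andP[ij jl].
by apply: (sorted_leq_nth (leT := fun a b => b <= a)) => //;
  rewrite ?inE //; [move=> a b c ab bc; exact: le_trans bc ab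
    | exact: leq_ltn_trans jl].
Qed.

(** In an eigenbasis the strict gap forces u to lie on the first coordinate
    axis, so a vector orthogonal to u has no first coordinate. *)
Lemma rayleigh_orthogonal d (A : 'M[R]_d) (lam : seq R) (u v : 'cV[R]_d) :
  A^T = A -> eigenvalues_of A lam -> lam`_1 < lam`_0 ->
  dot u u = 1 -> A *m u = lam`_0 *: u -> dot u v = 0 ->
  dot v (A *m v) <= lam`_1 * dot v v.
Proof.
move=> symA [charA slam] gap uu Au uv.
have slamd : size lam = d.
  by have := congr1 (fun p : {poly R} => size p) charA;
     rewrite size_char_poly size_prod_XsubC => -[].
have [Q [QQ QQ' AQ]] := symmetric_diagonalizable symA charA.
set D := diag_mx _ in AQ.
pose a := Q^T *m u; pose c := Q^T *m v.
have dotQ x y : dot (Q^T *m x) (Q^T *m y) = dot x y.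
  by rewrite dot_mulmx trmxK mulmxA QQ' mul1mx.
have le1 (i : 'I_d) : val i != 0%N -> lam`_i <= lam`_1.
  by move=> i0; apply: sorted_ge_nth => //; rewrite slamd ltn_ord andbT lt0n.
have a0 (i : 'I_d) : val i != 0%N -> a i 0 = 0.
  move=> i0.
  have : Q^T *m (A *m u) = lam`_0 *: a by rewrite Au -scalemxAr.
  rewrite AQ -!mulmxA mulmxA QQ mul1mx => /(congr1 (fun x : 'cV_d => x i 0)).
  rewrite mul_diag_mx !mxE => /eqP; rewrite -subr_eq0 -mulrBl mulf_eq0.
  rewrite [X in X || _]lt_eqF /= => [/eqP ai|]; last first.
    by rewrite subr_lt0; apply: le_lt_trans gap; apply: le1.
  exact: ai.
have c0 (i : 'I_d) : val i == 0%N -> c i 0 = 0.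
  move=> i0.
  have e0 (w : 'cV[R]_d) : dot a w = a i 0 * w i 0.
    rewrite dotE (bigD1 i) //= big1 ?addr0 // => j ji; rewrite a0 ?mul0r //.
    by apply: contra ji => /eqP j0; apply/eqP/val_inj; rewrite j0 (eqP i0).
  have aa : a i 0 * a i 0 = 1 by rewrite -e0 dotQ.
  have : a i 0 * c i 0 = 0 by rewrite -e0 dotQ.
  move/eqP; rewrite mulf_eq0 => /orP[/eqP ai|/eqP//].
  by move: aa; rewrite ai mulr0 => /esym/eqP; rewrite oner_eq0.
have -> : dot v v = dot c c by rewrite dotQ.
have -> : dot v (A *m v) = dot c (D *m c).
  by rewrite AQ -!mulmxA dot_mulmx.
rewrite !dotE mulr_sumr; apply: ler_sum => i _.
rewrite mul_diag_mx !mxE mulrCA; have [i0|i0] := boolP (val i == 0%N).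
  by have := c0 i i0; rewrite !mxE => ->; rewrite !mul0r !mulr0.
by apply: ler_wpM2r; [rewrite -expr2 sqr_ge0 | apply: le1].
Qed.

Lemma eigenvalue_quadratic_form d (A : 'M[R]_d) (lam : seq R) (i : 'I_d) :
  A^T = A -> eigenvalues_of A lam ->
  exists q : 'cV[R]_d, dot q q = 1 /\ dot q (A *m q) = lam`_i.
Proof.
move=> symA [charA slam].
have [Q [QQ QQ' AQ]] := symmetric_diagonalizable symA charA.
set D := diag_mx _ in AQ.
have dotd (B : 'M[R]_d) : dot (delta_mx i 0) (B *m delta_mx i 0) = B i i.
  by rewrite /dot trmx_delta mulmxA -rowE -colE !mxE.
exists (Q *m delta_mx i 0); split.
  by rewrite dot_mulmx mulmxA QQ mul1mx -[X in dot _ X]mul1mx dotd mxE eqxx.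
have -> : A *m (Q *m (delta_mx i 0 : 'cV_d)) = Q *m (D *m delta_mx i 0).
  by rewrite {1}AQ -!mulmxA (mulmxA Q^T) QQ mul1mx.
by rewrite dot_mulmx !mulmxA QQ mul1mx dotd // !mxE eqxx mulr1n.
Qed.
End Spectral.

(** * Random processes *)
Section RandomTrees.
Variable R : realType.

Fixpoint tbind (A B : Type) (t : rtree A) (f : A -> rtree B) : rtree B :=
  match t with
  | Leaf a => f a
  | Unif m g => Unif (fun i => tbind (g i) f)
  end.

Fixpoint iterT (A : Type) (k : nat) (f : A -> rtree A) (a : A) : rtree A :=
  if k is k'.+1 then tbind (f a) (iterT k' f) else Leaf a.

Lemma iterTS A k (f : A -> rtree A) a : iterT k.+1 f a = tbind (f a) (iterT k f).
Proof. by []. Qed.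

Fixpoint Ex (A : Type) (t : rtree A) (phi : A -> R) : R :=
  match t with
  | Leaf a => phi a
  | Unif m g => m.+1%:R^-1 * \sum_(i < m.+1) Ex (g i) phi
  end.

Lemma Ex_bind A B (t : rtree A) (f : A -> rtree B) phi :
  Ex (tbind t f) phi = Ex t (fun a => Ex (f a) phi).
Proof.
by elim: t => //= m g IH; congr (_ * _); apply: eq_bigr => i _; apply: IH.
Qed.

Lemma le_Ex A (t : rtree A) phi psi :
  (forall a, phi a <= psi a) -> Ex t phi <= Ex t psi.
Proof.
move=> le; elim: t => //= m g IH; apply: ler_wpM2l; first by rewrite invr_ge0.
by apply: ler_sum => i _; apply: IH.
Qed.

Lemma eq_Ex A (t : rtree A) phi psi : phi =1 psi -> Ex t phi = Ex t psi.
Proof.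
by move=> e; apply/le_anti/andP; split; apply: le_Ex => a; rewrite e.
Qed.

Lemma ExD A (t : rtree A) phi psi :
  Ex t (fun a => phi a + psi a) = Ex t phi + Ex t psi.
Proof.
elim: t => //= m g IH; rewrite -mulrDr -big_split /=; congr (_ * _).
by apply: eq_bigr => i _; apply: IH.
Qed.

Lemma ExZ A (t : rtree A) c phi : Ex t (fun a => c * phi a) = c * Ex t phi.
Proof.
elim: t => //= m g IH; rewrite mulrCA [X in _ = _ * X]mulr_sumr; congr (_ * _).
by apply: eq_bigr => i _; apply: IH.
Qed.

Lemma Ex_cst A (t : rtree A) c : Ex t (fun _ => c) = c.
Proof.
elim: t => //= m g IH; rewrite (eq_bigr (fun _ => c)) => [|i _]; last exact: IH.
by rewrite sumr_const card_ord -[c *+ _]mulr_natl mulrA mulVf ?mul1r ?pnatr_eq0.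
Qed.

Lemma Ex_sum A (t : rtree A) (I : finType) (F : I -> A -> R) :
  Ex t (fun a => \sum_i F i a) = \sum_i Ex t (F i).
Proof.
elim: t => //= m g IH; rewrite -mulr_sumr exchange_big; congr (_ * _).
by apply: eq_bigr => i _; apply: IH.
Qed.

Lemma Ex_ge0 A (t : rtree A) phi : (forall a, 0 <= phi a) -> 0 <= Ex t phi.
Proof. by move=> h; rewrite -(Ex_cst t 0); apply: le_Ex. Qed.

Definition pr A (t : rtree A) (P : A -> Prop) : R := Ex t (fun a => `[< P a >]%:R).

(** For c = 0, where one cannot divide by c, the expectation of phi vanishes, so
    that phi is zero at every outcome. *)
Lemma markov A (t : rtree A) (phi : A -> R) c q :
  (forall a, 0 <= phi a) -> 0 <= c -> 0 <= q -> Ex t phi <= q * c ->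
  1 - q <= pr t (fun a => phi a <= c).
Proof.
move=> phi0 c0 q0; have [-> h|cn h] := eqVneq c 0.
  have {}h : Ex t phi = 0.
    by apply/le_anti; rewrite Ex_ge0 // andbT (le_trans h) ?mulr0.
  rewrite (_ : pr _ _ = 1) ?gerBl // /pr.
  elim: t h => [a|m g IH] /=.
    by move=> ->; rewrite asboolT.
  move/eqP; rewrite mulf_eq0 invr_eq0 pnatr_eq0 orFb psumr_eq0 => [/allP h|i _];
    last exact: Ex_ge0.
  rewrite (eq_bigr (fun _ => 1)) => [|i _].
    by rewrite sumr_const card_ord mulVf ?pnatr_eq0.
  by apply: IH; apply/eqP; apply: (h i); rewrite mem_index_enum.
have cp : 0 < c by rewrite lt0r cn.
rewrite lerBlDr -(Ex_cst t 1).
apply: le_trans (_ : Ex t (fun a => (`[< phi a <= c >])%:R + c^-1 * phi a) <= _).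
  apply: le_Ex => a; case: asboolP => [_|/negP]; first by
    rewrite -[X in X <= _]addr0 lerD2l mulr_ge0 ?invr_ge0.
  by rewrite -ltNge add0r => h'; rewrite ler_pdivlMl // mulr1 ltW.
rewrite ExD ExZ lerD2l ler_pdivrMl // mulrC //.
Qed.

Lemma pr_bind A B (t : rtree A) (f : A -> rtree B) (P : A -> Prop)
    (Q : B -> Prop) p q :
  1 - p <= pr t P -> (forall a, P a -> 1 - q <= pr (f a) Q) -> 0 <= q ->
  1 - (p + q) <= pr (tbind t f) Q.
Proof.
move=> tP fQ q0; rewrite /pr Ex_bind.
apply: le_trans (_ : Ex t (fun a => `[< P a >]%:R - q) <= _); last first.
  apply: le_Ex => a; case: asboolP => [/fQ //|_].
  rewrite sub0r; apply: le_trans (_ : 0 <= _); first by rewrite oppr_le0.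
  by apply: Ex_ge0 => b; apply: ler0n.
by rewrite ExD Ex_cst opprD addrA lerD2r.
Qed.

(** Union bound along a chain in which each step is good only conditionally on
    the invariant established by the steps before it. *)
Lemma pr_iterT A k (f : A -> rtree A) (P : nat -> A -> Prop) q a :
  0 <= q ->
  (forall j b, (j < k)%N -> P j b -> 1 - q <= pr (f b) (P j.+1)) ->
  P 0%N a -> 1 - k%:R * q <= pr (iterT k f a) (P k).
Proof.
move=> q0; elim: k P a => [|k IH] P a fP Pa /=.
  by rewrite mul0r subr0 /pr /= asboolT.
rewrite -(addn1 k) natrD mulrDl mul1r [_ + q]addrC.
apply: pr_bind; first exact: (fP 0%N).
  move=> b Pb; rewrite addn1; apply: (IH (fun j => P j.+1)) => // j c jk.
  exact: fP.
by rewrite mulr_ge0 ?ler0n.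
Qed.

Lemma pr_leaf A (a : A) (P : A -> Prop) q : 0 <= q -> P a ->
  1 - q <= pr (Leaf a) P.
Proof. by move=> q0 Pa; rewrite /pr /= asboolT // gerBl. Qed.

Lemma le_pr A (t : rtree A) (P Q : A -> Prop) :
  (forall a, P a -> Q a) -> pr t P <= pr t Q.
Proof.
move=> PQ; apply: le_Ex => a; case: asboolP => [/PQ Qa|_]; last exact: ler0n.
by rewrite asboolT.
Qed.

End RandomTrees.

(** * Solving a shifted system with variance-reduced gradient steps *)
Section SVRG.
Variables (R : realType) (n d : nat) (x : 'I_n.+1 -> 'cV[R]_d).
Hypothesis x1 : forall i, enorm (x i) <= 1.

Lemma covE v : cov x *m v = n.+1%:R^-1 *: \sum_i dot (x i) v *: x i.
Proof.
rewrite /cov -scalemxAl; congr (_ *: _); rewrite mulmx_suml.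
apply: eq_bigr => i _; rewrite -mulmxA.
rewrite (_ : (x i)^T *m v = (dot (x i) v)%:M) ?mul_mx_scalar //.
by apply/matrixP => a b; rewrite !ord1 [RHS]mxE eqxx mulr1n.
Qed.

Lemma dot_cov u v :
  dot u (cov x *m v) = n.+1%:R^-1 * \sum_i dot (x i) u * dot (x i) v.
Proof.
rewrite covE dotZr dot_sumr; congr (_ * _); apply: eq_bigr => i _.
by rewrite dotZr mulrC dotC.
Qed.

Lemma cov_sym : (cov x)^T = cov x.
Proof.
rewrite /cov linearZ /= linear_sum /=; congr (_ *: _); apply: eq_bigr => i _.
by rewrite trmx_mul trmxK.
Qed.

Lemma dotxx_le1 i : dot (x i) (x i) <= 1.
Proof. by rewrite -sqr_enorm expr_le1 // enorm_ge0. Qed.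

Lemma sqr_dotx_le i v : dot (x i) v ^+ 2 <= dot v v.
Proof.
apply: le_trans (cauchy_schwarz _ _) _.
by rewrite ler_piMl ?dotvv_ge0 ?dotxx_le1.
Qed.

Lemma avg_le (F : 'I_n.+1 -> R) c :
  (forall i, F i <= c) -> n.+1%:R^-1 * (\sum_i F i) <= c.
Proof.
move=> h; rewrite ler_pdivrMl ?ltr0n //.
apply: le_trans (ler_sum _ (fun i _ => h i)) _.
by rewrite sumr_const card_ord mulr_natl.
Qed.

Lemma dot_cov_ge0 v : 0 <= dot v (cov x *m v).
Proof.
rewrite dot_cov mulr_ge0 ?invr_ge0 ?ler0n //; apply: sumr_ge0 => i _.
by rewrite -expr2 sqr_ge0.
Qed.

Lemma dot_cov_le v : dot v (cov x *m v) <= dot v v.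
Proof. by rewrite dot_cov; apply: avg_le => i; rewrite -expr2 sqr_dotx_le. Qed.

(** Since dot w w with w = cov x *m v is the average of the products
    dot (x i) w * dot (x i) v, each of which is at most (|w|^2 + |v|^2) / 2. *)
Lemma cov_contract v : dot (cov x *m v) (cov x *m v) <= dot v v.
Proof.
set w := cov x *m v.
suff : dot w w <= (dot v v + dot w w) / 2 by lra.
rewrite -[X in X <= _]/(dot w (cov x *m v)) [X in X <= _]dot_cov; apply: avg_le => i.
have := sqr_dotx_le i v; have := sqr_dotx_le i w.
have := sqr_ge0 (dot (x i) v - dot (x i) w); nra.
Qed.

Variables (sigma eta mu : R).
Hypotheses (sigma_ge0 : 0 <= sigma) (sigma_le3 : sigma <= 3).
Hypotheses (eta_gt0 : 0 < eta) (mu_gt0 : 0 < mu) (eta_mu : 22 * eta <= mu).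
Hypothesis mu_le1 : mu <= 1.
Hypothesis strong : forall v, mu * dot v v <= dot v (sigma *: v - cov x *m v).

(** D is the displacement from a reference point with residual r. The exact
    gradient step for the system with matrix sigma - cov x would be
    D + eta (r - sigma D + cov x D); here x_i x_i^T stands in for cov x. *)
Definition svrg_step (r D : 'cV[R]_d) : rtree 'cV[R]_d :=
  Unif (fun i : 'I_n.+1 =>
    Leaf ((1 - eta * sigma) *: D + eta *: r + (eta * dot (x i) D) *: x i)).

(** Put f = e - D and M = sigma - cov x. The step replaces f by
    f - eta M f plus a centred noise, whose second moment is at most
    eta^2 |D|^2 <= 2 eta^2 (|e|^2 + |f|^2). The deterministic part has squared
    norm |f|^2 - 2 eta <f, M f> + eta^2 |M f|^2, with <f, M f> >= mu |f|^2 and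
    |M f|^2 <= 20 |f|^2 as sigma <= 3. Altogether the coefficient of |f|^2 is at
    most 1 - 2 eta mu + 22 eta^2 <= 1 - eta mu. *)
Lemma svrg_step_contract (e D : 'cV[R]_d) :
  Ex (svrg_step (sigma *: e - cov x *m e) D) (fun D' => dot (e - D') (e - D'))
  <= (1 - eta * mu) * dot (e - D) (e - D) + 2 * eta ^+ 2 * dot e e.
Proof.
set r := sigma *: e - cov x *m e.
pose c := e - ((1 - eta * sigma) *: D + eta *: r).
pose a i := dot (x i) D *: x i.
(* Bias and variance: the average of c - eta a_i is c - eta (cov x D). *)
have E1 : Ex (svrg_step r D) (fun D' => dot (e - D') (e - D'))
  = dot (c - eta *: (cov x *m D)) (c - eta *: (cov x *m D))
    + eta ^+ 2 * (n.+1%:R^-1 * (\sum_i dot (a i) (a i))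
                  - dot (cov x *m D) (cov x *m D)).
  rewrite /=.
  transitivity (n.+1%:R^-1 * (\sum_i (dot c c - 2 * eta * dot c (a i)
                   + eta ^+ 2 * dot (a i) (a i)))).
    congr (_ * _); apply: eq_bigr => i _.
    rewrite (_ : e - _ = c - eta *: a i); last first.
      by rewrite /c /a scalerA [in LHS]opprD addrA.
    by rewrite dotvvD !(dotNr, dotNl, dotZr, dotZl); ring.
  rewrite !big_split /= sumr_const card_ord -[dot c c *+ _]mulr_natl -mulr_sumr.
  rewrite sumrN -mulr_sumr.
  have -> : \sum_i dot c (a i) = n.+1%:R * dot c (cov x *m D).
    by rewrite covE dotZr dot_sumr mulrA divff ?pnatr_eq0 // mul1r.
  rewrite dotvvD !(dotNr, dotNl, dotZr, dotZl).
  have : n.+1%:R != 0 :> R by rewrite pnatr_eq0.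
  by move: (n.+1%:R) => N nz; field.
rewrite E1.
set f := e - D.
have -> : c - eta *: (cov x *m D) = f - eta *: (sigma *: f - cov x *m f).
  rewrite /c /f /r !(mulmxBr, scalerBr, scalerBl, scale1r, scalerA, opprD, opprB).
  by apply/matrixP => i j; rewrite !mxE; ring.
have aD : n.+1%:R^-1 * (\sum_i dot (a i) (a i)) <= dot D D.
  apply: avg_le => i; rewrite /a dotZl dotZr mulrA -expr2.
  apply: le_trans (sqr_dotx_le i D).
  by rewrite ler_piMr ?sqr_ge0 ?dotxx_le1.
have DD : dot D D <= 2 * dot e e + 2 * dot f f.
  have -> : D = e + - f by rewrite /f opprB addrC subrK.
  by apply: le_trans (dotvvD_le _ _) _; rewrite dotNl dotNr opprK.
have covD := dotvv_ge0 (cov x *m D).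
have Mf := strong f.
set g := sigma *: f - cov x *m f in Mf *.
have gg : dot g g <= 20 * dot f f.
  apply: le_trans (dotvvD_le _ _) _; rewrite dotNl dotNr opprK dotZl dotZr mulrA.
  have := cov_contract f.
  have : sigma * sigma * dot f f <= 9 * dot f f.
    apply: ler_wpM2r; first exact: dotvv_ge0.
    by have -> : 9 = 3 * 3 :> R by [rewrite -natrM]; apply: ler_pM.
  lra.
rewrite dotvvD !(dotNr, dotNl, dotZr, dotZl).
have ff := dotvv_ge0 f; have e2 : 0 <= eta ^+ 2 by exact: sqr_ge0.
have h1 : eta * (mu * dot f f) <= eta * dot f g by apply: ler_wpM2l => //; exact: ltW.
have h2 : eta ^+ 2 * dot g g <= eta ^+ 2 * (20 * dot f f) by apply: ler_wpM2l.
have h3 : eta ^+ 2 * (n.+1%:R^-1 * (\sum_i dot (a i) (a i)) -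
   dot (cov x *m D) (cov x *m D)) <= eta ^+ 2 * (2 * dot e e + 2 * dot f f).
  by apply: ler_wpM2l => //; apply: le_trans DD; apply: le_trans aD; rewrite gerBl.
have h4 : eta * (22 * eta) * dot f f <= eta * mu * dot f f.
  by apply: ler_wpM2r => //; apply: ler_wpM2l => //; exact: ltW.
apply: le_trans (lerD (lexx _) h3) _.
nra.
Qed.

Lemma eta_mu01 : 0 <= eta * mu <= 1.
Proof.
have eta1 : eta <= 1 by move: eta_gt0 eta_mu mu_le1; lra.
by apply/andP; split; [apply: mulr_ge0 | apply: mulr_ile1] => //; exact: ltW.
Qed.

(** The recursion of [svrg_step_contract] has the fixed point
    2 eta |e|^2 / mu. *)
Lemma svrg_steps_contract T (e D : 'cV[R]_d) :
  Ex (iterT T (svrg_step (sigma *: e - cov x *m e)) D)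
     (fun D' => dot (e - D') (e - D'))
  <= (1 - eta * mu) ^+ T * dot (e - D) (e - D)
     + 2 * eta / mu * dot e e * (1 - (1 - eta * mu) ^+ T).
Proof.
set a := 1 - eta * mu.
have a0 : 0 <= a by rewrite /a; have := eta_mu01; lra.
elim: T D => [|T IH] D; first by rewrite /= expr0 subrr mulr0 addr0 mul1r.
rewrite iterTS Ex_bind.
apply: le_trans (le_Ex _ IH) _.
rewrite ExD Ex_cst ExZ.
have := ler_wpM2l (exprn_ge0 T a0) (svrg_step_contract e D).
rewrite -/a => h; apply: le_trans (lerD h (lexx _)) _.
rewrite le_eqVlt; apply/orP; left; apply/eqP; rewrite (exprSr a).
have -> : 2 * eta ^+ 2 = 2 * eta / mu * (1 - a).
  by rewrite /a; field; rewrite gt_eqF.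
by move: (a ^+ T) (2 * eta / mu) => aT k; ring.
Qed.

Lemma bernoulli_inv (b : R) T : 0 <= b <= 1 -> (1 - b) ^+ T * (1 + b * T%:R) <= 1.
Proof.
move=> /andP[b0 b1]; elim: T => [|T IH]; first by rewrite mulr0 addr0 mulr1.
apply: le_trans IH; rewrite exprSr -mulrA; apply: ler_wpM2l.
  by apply: exprn_ge0; rewrite subr_ge0.
by rewrite -natr1; have : 0 <= T%:R :> R by []; nra.
Qed.

Definition svrg_epoch T (w z : 'cV[R]_d) : rtree 'cV[R]_d :=
  tbind (iterT T (svrg_step (w - sigma *: z + cov x *m z)) 0)
    (fun D => Leaf (z + D)).

Variable T : nat.
Hypothesis muT : 3 <= eta * mu * T%:R.

(** The two terms of [svrg_steps_contract] with D = 0 are at most 1/4 of |e|^2,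
    by the choice of T, and 1/11 of |e|^2, by the choice of eta. *)
Lemma svrg_epoch_contract (y z : 'cV[R]_d) :
  Ex (svrg_epoch T (sigma *: y - cov x *m y) z) (fun z' => dot (y - z') (y - z'))
  <= 2^-1 * dot (y - z) (y - z).
Proof.
rewrite Ex_bind; set e := y - z.
rewrite (_ : _ + cov x *m z = sigma *: e - cov x *m e); last first.
  by rewrite /e mulmxBr scalerBr; apply/matrixP => i j; rewrite !mxE; ring.
rewrite (@eq_Ex _ _ _ _ (fun D => dot (e - D) (e - D))); last first.
  by move=> D /=; rewrite opprD addrA.
apply: le_trans (svrg_steps_contract T e 0) _; rewrite subr0.
have b01 := eta_mu01.
have h := bernoulli_inv T b01.
have h1 : (1 - eta * mu) ^+ T <= 4^-1.
  have : 0 <= (1 - eta * mu) ^+ T by apply: exprn_ge0; lra.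
  by move=> a0; have := ler_wpM2l a0 muT; move: h; rewrite mulrDr mulr1; lra.
have h0 : 0 <= (1 - eta * mu) ^+ T by apply: exprn_ge0; lra.
have h2 : 2 * eta / mu <= 11^-1 by rewrite ler_pdivrMr //; move: eta_mu; lra.
have h3 : 0 <= 2 * eta / mu by rewrite mulr_ge0 ?invr_ge0 ?ltW // mulr_gt0.
have ee := dotvv_ge0 e.
have h4 : 2 * eta / mu * dot e e * (1 - (1 - eta * mu) ^+ T) <= 11^-1 * dot e e.
  apply: le_trans (_ : 2 * eta / mu * dot e e <= _); last exact: ler_wpM2r.
    by apply: ler_piMr; [apply: mulr_ge0 | rewrite gerBl].
have := ler_wpM2r ee h1; lra.
Qed.

Definition svrg_solve K (w : 'cV[R]_d) : rtree 'cV[R]_d :=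
  iterT K (svrg_epoch T w) 0.

Lemma svrg_solve_contract K (y : 'cV[R]_d) :
  Ex (svrg_solve K (sigma *: y - cov x *m y)) (fun z' => dot (y - z') (y - z'))
  <= 2^-1 ^+ K * dot y y.
Proof.
suff H z : Ex (iterT K (svrg_epoch T (sigma *: y - cov x *m y)) z)
    (fun z' => dot (y - z') (y - z')) <= 2^-1 ^+ K * dot (y - z) (y - z).
  by have := H 0; rewrite subr0.
elim: K z => [|K IH] z; first by rewrite /= expr0 mul1r.
rewrite iterTS Ex_bind; apply: le_trans (le_Ex _ IH) _.
rewrite ExZ exprSr -mulrA; apply: ler_wpM2l; last exact: svrg_epoch_contract.
by apply: exprn_ge0; rewrite invr_ge0.
Qed.

End SVRG.

(** The ratios of consecutive terms of a log-convex sequence increase, so a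
    bound on the last one bounds all of them. *)
Lemma log_convex_ratio (R : realType) (a : nat -> R) q s :
  (forall k, 0 <= a k) -> (forall k, a k.+1 ^+ 2 <= a k * a k.+2) -> 0 <= q ->
  a s.+1 <= q * a s -> a s.+1 <= q ^+ s.+1 * a 0%N.
Proof.
move=> a0 cvx q0; elim: s => [|s IH] h; first by rewrite expr1.
apply: (le_trans h); rewrite exprS -mulrA; apply: ler_wpM2l => //; apply: IH.
have := a0 s.+1; rewrite le_eqVlt => /orP[/eqP <-|as0]; first exact: mulr_ge0.
rewrite -(ler_pM2l as0) -expr2; apply: le_trans (cvx s) _.
apply: le_trans (ler_wpM2l (a0 s) h) _.
by rewrite le_eqVlt; apply/orP; left; apply/eqP; ring.
Qed.

(** * The inexact power method for the inverse of a shifted matrix *)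
Section ShiftInvert.
Variables (R : realType) (d : nat) (X : 'M[R]_d) (u : 'cV[R]_d) (lam1 delta : R).
Implicit Types v w y z : 'cV[R]_d.
Hypothesis symX : X^T = X.
Hypothesis uu : dot u u = 1.
Hypothesis Xu : X *m u = lam1 *: u.
Hypothesis top : forall v, dot v (X *m v) <= lam1 * dot v v.
Hypothesis gap : forall v, dot u v = 0 ->
  dot v (X *m v) <= (lam1 - delta) * dot v v.
Hypothesis delta_gt0 : 0 < delta.
Variable sigma : R.
Hypothesis sigma_gt : lam1 < sigma.

Let g := sigma - lam1.
Let g_gt0 : 0 < g. Proof. by rewrite subr_gt0. Qed.
Let M := sigma%:M - X.
Definition shift_inv : 'M[R]_d := invmx (sigma%:M - X).
Let B := shift_inv.

Lemma shiftE v : M *m v = sigma *: v - X *m v.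
Proof. by rewrite mulmxBl mul_scalar_mx. Qed.

Lemma shift_strong v : g * dot v v <= dot v (sigma *: v - X *m v).
Proof. by rewrite dotDr dotNr dotZr mulrBl lerD2l lerN2. Qed.

Lemma shift_unit : M \in unitmx.
Proof.
rewrite -row_free_unit -kermx_eq0; apply/eqP/row_matrixP => i; rewrite row0.
set r := row i _.
have rM : r *m M = 0 by rewrite -row_mul mulmx_ker row0.
have Mr : M *m r^T = 0.
  have MT : M^T = M by rewrite linearB /= tr_scalar_mx symX.
  by rewrite -MT -trmx_mul rM trmx0.
have := shift_strong r^T; rewrite -shiftE Mr dot0r => h.
have r0 : dot r^T r^T = 0.
  apply/le_anti; rewrite dotvv_ge0 andbT; by rewrite -(pmulr_rle0 _ g_gt0).
by rewrite -[r]trmxK (dotvv_eq0 r0) trmx0.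
Qed.

Lemma shift_invK v : sigma *: (B *m v) - X *m (B *m v) = v.
Proof. by rewrite -shiftE mulmxA mulmxV ?mul1mx // shift_unit. Qed.

Lemma shift_inv_sym : B^T = B.
Proof. by rewrite /B /shift_inv trmx_inv linearB /= tr_scalar_mx symX. Qed.

Lemma shift_inv_u : B *m u = g^-1 *: u.
Proof.
have : M *m (g^-1 *: u) = u.
  rewrite -scalemxAr shiftE Xu -scalerBl scalerA mulVf ?scale1r //.
  by rewrite gt_eqF.
by move=> h; rewrite -{1}h mulmxA mulVmx ?mul1mx // shift_unit.
Qed.

Lemma dot_u_shift_inv v : dot u (B *m v) = g^-1 * dot u v.
Proof. by rewrite dot_mulmx shift_inv_sym shift_inv_u dotZl. Qed.

(** By Cauchy-Schwarz: c |w|^2 <= dot w v <= |w| |v|. *)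
Let inv_bound c (w : 'cV[R]_d) v : 0 < c ->
  c * dot w w <= dot w v -> enorm w <= c^-1 * enorm v.
Proof.
move=> c0 h; rewrite ler_pdivlMl //.
have := enorm_ge0 w; rewrite le_eqVlt => /orP[/eqP <-|w0].
  by rewrite mulr0 enorm_ge0.
rewrite -(ler_pM2l w0) mulrCA -expr2 sqr_enorm.
by apply: le_trans h _; apply: le_trans (ler_norm _) (ler_dot_enorm _ _).
Qed.

Lemma shift_inv_le v : enorm (B *m v) <= g^-1 * enorm v.
Proof.
by apply: inv_bound => //; rewrite -[X in _ <= dot _ X]shift_invK shift_strong.
Qed.

Lemma shift_inv_orth_le v : dot u v = 0 ->
  enorm (B *m v) <= (g + delta)^-1 * enorm v.
Proof.
move=> uv; apply: inv_bound; first by move: delta_gt0 g_gt0; lra.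
rewrite -[X in _ <= dot _ X]shift_invK dotDr dotNr dotZr.
have := gap (v := B *m v); rewrite dot_u_shift_inv uv mulr0 => /(_ erefl).
by rewrite /g; lra.
Qed.

Variable y0 : 'cV[R]_d.
Let P k := iter k (mulmx B) y0.

Lemma power_le k : enorm (P k) <= g^-1 ^+ k * enorm y0.
Proof.
elim: k => [|k IH]; first by rewrite mul1r.
apply: le_trans (shift_inv_le _) _; rewrite exprS -mulrA.
by apply: ler_wpM2l => //; rewrite invr_ge0 ltW.
Qed.

Lemma dot_u_power k : dot u (P k) = g^-1 ^+ k * dot u y0.
Proof.
elim: k => [|k IH]; first by rewrite mul1r.
by rewrite [P _]/= dot_u_shift_inv IH exprS mulrA.
Qed.

Lemma enorm_u : enorm u = 1.
Proof. by rewrite enormE uu sqrtr1. Qed.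

Lemma power_ge k : g^-1 ^+ k * `|dot u y0| <= enorm (P k).
Proof.
have := ler_dot_enorm u (P k); rewrite dot_u_power enorm_u mul1r normrM.
by rewrite ger0_norm // exprn_ge0 // invr_ge0 ltW.
Qed.

Lemma power_log_convex k : enorm (P k.+1) ^+ 2 <= enorm (P k) * enorm (P k.+2).
Proof.
rewrite sqr_enorm [X in dot X _]/= dotC dot_mulmx shift_inv_sym dotC.
by apply: le_trans (ler_norm _) (ler_dot_enorm _ _).
Qed.

(** If the last ratio of the norms of the iterates were less than 3/4 of its
    upper bound g^-1, then so would be all earlier ones by log-convexity, and
    the last iterate would be shorter than its component along u. *)
Lemma power_ratio s : (3 / 4) ^+ s.+1 * enorm y0 < `|dot u y0| ->
  3 / 4 * g^-1 * enorm (P s) <= enorm (P s.+1).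
Proof.
move=> h; rewrite leNgt; apply/negP => /ltW lt.
have gi : 0 <= g^-1 by rewrite invr_ge0 ltW.
have q0 : 0 <= 3 / 4 * g^-1 by apply: mulr_ge0; [lra|].
have := @log_convex_ratio _ (fun k => enorm (P k)) _ _
  (fun k => enorm_ge0 _) power_log_convex q0 lt.
have := power_ge s.+1.
move=> h1 h2; move: h; rewrite ltNge => /negP; apply.
have gs : 0 < g^-1 ^+ s.+1 by rewrite exprn_gt0 // invr_gt0.
rewrite -(ler_pM2l gs); apply: le_trans h1 _; apply: le_trans h2 _.
by rewrite exprMn mulrAC mulrC mulrA.
Qed.

Definition rejection (v : 'cV[R]_d) := v - dot u v *: u.

Lemma dot_u_rejection v : dot u (rejection v) = 0.
Proof. by rewrite /rejection dotDr dotNr dotZr uu mulr1 subrr. Qed.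

Lemma sqr_enorm_rejection v : enorm (rejection v) ^+ 2 = enorm v ^+ 2 - dot u v ^+ 2.
Proof.
rewrite !sqr_enorm /rejection dotvvD !(dotNr, dotNl, dotZr, dotZl) uu (dotC v u).
ring.
Qed.

Lemma rejection_le v : enorm (rejection v) <= enorm v.
Proof.
rewrite -(@ler_pXn2r _ 2) ?nnegrE ?enorm_ge0 // sqr_enorm_rejection.
by rewrite gerBl sqr_ge0.
Qed.

Lemma rejectionD v w : rejection (v + w) = rejection v + rejection w.
Proof. by rewrite /rejection dotDr scalerDl opprD addrACA. Qed.

Lemma rejection_power k : rejection (P k) = iter k (mulmx B) (rejection y0).
Proof.
elim: k => [//|k IH]; rewrite !iterS -IH /rejection mulmxBr -scalemxAr.
by rewrite [P _]/= shift_inv_u dot_u_shift_inv scalerA [_^-1 * _]mulrC.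
Qed.

Lemma rejection_power_le k :
  enorm (rejection (P k)) <= (g + delta)^-1 ^+ k * enorm y0.
Proof.
rewrite rejection_power; apply: le_trans (_ : _ * enorm (rejection y0) <= _);
  last first.
  apply: ler_wpM2l (rejection_le _); apply: exprn_ge0; rewrite invr_ge0.
  by move: delta_gt0 g_gt0; lra.
suff [] : dot u (iter k (mulmx B) (rejection y0)) = 0 /\
  enorm (iter k (mulmx B) (rejection y0))
    <= (g + delta)^-1 ^+ k * enorm (rejection y0) by [].
elim: k => [|k [IH1 IH2]]; first by rewrite mul1r dot_u_rejection.
rewrite iterS dot_u_shift_inv IH1 mulr0; split=> //.
apply: le_trans (shift_inv_orth_le IH1) _; rewrite exprS -mulrA.
by apply: ler_wpM2l => //; rewrite invr_ge0; move: delta_gt0 g_gt0; lra.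
Qed.

Variable tau : R.
Hypothesis tau_ge0 : 0 <= tau.

(** The deviation accumulated by k inexact steps of relative error tau: it is
    measured against the a priori bound on the length of the k-th exact iterate,
    and the factor (1 + tau)^k - 1 makes the induction in [tracksS] exact. *)
Definition tracks k (y : 'cV[R]_d) : Prop :=
  enorm (y - P k) <= g^-1 ^+ k * enorm y0 * ((1 + tau) ^+ k - 1).

Lemma tracks0 : tracks 0 y0.
Proof. by rewrite /tracks subrr enorm0 subrr mulr0. Qed.

Lemma tracksS k y z : tracks k y ->
  enorm (B *m y - z) <= tau * enorm (B *m y) -> tracks k.+1 z.
Proof.
rewrite /tracks => hy hz.
set D := enorm (y - P k) in hy; set N := g^-1 ^+ k * enorm y0 in hy.
have gi : 0 <= g^-1 by rewrite invr_ge0 ltW.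
have hD : enorm (B *m (y - P k)) <= g^-1 * D by exact: shift_inv_le.
have hy2 : enorm (B *m y) <= g^-1 * (N + D).
  apply: le_trans (shift_inv_le _) _; apply: ler_wpM2l => //.
  rewrite -[y](subrK (P k)) addrC; apply: le_trans (ler_enormD _ _) _.
  by apply: lerD => //; exact: power_le.
have -> : z - P k.+1 = - (B *m y - z) + B *m (y - P k).
  by rewrite [P k.+1]/= mulmxBr opprB addrA subrK.
apply: le_trans (ler_enormD _ _) _; rewrite enormN.
have h1 : tau * enorm (B *m y) <= tau * (g^-1 * (N + D)) by apply: ler_wpM2l.
apply: le_trans (lerD (le_trans hz h1) hD) _.
have -> : tau * (g^-1 * (N + D)) + g^-1 * D = g^-1 * (tau * N + (1 + tau) * D).
  by ring.
rewrite !exprS -[g^-1 * g^-1 ^+ k * _]mulrA -/N -mulrA; apply: ler_wpM2l => //.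
have : (1 + tau) * D <= (1 + tau) * (N * ((1 + tau) ^+ k - 1)).
  by apply: ler_wpM2l => //; rewrite addr_ge0.
by move=> h; apply: le_trans (lerD (lexx _) h) _; rewrite le_eqVlt; apply/orP; left;
  apply/eqP; ring.
Qed.

Variables (om err : R) (s : nat).
Hypothesis om_gt0 : 0 < om.
Hypothesis om_le : om * enorm y0 <= `|dot u y0|.
Hypothesis y0_gt0 : 0 < enorm y0.
Hypothesis err_le : err <= om / 16.
Hypothesis tau_err : (1 + tau) ^+ s.+1 - 1 <= err.
Hypothesis s_large : (3 / 4) ^+ s.+1 < om.

Let tau_err' : (1 + tau) ^+ s - 1 <= err.
Proof.
apply: le_trans tau_err; rewrite lerD2r exprS ler_peMl //.
  by apply: exprn_ge0; rewrite addr_ge0.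
by rewrite lerDl.
Qed.

Let tracks_rel k y : tracks k y -> (1 + tau) ^+ k - 1 <= err ->
  enorm (y - P k) <= 16^-1 * enorm (P k).
Proof.
move=> ty te.
have gk : 0 <= g^-1 ^+ k by apply: exprn_ge0; rewrite invr_ge0 ltW.
apply: le_trans ty _.
apply: le_trans (_ : g^-1 ^+ k * enorm y0 * (om / 16) <= _).
  apply: ler_wpM2l; first by rewrite mulr_ge0 ?enorm_ge0.
  exact: le_trans te err_le.
rewrite mulrA [X in _ <= X]mulrC; apply: ler_wpM2r; first by rewrite invr_ge0.
by apply: le_trans (power_ge k); rewrite -mulrA; apply: ler_wpM2l => //; rewrite mulrC.
Qed.

Let P_gt0 k : 0 < enorm (P k).
Proof.
apply: lt_le_trans (power_ge k); apply: mulr_gt0.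
  by apply: exprn_gt0; rewrite invr_gt0.
by apply: lt_le_trans om_le; apply: mulr_gt0.
Qed.

(** For exact iterates the quotient lies between g and 4g/3; the inexact ones
    differ from them by a relative error of at most 1/16. *)
Lemma gap_estimate a b : tracks s a -> tracks s.+1 b ->
  g / 2 <= enorm a / enorm b <= 2 * g.
Proof.
move=> ta tb; have ha := tracks_rel ta tau_err'; have hb := tracks_rel tb tau_err.
have ha1 : enorm a <= 17 / 16 * enorm (P s).
  have := ler_enormD (a - P s) (P s); rewrite subrK; lra.
have ha2 : 15 / 16 * enorm (P s) <= enorm a.
  have := ler_enormB (P s) (a - P s); rewrite [P _ + _]addrC subrK; lra.
have hb1 : enorm b <= 17 / 16 * enorm (P s.+1).
  have := ler_enormD (b - P s.+1) (P s.+1); rewrite subrK; lra.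
have hb2 : 15 / 16 * enorm (P s.+1) <= enorm b.
  have := ler_enormB (P s.+1) (b - P s.+1); rewrite [P _ + _]addrC subrK; lra.
have r1 : g * enorm (P s.+1) <= enorm (P s).
  by have := shift_inv_le (P s); rewrite ler_pdivlMl.
have r2 : 3 / 4 * enorm (P s) <= g * enorm (P s.+1).
  rewrite -ler_pdivrMl // mulrCA mulrA; apply: power_ratio.
  by apply: lt_le_trans om_le; rewrite ltr_pM2r.
have Pp := P_gt0 s.+1.
have bp : 0 < enorm b by lra.
have h1 : g * enorm b <= g * (17 / 16 * enorm (P s.+1)).
  by apply: ler_wpM2l => //; exact: ltW.
have h2 : g * (15 / 16 * enorm (P s.+1)) <= g * enorm b.
  by apply: ler_wpM2l => //; exact: ltW.
apply/andP; split.
  by rewrite ler_pdivlMr //; lra.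
by rewrite ler_pdivrMr //; lra.
Qed.

(** As g <= delta, the part of an exact iterate orthogonal to u shrinks
    relative to the part along u by a factor of at least two per step. *)
Lemma accurate eps b : g <= delta -> 0 <= eps -> 0 <= err ->
  (2^-1 ^+ s.+1 + err) ^+ 2 <= eps * (om - err) ^+ 2 ->
  tracks s.+1 b -> 0 < enorm b /\ (1 - eps) * enorm b ^+ 2 <= dot u b ^+ 2.
Proof.
move=> gd e0 err0 he tb.
have hb := tracks_rel tb tau_err.
have Pp := P_gt0 s.+1.
have bp : 0 < enorm b.
  by have := ler_enormB (P s.+1) (b - P s.+1); rewrite [P _ + _]addrC subrK; lra.
split=> //.
set S := g^-1 ^+ s.+1 * enorm y0.
have gs : 0 < g^-1 ^+ s.+1 by rewrite exprn_gt0 // invr_gt0.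
have S0 : 0 < S by rewrite mulr_gt0.
have tb' : enorm (b - P s.+1) <= S * err.
  by apply: le_trans tb _; apply: ler_wpM2l => //; exact: ltW.
have lower : S * (om - err) <= enorm b.
  have := ler_enormB (P s.+1) (b - P s.+1); rewrite [P _ + _]addrC subrK.
  have : S * om <= enorm (P s.+1).
    apply: le_trans (power_ge s.+1); rewrite /S -mulrA; apply: ler_wpM2l;
    by [exact: ltW | rewrite mulrC].
  lra.
have upper : enorm (rejection b) <= S * (2^-1 ^+ s.+1 + err).
  rewrite -[b](subrK (P s.+1)) rejectionD; apply: le_trans (ler_enormD _ _) _.
  have := le_trans (rejection_le (b - P s.+1)) tb'.
  have : enorm (rejection (P s.+1)) <= S * 2^-1 ^+ s.+1.
    apply: le_trans (rejection_power_le _) _.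
    rewrite /S mulrAC; apply: ler_wpM2r; first exact: enorm_ge0.
    rewrite -exprMn; apply: lerXn2r; rewrite ?nnegrE ?invr_ge0 //.
    - by move: delta_gt0 g_gt0; lra.
    - by rewrite mulr_ge0 // invr_ge0 // ltW.
    - rewrite -invfM lef_pV2 ?posrE //; first by move: g_gt0 gd; lra.
      + by move: delta_gt0 g_gt0; lra.
      + by move: g_gt0; lra.
  lra.
have omerr : 0 <= om - err by move: err_le om_gt0; lra.
have half : 0 <= 2^-1 ^+ s.+1 :> R by apply: exprn_ge0; rewrite invr_ge0.
have : enorm (rejection b) ^+ 2 <= eps * enorm b ^+ 2.
  apply: le_trans (_ : (S * (2^-1 ^+ s.+1 + err)) ^+ 2 <= _).
    by apply: lerXn2r upper; rewrite nnegrE ?enorm_ge0 // mulr_ge0 ?addr_ge0 // ltW.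
  apply: le_trans (_ : eps * (S * (om - err)) ^+ 2 <= _).
    by rewrite 2!(exprMn _ S) [X in _ <= X]mulrCA; apply: ler_wpM2l => //; exact: sqr_ge0.
  apply: ler_wpM2l => //; apply: lerXn2r lower; rewrite nnegrE ?enorm_ge0 //.
  by rewrite mulr_ge0 // ltW.
rewrite sqr_enorm_rejection; lra.
Qed.

End ShiftInvert.

(** * The random start vector *)
Section StartVector.
Variables (R : realType) (m d : nat).

Definition draw_entry (l : seq nat) : rtree (seq nat) :=
  Unif (fun v : 'I_m.+1 => Leaf (rcons l v)).

Definition start (k : nat) (l : seq nat) : rtree (seq nat) := iterT k draw_entry l.

Definition gvec (l : seq nat) : 'cV[R]_d := \col_j (nth 0%N l j)%:R.

Lemma Ex_start_cat k l (phi : seq nat -> R) :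
  Ex (start k l) phi = Ex (start k [::]) (fun r => phi (l ++ r)).
Proof.
have [j] := ubnP k; elim: j k l phi => // j IH [|k] l phi kj.
  by rewrite /= cats0.
rewrite /start !iterTS !Ex_bind /=; congr (_ * _); apply: eq_bigr => v _.
rewrite -/(start _ _) IH // [RHS]IH //; apply: eq_Ex => r /=.
by rewrite cat_rcons.
Qed.

(** Two distinct v in the sum would give points c + v u at distance at least
    |u|, both within less than |u| / 2 of the origin. *)
Lemma sum_indicator_le1 (u c : R) :
  \sum_(v < m.+1) `[< `|c + v%:R * u| < `|u| / 2 >]%:R <= 1 :> R.
Proof.
have [[v0 h0]|none] := pselect (exists v : 'I_m.+1, `|c + v%:R * u| < `|u| / 2).
  rewrite (bigD1 v0) //= asboolT // big1 ?addr0 // => v vv0.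
  rewrite asboolF // => h.
  have : `|(v%:R - v0%:R) * u| < `|u|.
    have -> : (v%:R - v0%:R) * u = (c + v%:R * u) - (c + v0%:R * u) by ring.
    apply: le_lt_trans (ler_normB _ _) _; lra.
  rewrite normrM; apply/negP; rewrite -leNgt ler_peMl //.
  wlog vlt : v v0 {h h0} vv0 / (v0 < v)%N.
    move=> H; have := vv0; rewrite -val_eqE neq_ltn => /orP[lt|lt].
      by rewrite distrC; apply: H => //; rewrite eq_sym.
    exact: H.
  rewrite -natrB ?(ltnW vlt) // normr_nat ler1n subn_gt0 //.
rewrite big1 // => v _; rewrite asboolF // => h; apply: none; by exists v.
Qed.

(** Draw coordinate j last: whatever the other coordinates are, at most one of
    its m + 1 values is bad, by [sum_indicator_le1]. *)
Lemma anticoncentration (u : 'cV[R]_d) (j : 'I_d) k l :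
  (size l <= j < size l + k)%N ->
  Ex (start k l) (fun l' => `[< `|dot u (gvec l')| < `|u j 0| / 2 >]%:R)
  <= m.+1%:R^-1 :> R.
Proof.
elim: k l => [|k IH] l /andP[lj jk].
  by move: jk; rewrite addn0 ltnNge lj.
rewrite /start iterTS Ex_bind /= -/(start k _).
have [lj'|jl] := ltnP (size l) j.
  apply: avg_le => v; apply: IH; by rewrite size_rcons lj' addSnnS.
have sl : size l = j by apply/eqP; rewrite eqn_leq lj jl.
rewrite (eq_bigr (fun v : 'I_m.+1 => Ex (start k [::]) (fun r =>
  `[< `|dot u (gvec (rcons l v ++ r))| < `|u j 0| / 2 >]%:R))); last first.
  by move=> v _; rewrite -/(start k _) Ex_start_cat.
rewrite -Ex_sum -ExZ -[leRHS](Ex_cst (start k [::])); apply: le_Ex => r.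
rewrite -[leRHS]mulr1; apply: ler_wpM2l; first by rewrite invr_ge0.
pose c := \sum_(i < d | i != j) u i 0 * (nth 0%N (rcons l 0%N ++ r) i)%:R.
rewrite (eq_bigr (fun v : 'I_m.+1 => `[< `|c + v%:R * u j 0| < `|u j 0| / 2 >]%:R)).
  exact: sum_indicator_le1.
move=> v _; congr (`[< `|_| < _ >]%:R).
rewrite dotE (bigD1 j) //= addrC; congr (_ + _).
  apply: eq_bigr => i ij; rewrite mxE; congr (_ * _%:R).
  rewrite !nth_cat !size_rcons !nth_rcons sl.
  by rewrite ltnS leq_eqVlt [_ == _ :> nat](negPf ij) /=; case: ifP.
by rewrite mxE nth_cat size_rcons sl ltnS leqnn nth_rcons sl ltnn eqxx mulrC.
Qed.

Fixpoint always (A : Type) (t : rtree A) (P : A -> Prop) : Prop :=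
  match t with
  | Leaf a => P a
  | Unif _ g => forall i, always (g i) P
  end.

Lemma pr_always A (t : rtree A) (P Q : A -> Prop) :
  always t P -> pr R t Q <= pr R t (fun a => P a /\ Q a).
Proof.
rewrite /pr; elim: t => [a Pa|k g IH h] /=.
  by case: asboolP => [Qa|_]; [rewrite asboolT | exact: ler0n].
by apply: ler_wpM2l; [rewrite invr_ge0 | apply: ler_sum => i _; exact: IH].
Qed.

Lemma start_always k l : all (fun v => (v <= m)%N) l ->
  always (start k l) (fun l' => size l' = (size l + k)%N /\ all (fun v => (v <= m)%N) l').
Proof.
elim: k l => [|k IH] l lm; first by rewrite addn0.
move=> i /=; rewrite -addSnnS -(size_rcons l i); apply: IH.
by rewrite all_rcons lm -ltnS ltn_ord.
Qed.

Lemma enorm_gvec l : size l = d -> all (fun v => (v <= m)%N) l ->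
  enorm (gvec l) <= m%:R * d%:R.
Proof.
move=> sl lm; rewrite -(@ler_pXn2r _ 2) ?nnegrE ?enorm_ge0 ?mulr_ge0 //.
rewrite sqr_enorm dotE; apply: le_trans (_ : \sum_(j < d) m%:R ^+ 2 <= _).
  apply: ler_sum => j _; rewrite mxE -expr2 lerXn2r ?nnegrE // ler_nat.
  by apply: (allP lm); apply: mem_nth; rewrite sl.
rewrite sumr_const card_ord -[_ *+ d]mulr_natl exprMn [d%:R * _]mulrC; apply: ler_wpM2l.
  exact: sqr_ge0.
by rewrite -natrX ler_nat; case: (d) => // d'; rewrite expnS leq_pmulr // expn_gt0.
Qed.

Lemma large_entry (u : 'cV[R]_d) : dot u u = 1 -> exists j, 1 <= d%:R * `|u j 0|.
Proof.
move=> uu; apply: contrapT => /forallNP h.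
have d0 : (0 < d)%N.
  rewrite lt0n; apply/eqP => d0; have := uu; rewrite dotE big1 => [/esym/eqP|j _].
    by rewrite oner_eq0.
  by have := ltn_ord j; rewrite {2}d0.
have dp : 0 < d%:R :> R by rewrite ltr0n.
have : dot u u <= \sum_(j < d) d%:R^-1 * `|u j 0|.
  rewrite dotE; apply: ler_sum => j _; rewrite -expr2 -real_normK ?num_real //.
  rewrite expr2; apply: ler_wpM2r => //; apply/ltW.
  have /negP := h j; rewrite -ltNge => hj.
  by rewrite -(ltr_pM2l dp) divff ?gt_eqF.
rewrite uu -mulr_sumr; apply/negP; rewrite -ltNge.
rewrite mulrC ltr_pdivrMr // mul1r.
apply: lt_le_trans (_ : \sum_(j < d) 1 <= _); last first.
  by rewrite sumr_const card_ord.
apply: ltr_sum => [|j _]; first by apply/hasP; exists (Ordinal d0); rewrite ?mem_index_enum.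
have /negP := h j; rewrite -ltNge => hj; apply: le_lt_trans hj.
by rewrite ler_peMl // ler1n.
Qed.

Lemma start_pr (u : 'cV[R]_d) : dot u u = 1 ->
  1 - m.+1%:R^-1 <= pr R (start d [::]) (fun l =>
    1 <= 2 * d%:R * `|dot u (gvec l)| /\ enorm (gvec l) <= m%:R * d%:R).
Proof.
move=> uu; have [j hj] := large_entry uu.
have h0 : always (start d [::]) (fun l' => size l' = d /\ all (fun v => (v <= m)%N) l').
  exact: start_always.
apply: le_trans (le_trans (pr_always (fun l =>
  `|u j 0| / 2 <= `|dot u (gvec l)|) h0) _); last first.
  apply: le_pr => l [[sl lm] h]; split; last exact: enorm_gvec.
  have := ler_wpM2l (ler0n R d) h; move: hj; lra.
have := @anticoncentration u j d [::]; rewrite /= add0n ltn_ord => /(_ isT) h.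
rewrite lerBlDr -lerBlDl; apply: le_trans h; rewrite /pr.
rewrite -{1}(Ex_cst (start d [::]) 1) -[- Ex _ _]mulN1r -ExZ -ExD.
apply: le_Ex => l; case: asboolP => [_|/negP].
  by rewrite mulr1 subrr ler0n.
by rewrite -ltNge => h; rewrite asboolT // mulr0 addr0.
Qed.

End StartVector.

(** * Lowering the shift in stages *)
Section Algorithm.
Variables (R : realType) (n d : nat) (x : 'I_n.+1 -> 'cV[R]_d).

Definition power_step (solve : 'cV[R]_d -> rtree 'cV[R]_d) (cb : R * 'cV[R]_d)
    : rtree (R * 'cV[R]_d) :=
  tbind (solve cb.2) (fun z => Leaf (dot cb.2 cb.2, z)).

(** The state consists of the shift, the squared norm of the last iterate but
    one, and the last iterate. The square root estimates the distance g of the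
    shift to the top eigenvalue up to a factor of two, so that the new distance
    lies between g/2 + theta/16 and 7g/8 + theta/16. *)
Definition stage (theta : R) T K s (y0 : 'cV[R]_d) (st : R * R * 'cV[R]_d)
    : rtree (R * R * 'cV[R]_d) :=
  tbind (iterT s (power_step (svrg_solve x st.1.1 (theta / 352) T K)) (st.1.2, y0))
    (fun cb => Leaf
      (st.1.1 - Num.sqrt (cb.1 / dot cb.2 cb.2) / 4 + theta / 16, cb.1, cb.2)).

Hypothesis x1 : forall i, enorm (x i) <= 1.
Variables (u : 'cV[R]_d) (lam1 delta theta : R).
Let X := cov x.
Hypothesis uu : dot u u = 1.
Hypothesis Xu : X *m u = lam1 *: u.
Hypothesis top : forall v, dot v (X *m v) <= lam1 * dot v v.
Hypothesis gap : forall v, dot u v = 0 ->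
  dot v (X *m v) <= (lam1 - delta) * dot v v.
Hypothesis theta_gt0 : 0 < theta.
Hypothesis theta_le : theta <= delta.
Hypothesis delta_le1 : delta <= 1.

Lemma lam1E : lam1 = dot u (X *m u).
Proof. by rewrite Xu dotZr uu mulr1. Qed.

Lemma lam1_ge0 : 0 <= lam1.
Proof. by rewrite lam1E dot_cov_ge0. Qed.

Lemma lam1_le1 : lam1 <= 1.
Proof. by rewrite lam1E -[leRHS]uu; apply: dot_cov_le. Qed.

Variables (T K s : nat) (tau q : R).
Hypothesis T_large : 3 * 352 * 16 <= T%:R * theta ^+ 2.
Hypothesis tau_gt0 : 0 < tau.
Hypothesis q_ge0 : 0 <= q.
Hypothesis K_large : 2^-1 ^+ K <= q * tau ^+ 2.

(** The lower bound makes the shifted matrix well conditioned for the gradient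
    steps with mu = theta / 16; the upper bound keeps the shift at most 3. *)
Definition valid sigma := theta / 16 <= sigma - lam1 <= 2.

Lemma valid_gt sigma : valid sigma -> lam1 < sigma.
Proof. by move=> /andP[h _]; move: theta_gt0; lra. Qed.

Lemma solve_pr sigma w : valid sigma ->
  1 - q <= pr R (svrg_solve x sigma (theta / 352) T K w) (fun z =>
    enorm (shift_inv X sigma *m w - z) <= tau * enorm (shift_inv X sigma *m w)).
Proof.
move=> vs; have gs := valid_gt vs; case/andP: vs => g1 g2.
set y := _ *m w.
have wE : w = sigma *: y - X *m y.
  by rewrite /y (shift_invK (cov_sym x) top gs).
have contract : Ex (svrg_solve x sigma (theta / 352) T K (sigma *: y - X *m y))
    (fun z => dot (y - z) (y - z)) <= q * (tau ^+ 2 * dot y y).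
  apply: le_trans (@svrg_solve_contract _ _ _ x x1 sigma (theta / 352) (theta / 16)
    _ _ _ _ _ _ _ T _ K y) _.
  - by have := lam1_ge0; move: theta_gt0; lra.
  - by have := lam1_le1; lra.
  - by rewrite divr_gt0.
  - by rewrite divr_gt0.
  - lra.
  - by move: theta_le delta_le1; lra.
  - move=> v; apply: le_trans (shift_strong top sigma v).
    by apply: ler_wpM2r g1; exact: dotvv_ge0.
  - move: T_large; lra.
  - by rewrite mulrA; apply: ler_wpM2r K_large; exact: dotvv_ge0.
have mk := @markov R _ (svrg_solve x sigma (theta / 352) T K (sigma *: y - X *m y))
  (fun z => dot (y - z) (y - z)) (tau ^+ 2 * dot y y) q (fun z => dotvv_ge0 _)
  (mulr_ge0 (sqr_ge0 _) (dotvv_ge0 _)) q_ge0 contract.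
rewrite [X in svrg_solve _ _ _ _ _ X]wE; apply: (le_trans mk); apply: le_pr => z /= h.
have ty : 0 <= tau * enorm y by rewrite mulr_ge0 ?enorm_ge0 // ltW.
by rewrite -(@ler_pXn2r _ 2) ?nnegrE ?enorm_ge0 // exprMn !sqr_enorm.
Qed.

Variables (y0 : 'cV[R]_d) (om err eps : R).
Hypothesis om_gt0 : 0 < om.
Hypothesis om_le : om * enorm y0 <= `|dot u y0|.
Hypothesis y0_gt0 : 0 < enorm y0.
Hypothesis err_ge0 : 0 <= err.
Hypothesis err_le : err <= om / 16.
Hypothesis tau_err : (1 + tau) ^+ s.+1 - 1 <= err.
Hypothesis s_large : (3 / 4) ^+ s.+1 < om.
Hypothesis eps_ge0 : 0 <= eps.
Hypothesis eps_large : (2^-1 ^+ s.+1 + err) ^+ 2 <= eps * (om - err) ^+ 2.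

Definition accurate_vec (b : 'cV[R]_d) : Prop :=
  0 < enorm b /\ (1 - eps) * enorm b ^+ 2 <= dot u b ^+ 2.

Lemma stage_pr (st : R * R * 'cV[R]_d) : valid st.1.1 ->
  1 - s.+1%:R * q <= pr R (stage theta T K s.+1 y0 st) (fun st' =>
    [/\ theta / 16 <= st'.1.1 - lam1,
        st'.1.1 - lam1 <= 7 / 8 * (st.1.1 - lam1) + theta / 16
      & st.1.1 - lam1 <= delta -> accurate_vec st'.2]).
Proof.
case: st => [[sigma c] y] /= vs; have gs := valid_gt vs.
pose tr := tracks X lam1 sigma y0 tau.
pose P j (cb : R * 'cV[R]_d) := tr j cb.2 /\
  forall j', j = j'.+1 -> exists2 a, cb.1 = dot a a & tr j' a.
have iterP : 1 - s.+1%:R * q <= pr R (iterT s.+1 (power_step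
    (svrg_solve x sigma (theta / 352) T K)) (c, y0)) (P s.+1).
  apply: pr_iterT => //; last by split=> //; exact: tracks0.
  move=> j [c' b] js [/= trb _]; rewrite /power_step /=.
  rewrite -[1 - q]/(1 - q) -(addr0 q).
  apply: pr_bind (solve_pr _ vs) _ _ => // z hz.
  apply: pr_leaf => //; split=> /=.
    exact: (tracksS (cov_sym x) top gs (ltW tau_gt0) trb hz).
  by move=> j' [<-]; exists b.
rewrite -[s.+1%:R * q]addr0; apply: pr_bind iterP _ _ => // -[c' b] [/= trb].
move=> /(_ s erefl) [a /= -> tra].
apply: pr_leaf => //=.
have est := gap_estimate (cov_sym x) uu Xu top gs (ltW tau_gt0) om_gt0 om_le y0_gt0
  err_le tau_err s_large tra trb.
have -> : Num.sqrt (dot a a / dot b b) = enorm a / enorm b.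
  by rewrite sqrtrM ?dotvv_ge0 // sqrtrV ?dotvv_ge0 // -!enormE.
case/andP: est => e1 e2; split; [lra | lra |].
move=> gd.
have d0 : 0 < delta by move: theta_gt0 theta_le; lra.
exact: (accurate (cov_sym x) uu Xu top gap d0 gs om_gt0 om_le y0_gt0
  err_le tau_err gd eps_ge0 err_ge0 eps_large trb).
Qed.

Variable J : nat.
Hypothesis J_large : 4 * (7 / 8) ^+ J <= theta.

(** The distance of the shift to the top eigenvalue before stage j is at most
    2 (7/8)^j + theta/2, which for j = J is at most theta. *)
Lemma stages_pr c y :
  1 - J.+1%:R * (s.+1%:R * q) <=
    pr R (iterT J.+1 (stage theta T K s.+1 y0) (2, c, y))
       (fun st => accurate_vec st.2).
Proof.
pose P j (st : R * R * 'cV[R]_d) :=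
  [/\ valid st.1.1, st.1.1 - lam1 <= 2 * (7 / 8) ^+ j + theta / 2 &
      j = J.+1 -> accurate_vec st.2].
apply: le_trans (_ : pr R (iterT J.+1 (stage theta T K s.+1 y0) (2, c, y)) (P J.+1) <= _);
  last by apply: le_pr => st [_ _]; exact.
apply: pr_iterT; first by rewrite mulr_ge0.
  move=> j st jJ [vs gj _]; apply: (le_trans (stage_pr vs)); apply: le_pr.
  move=> st' [h1 h2 h3]; split.
  - apply/andP; split=> //; case/andP: vs => _ g2.
    by move: theta_le delta_le1; lra.
  - by rewrite exprS; move: gj h2; lra.
  - case=> jJ'; apply: h3; apply: le_trans gj _; rewrite jJ'.
    by move: J_large theta_le; lra.
split=> //=; last by rewrite expr0; have := lam1_ge0; move: theta_gt0; lra.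
apply/andP; split; first by have := lam1_le1; move: theta_le delta_le1; lra.
by have := lam1_ge0; lra.
Qed.

End Algorithm.

(** * A logic for randomized programs *)
Section Simulation.
Variables (S A : Type).

(** The runs t of a program branch exactly as the process T does, all of them
    halt, and the final states are related by Q to the outcomes of T. Time
    bounds, which hold for every run, and probabilities can then both be read
    off ([sim_surely], [sim_Pr]). *)
Inductive sim (Q : A -> S -> Prop) : rtree (option S) -> rtree A -> Prop :=
| sim_leaf a s : Q a s -> sim Q (Leaf (Some s)) (Leaf a)
| sim_unif m g h : (forall i : 'I_m.+1, sim Q (g i) (h i)) ->
    sim Q (Unif g) (Unif h).

Fixpoint leaves (t : rtree (option S)) (P : S -> Prop) : Prop :=
  match t with
  | Leaf (Some s) => P s
  | Leaf None => True
  | Unif _ g => forall i, leaves (g i) P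
  end.

Lemma sim_leaves (Q Q' : A -> S -> Prop) (P : S -> Prop) t T :
  sim Q t T -> leaves t P -> (forall a s, Q a s -> P s -> Q' a s) -> sim Q' t T.
Proof.
move=> + + QQ'; elim=> [a s Qas Ps|m g h _ IH lv]; constructor; first exact: QQ'.
by move=> i; apply: IH; apply: lv.
Qed.

Lemma sim_mono (Q Q' : A -> S -> Prop) t T :
  sim Q t T -> (forall a s, Q a s -> Q' a s) -> sim Q' t T.
Proof.
move=> + QQ'; elim=> [a s Qas|m g h _ IH]; constructor; first exact: QQ'.
by move=> i; apply: IH.
Qed.

Lemma sim_surely (Q : A -> S -> Prop) t T (E : S -> bool) :
  sim Q t T -> (forall a s, Q a s -> E s) -> surely t E.
Proof. by move=> + QE; elim=> [a s Qas|m g h _ IH] /=; [apply: QE Qas | ]. Qed.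

Lemma sim_Pr (R : realType) (Q : A -> S -> Prop) t T (P : A -> Prop) (E : S -> bool) :
  sim Q t T -> (forall a s, Q a s -> P a -> E s) -> pr R T P <= Pr R t E.
Proof.
rewrite /pr => + QE; elim=> [a s Qas|m g h _ IH] /=.
  by case: asboolP => [Pa|_]; [rewrite (QE _ _ Qas Pa) | exact: ler0n].
by apply: ler_wpM2l; [rewrite invr_ge0 | apply: ler_sum => i _; exact: IH].
Qed.

End Simulation.

Lemma sim_bind S S' A B (Q : A -> S -> Prop) (Q' : B -> S' -> Prop) t T f F :
  sim Q t T -> (forall a s, Q a s -> sim Q' (f s) (F a)) ->
  sim Q' (rbind t f) (tbind T F).
Proof.
by move=> + h; elim=> [a s Qas|m g k _ IH] /=; [apply: h | constructor].
Qed.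

Lemma leaves_bind S S' (t : rtree (option S)) (f : S -> rtree (option S')) P P' :
  leaves t P -> (forall s, P s -> leaves (f s) P') -> leaves (rbind t f) P'.
Proof.
move=> + h; elim: t => [[s|]|m g IH] //=; first exact: h.
by move=> lv i; apply: IH.
Qed.

Lemma leaves_mono S (t : rtree (option S)) P P' :
  leaves t P -> (forall s, P s -> P' s) -> leaves t P'.
Proof.
move=> + h; elim: t => [[s|]|m g IH] //=; first exact: h.
by move=> lv i; apply: IH.
Qed.

Section Logic.
Variables (R : realType).
Implicit Types (s : state R) (c : cmd).

(** The arrays a command may write. That all others keep their contents
    ([run_frame]) is a syntactic matter, so specifications mention only what
    changes. *)
Fixpoint imods c : seq nat :=
  match c with
  | IPut a _ _ | Draw a _ _ => [:: a]
  | Seq c1 c2 | If _ c1 c2 => imods c1 ++ imods c2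
  | While _ c1 => imods c1
  | _ => [::]
  end.

Fixpoint rmods c : seq nat :=
  match c with
  | RPut a _ _ => [:: a]
  | Seq c1 c2 | If _ c1 c2 => rmods c1 ++ rmods c2
  | While _ c1 => rmods c1
  | _ => [::]
  end.

Definition same (ia ra : seq nat) s s' : Prop :=
  (forall a, a \notin ia -> imem s' a = imem s a) /\
  (forall a, a \notin ra -> rmem s' a = rmem s a).

Lemma same_trans ia ra s1 s2 s3 :
  same ia ra s1 s2 -> same ia ra s2 s3 -> same ia ra s1 s3.
Proof.
move=> [i12 r12] [i23 r23]; split=> a h; first by rewrite i23 ?i12.
by rewrite r23 ?r12.
Qed.

Lemma same_sub ia ra ia' ra' s s' : {subset ia <= ia'} -> {subset ra <= ra'} ->
  same ia ra s s' -> same ia' ra' s s'.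
Proof.
move=> si sr [hi hr]; split=> a h; first by apply: hi; apply: contra (si a) h.
by apply: hr; apply: contra (sr a) h.
Qed.

Lemma same_tick ia ra k s : same ia ra s (tick k s).
Proof. by []. Qed.

Lemma upd_neq A (m : nat -> nat -> A) a i v b : b != a -> upd m a i v b = m b.
Proof. by move=> /negPf ba; apply: funext => j; rewrite /upd ba. Qed.

Lemma upd_idx A (m : nat -> nat -> A) a i v j : upd m a i v a j = if j == i then v else m a j.
Proof. by rewrite /upd eqxx. Qed.

Lemma run_frame fuel c s : leaves (run fuel c s) (same (imods c) (rmods c) s).
Proof.
elim: c s => [|a i e|a i e|a i e|c1 IH1 c2 IH2|b c1 IH1 c2 IH2|b c1 IH1] s /=.
- by [].
- by split=> // b; rewrite inE => ba; rewrite /= upd_neq.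
- by split=> // b; rewrite inE => ba; rewrite /= upd_neq.
- by move=> v; split=> // b; rewrite inE => ba; rewrite /= upd_neq.
- apply: leaves_bind (IH1 s) _ => s1 h1; apply: leaves_mono (IH2 s1) _ => s2 h2.
  apply: same_trans (same_sub _ _ h1) (same_sub _ _ h2) => z hz;
  by rewrite mem_cat hz ?orbT.
- case: ifP => _.
    by apply: leaves_mono (IH1 _) _ => s2; apply: same_sub => z hz; rewrite mem_cat hz.
  apply: leaves_mono (IH2 _) _ => s2; apply: same_sub => z hz.
    by rewrite mem_cat hz orbT.
  by rewrite mem_cat hz orbT.
- move: {2}fuel => k; elim: k s => [|k IHk] s //=.
  case: ifP => _ //.
  apply: leaves_bind (IH1 (tick (bcost b) s)) _ => s1 h1.
  by apply: leaves_mono (IHk s1) _ => s2; apply: same_trans h1.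
Qed.

Variable fuel : nat.

(** The fuel is one fixed number exceeding the length of every loop, so no
    reasoning about its consumption is needed. *)
Definition hoare A c s (k : nat) (T : rtree A) (Q : A -> state R -> Prop) : Prop :=
  sim (fun a s' => Q a s' /\ (clock s' <= clock s + k)%N) (run fuel c s) T.

Lemma hoare_mono A c s k k' T (Q Q' : A -> state R -> Prop) :
  hoare c s k T Q -> (k <= k')%N ->
  (forall a s', Q a s' -> same (imods c) (rmods c) s s' -> Q' a s') ->
  hoare c s k' T Q'.
Proof.
move=> h kk QQ'; apply: sim_leaves h (run_frame _ _ _) _ => a s' [Qs ck] fr.
by split; [exact: QQ' | apply: leq_trans ck _; rewrite leq_add2l].
Qed.

Lemma hoare_le A c s k k' (T : rtree A) Q :
  hoare c s k T Q -> (k <= k')%N -> hoare c s k' T Q.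
Proof. by move=> h kk; apply: hoare_mono h kk _. Qed.

Lemma hoare_seq A B c1 c2 s k1 k2 (T1 : rtree A) (T2 : A -> rtree B) Q1 Q :
  hoare c1 s k1 T1 Q1 ->
  (forall a s', Q1 a s' -> same (imods c1) (rmods c1) s s' ->
     hoare c2 s' k2 (T2 a) Q) ->
  hoare (Seq c1 c2) s (k1 + k2) (tbind T1 T2) Q.
Proof.
move=> h1 h2; have h1' := hoare_mono h1 (leqnn k1) (fun a s' q f => conj q f).
apply: sim_bind h1' _ => a s' [[Qs fr] ck].
apply: sim_mono (h2 a s' Qs fr) _ => b s'' [Qb ck2]; split=> //.
by apply: leq_trans ck2 _; rewrite addnA leq_add2r.
Qed.

Definition det c s k (Q : state R -> Prop) := hoare c s k (Leaf tt) (fun _ => Q).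

Lemma det_mono c s k k' (Q Q' : state R -> Prop) :
  det c s k Q -> (k <= k')%N ->
  (forall s', Q s' -> same (imods c) (rmods c) s s' -> Q' s') ->
  det c s k' Q'.
Proof. by move=> h kk QQ'; apply: hoare_mono h kk _ => _. Qed.

Lemma det_seq B c1 c2 s k1 k2 (T : rtree B) Q1 Q :
  det c1 s k1 Q1 ->
  (forall s', Q1 s' -> same (imods c1) (rmods c1) s s' -> hoare c2 s' k2 T Q) ->
  hoare (Seq c1 c2) s (k1 + k2) T Q.
Proof. by move=> h1 h2; apply: (hoare_seq (T2 := fun _ => T) h1) => _. Qed.

Lemma hoare_det_seq B c1 c2 s k1 k2 (T1 : rtree B) Q1 Q :
  hoare c1 s k1 T1 Q1 ->
  (forall a s', Q1 a s' -> same (imods c1) (rmods c1) s s' ->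
     det c2 s' k2 (Q a)) ->
  hoare (Seq c1 c2) s (k1 + k2) T1 Q.
Proof.
move=> h1 h2.
have -> : T1 = tbind T1 (fun a => Leaf a).
  by elim: T1 {h1} => //= m g IH; congr Unif; apply: funext => i.
apply: hoare_seq h1 _ => a s' Qs fr.
have := h2 a s' Qs fr; rewrite /det /hoare.
move: (run _ _ _) => t; move E: (Leaf tt) => tr hs.
elim: hs E => [[] s2 Qs2 _|//]; by constructor.
Qed.

Lemma hoare_map A B c s k (T : rtree A) (g : A -> B) Q (Q' : B -> state R -> Prop) :
  hoare c s k T Q -> (forall a s', Q a s' -> same (imods c) (rmods c) s s' -> Q' (g a) s') ->
  hoare c s k (tbind T (fun a => Leaf (g a))) Q'.
Proof.
move=> h QQ'; have := hoare_mono h (leqnn k) QQ'; rewrite /hoare.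
by elim=> [a s' q|m f f' _ IH]; constructor.
Qed.

Lemma det_iput a i e s k (Q : state R -> Prop) :
  (forall s', same [:: a] [::] s s' ->
     (forall j, imem s' a j = if j == ieval s i then ieval s e else imem s a j) ->
     Q s') ->
  ((icost i + icost e).+1 <= k)%N -> det (IPut a i e) s k Q.
Proof.
move=> h hk; constructor; split; last by rewrite /= leq_add2l.
apply: h => [|j]; last by rewrite /= upd_idx.
by split=> // b; rewrite inE => ba; rewrite /= upd_neq.
Qed.

Lemma det_rput a i e s k (Q : state R -> Prop) :
  (forall s', same [::] [:: a] s s' ->
     (forall j, rmem s' a j = if j == ieval s i then reval s e else rmem s a j) ->
     Q s') ->
  ((icost i + rcost e).+1 <= k)%N -> det (RPut a i e) s k Q.
Proof.
move=> h hk; constructor; split; last by rewrite /= leq_add2l.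
apply: h => [|j]; last by rewrite /= upd_idx.
by split=> // b; rewrite inE => ba; rewrite /= upd_neq.
Qed.

Lemma hoare_draw B a i e m (F : 'I_m.+1 -> rtree B) f s k (Q : B -> state R -> Prop) :
  ieval s e = m -> (forall v : 'I_m.+1, F v = Leaf (f v)) ->
  (forall (v : 'I_m.+1) s', same [:: a] [::] s s' ->
     (forall j, imem s' a j = if j == ieval s i then val v else imem s a j) ->
     Q (f v) s') ->
  ((icost i + icost e).+1 <= k)%N -> hoare (Draw a i e) s k (Unif F) Q.
Proof.
move=> em Ff; case: m / em F f Ff => F f Ff h hk; constructor=> v; rewrite Ff.
constructor; split; last by rewrite /= leq_add2l.
apply: h => [|j]; last by rewrite /= upd_idx.
by split=> // b; rewrite inE => ba; rewrite /= upd_neq.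
Qed.

Definition For v lo hi c : cmd :=
  Seq (IPut v (ICst 0) lo)
      (While (BILt (IGet v (ICst 0)) hi)
         (Seq c (IPut v (ICst 0) (IAdd (IGet v (ICst 0)) (ICst 1))))).

(** The test is evaluated once more than the body; 5 and 9 count the operations
    on the loop counter. *)
Definition for_cost (clo chi body len : nat) : nat :=
  ((clo + chi + 5) + len * (body + chi + 9))%N.

(** The loop hidden in the semantics of While, as a function of its own so that
    it can be reasoned about by induction. *)
Fixpoint loop (b : bexp) (c : cmd) (f : nat) s : rtree (option (state R)) :=
  match f with
  | 0%N => Leaf None
  | f'.+1 =>
      if beval s b then rbind (run fuel c (tick (bcost b) s)) (loop b c f')
      else Leaf (Some (tick (bcost b) s))
  end.

Lemma runWhile b c s : run fuel (While b c) s = loop b c fuel s.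
Proof.
rewrite /=; move: {2 3}fuel => f; elim: f s => //= f IH s.
by case: ifP => // _; congr rbind; apply: funext => s'; apply: IH.
Qed.

Lemma det_while b c s k m (P : nat -> state R -> Prop) (Q : state R -> Prop) :
  (m < fuel)%N -> P 0%N s ->
  (forall j s', P j s' -> beval s' b ->
     (j < m)%N /\ det c (tick (bcost b) s') k (P j.+1)) ->
  (forall j s', P j s' -> ~~ beval s' b -> Q (tick (bcost b) s')) ->
  det (While b c) s (bcost b + m * (k + bcost b)) Q.
Proof.
move=> mfuel P0 step stop; rewrite /det /hoare runWhile.
suff H len f j s1 : (len < f)%N -> (j + len = m)%N -> P j s1 ->
    sim (fun (_ : unit) s' => Q s' /\
      (clock s' <= clock s1 + (bcost b + len * (k + bcost b)))%N)
      (loop b c f s1) (Leaf tt).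
  exact: (H m fuel 0%N).
elim: len f j s1 => [|len IH] [//|f] j s1 lf jl Pj /=; case: ifP => hb.
- by have [] := step _ _ Pj hb; rewrite -jl addn0 ltnn.
- constructor; split; first by apply: stop Pj _; rewrite hb.
  by rewrite /= mul0n addn0.
- have [jm dc] := step _ _ Pj hb.
  apply: (sim_bind (F := fun _ => Leaf tt) dc) => -[] s2 [Ps2 ck].
  apply: sim_mono (IH f j.+1 s2 lf _ Ps2) _; first by rewrite addSnnS.
  by move=> _ s3 [Qs3 ck3]; split=> //; move: ck ck3; rewrite /= mulSn; lia.
- constructor; split; first by apply: stop Pj _; rewrite hb.
  by rewrite /= ; lia.
Qed.

Lemma hoare_for A (F : A -> rtree A) (Inv : nat -> A -> state R -> Prop)
    v lo hi c s k nlo nhi a :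
  (nlo <= nhi)%N -> (nhi - nlo < fuel)%N -> v \notin imods c ->
  ieval s lo = nlo ->
  (forall s', same (v :: imods c) (rmods c) s s' -> ieval s' hi = nhi) ->
  (forall j b s1 s2, same [:: v] [::] s1 s2 -> Inv j b s1 -> Inv j b s2) ->
  Inv nlo a s ->
  (forall j b s', (nlo <= j < nhi)%N -> same (v :: imods c) (rmods c) s s' ->
     imem s' v 0%N = j -> Inv j b s' -> hoare c s' k (F b) (Inv j.+1)) ->
  hoare (For v lo hi c) s (for_cost (icost lo) (icost hi) k (nhi - nlo))
    (iterT (nhi - nlo) F a) (Inv nhi).
Proof.
move=> le_lohi lfuel vc elo ehi insens inv0 body.
rewrite /for_cost.
have -> : ((icost lo + icost hi + 5) + (nhi - nlo) * (k + icost hi + 9)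
  = (icost lo + 2) + (icost hi + 3 + (nhi - nlo) * (k + icost hi + 9)))%N by lia.
apply: (@det_seq _ _ _ _ _ _ _ (fun s1 => same (v :: imods c) (rmods c) s s1
  /\ imem s1 v 0%N = nlo /\ Inv nlo a s1)).
  apply: det_iput => [s1 fr h|]; last by rewrite /=; lia.
  split; first by apply: same_sub fr => // z; rewrite !inE => ->.
  by rewrite h /= elo; split=> //; apply: insens fr inv0.
move=> s1 [fr [vlo inv1]] _; rewrite /hoare runWhile.
set b := BILt _ _; set c1 := Seq _ _.
suff H len f j a' s' : (len < f)%N -> (j + len = nhi)%N -> (nlo <= j)%N ->
    same (v :: imods c) (rmods c) s s' -> imem s' v 0%N = j -> Inv j a' s' ->
    sim (fun x s2 => Inv nhi x s2 /\
      (clock s2 <= clock s' + (icost hi + 3 + len * (k + icost hi + 9)))%N)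
      (loop b c1 f s') (iterT len F a').
  by apply: (H _ _ nlo) => //; rewrite subnKC.
elim: len f j a' s' => [|len IH] [//|f] j a' s' lf jl nj fr' vj invj;
  rewrite [loop _ _ _ _]/=.
  rewrite vj (ehi _ fr') -jl addn0 ltnn; constructor; split; last by rewrite /=; lia.
  apply: (insens _ _ s') => //; by rewrite -jl addn0 in invj *.
rewrite vj (ehi _ fr') (_ : (j < nhi)%N = true); last by rewrite -jl; lia.
rewrite iterTS.
have fr1 : same (v :: imods c) (rmods c) s (tick (bcost b) s') by [].
have jn : (nlo <= j < nhi)%N by rewrite nj -jl; lia.
have hb := body j a' _ jn fr1 vj (insens _ _ _ _ (same_tick _ _ _ _) invj).
have hc1 : hoare c1 (tick (bcost b) s') (k + 6) (F a') (fun x s2 =>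
  same (v :: imods c) (rmods c) s s2 /\ imem s2 v 0%N = j.+1 /\ Inv j.+1 x s2).
  apply: hoare_det_seq hb _ => x s2 inv2 fr2.
  apply: det_iput => [s3 fr3 h3|//].
  split.
    apply: same_trans fr1 (same_trans (same_sub _ _ fr2) (same_sub _ _ fr3)) => // z.
      by rewrite inE => ->; rewrite orbT.
    by rewrite !inE => ->.
  split; last exact: insens fr3 inv2.
  rewrite h3 /= ; have [-> //] := fr2; by rewrite vj addn1.
apply: sim_bind hc1 _ => x s2 [[fr2 [v2 inv2]] ck2].
apply: sim_mono (IH f j.+1 x s2 lf _ _ fr2 v2 inv2) _; [by rewrite addSnnS|exact: leqW|].
move=> y s3 [inv3 ck3]; split=> //; move: ck2 ck3; rewrite /= mulSn; lia.
Qed.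

Lemma det_for (Inv : nat -> state R -> Prop) v lo hi c s k nlo nhi :
  (nlo <= nhi)%N -> (nhi - nlo < fuel)%N -> v \notin imods c ->
  ieval s lo = nlo ->
  (forall s', same (v :: imods c) (rmods c) s s' -> ieval s' hi = nhi) ->
  (forall j s1 s2, same [:: v] [::] s1 s2 -> Inv j s1 -> Inv j s2) ->
  Inv nlo s ->
  (forall j s', (nlo <= j < nhi)%N -> same (v :: imods c) (rmods c) s s' ->
     imem s' v 0%N = j -> Inv j s' -> det c s' k (Inv j.+1)) ->
  det (For v lo hi c) s (for_cost (icost lo) (icost hi) k (nhi - nlo)) (Inv nhi).
Proof.
move=> h1 h2 h3 h4 h5 h6 h7 h8; rewrite /det.
have -> : Leaf tt = iterT (nhi - nlo) (fun _ => Leaf tt) tt.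
  by elim: (_ - _)%N.
apply: (hoare_for (Inv := fun j _ => Inv j)) => //.
  by move=> j _; apply: h6.
by move=> j _; apply: h8.
Qed.

Lemma hoare_for0 A (F : A -> rtree A) (Inv : A -> state R -> Prop) v hi c s k m a :
  (m < fuel)%N -> v \notin imods c ->
  (forall s', same (v :: imods c) (rmods c) s s' -> ieval s' hi = m) ->
  (forall b s1 s2, same [:: v] [::] s1 s2 -> Inv b s1 -> Inv b s2) ->
  Inv a s ->
  (forall b s', same (v :: imods c) (rmods c) s s' -> Inv b s' ->
     hoare c s' k (F b) Inv) ->
  hoare (For v (ICst 0) hi c) s (icost hi + 6 + m * (k + icost hi + 9)) (iterT m F a) Inv.
Proof.
move=> mf vc ehi ins inv0 body.
have := @hoare_for A F (fun _ => Inv) v (ICst 0) hi c s k 0 m a (leq0n _).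
rewrite subn0 => /(_ mf vc erefl ehi (fun _ => ins) inv0) h.
apply: (hoare_le (h _)); last by rewrite /for_cost /=; lia.
by move=> j b s' _ fr _; apply: body.
Qed.

(** The value written may depend on the counter only through the cell [key j],
    so cells written several times cause no conflict; it may use the old
    contents of a cell not visited before. *)
Lemma det_assign v a lo hi ie e s nlo nhi (key : nat -> nat) (f : nat -> R) k :
  (nlo <= nhi)%N -> (nhi - nlo < fuel)%N ->
  ieval s lo = nlo ->
  (forall s', same [:: v] [:: a] s s' -> ieval s' hi = nhi) ->
  (forall j s', (nlo <= j < nhi)%N -> same [:: v] [:: a] s s' -> imem s' v 0%N = j ->
     (forall i, i \notin [seq key j' | j' <- iota nlo (j - nlo)] ->
        rmem s' a i = rmem s a i) ->
     ieval s' ie = key j /\ reval s' e = f (key j)) ->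
  (for_cost (icost lo) (icost hi) (icost ie + rcost e).+1 (nhi - nlo) <= k)%N ->
  det (For v lo hi (RPut a ie e)) s k (fun s' => forall i,
    rmem s' a i = if i \in [seq key j | j <- iota nlo (nhi - nlo)] then f i
                  else rmem s a i).
Proof.
move=> h1 h2 h3 h4 h5 hk.
apply: (det_mono (det_for (c := RPut a ie e) (Inv := fun j s' => forall i,
    rmem s' a i = if i \in [seq key j | j <- iota nlo (j - nlo)] then f i
                  else rmem s a i) h1 h2 _ h3 h4 _ _ _) hk).
- by [].
- by move=> j s1 s2 [_ fr] inv i; rewrite fr.
- by move=> i; rewrite subnn.
- move=> j s' jn fr vj inv.
  have [e1 e2] := h5 j s' jn fr vj (fun i ni => etrans (inv i) (ifN _ _ ni)).
  apply: det_rput => [s2 _ upd i|]; last exact: leqnn.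
  rewrite upd e1 e2 subSn; last by case/andP: jn.
  rewrite -addn1 iotaD map_cat mem_cat /= subnKC; last by case/andP: jn.
  rewrite inE; case: eqP => [-> |_]; first by rewrite orbT.
  by rewrite orbF inv.
- by move=> s'.
Qed.

Lemma det_scatter v a lo hi ie e s nlo nhi (key : nat -> nat) (f : nat -> R) k :
  (nlo <= nhi)%N -> (nhi - nlo < fuel)%N ->
  ieval s lo = nlo ->
  (forall s', same [:: v] [:: a] s s' -> ieval s' hi = nhi) ->
  (forall j s', (nlo <= j < nhi)%N -> same [:: v] [:: a] s s' -> imem s' v 0%N = j ->
     ieval s' ie = key j /\ reval s' e = f j) ->
  (for_cost (icost lo) (icost hi) (icost ie + (icost ie).+1 + rcost e).+2 (nhi - nlo) <= k)%N ->
  det (For v lo hi (RPut a ie (RAdd (RGet a ie) e))) s k (fun s' => forall i,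
    rmem s' a i = rmem s a i + \sum_(nlo <= j < nhi | key j == i) f j).
Proof.
move=> h1 h2 h3 h4 h5 hk.
apply: (det_mono (det_for (c := RPut a ie (RAdd (RGet a ie) e)) (Inv := fun j s' => forall i,
    rmem s' a i = rmem s a i + \sum_(nlo <= j' < j | key j' == i) f j') h1 h2 _ h3 h4 _ _ _) hk).
- by [].
- by move=> j s1 s2 [_ fr] inv i; rewrite fr.
- by move=> i; rewrite big_geq ?addr0.
- move=> j s' jn fr vj inv.
  have [e1 e2] := h5 j s' jn fr vj.
  apply: det_rput => [s2 _ upd i|]; last by rewrite /=; lia.
  rewrite upd /= e1 e2 2!big_mkcond big_nat_recr /=; last by case/andP: jn.
  rewrite -big_mkcond /=.
  by rewrite eq_sym; case: eqP => [<-|_]; rewrite inv ?addrA ?addr0.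
- by move=> s'.
Qed.

End Logic.

(** * Sparse data *)
Lemma nth_lt_count (r : seq nat) i k : pairwise leq r -> (k < size r)%N ->
  (nth 0%N r k < i)%N = (k < count (fun j => j < i) r)%N.
Proof.
elim: r k => [|a r IH] // k /= /andP[/allP ar pr] kr.
have [ai|ia] := ltnP a i; first by case: k kr => [|k] kr //=; rewrite IH.
have -> : count (fun j => j < i)%N r = 0%N.
  apply/eqP; rewrite -leqn0 leqNgt -has_count -all_predC; apply/allP => j /ar aj /=.
  by rewrite -leqNgt (leq_trans ia aj).
rewrite addn0 ltn0; case: k kr => [_|k kr] /=; first by apply/negbTE; rewrite -leqNgt.
apply/negbTE; rewrite -leqNgt; apply: leq_trans ia (ar _ _); exact: mem_nth.
Qed.

Section Entries.
Variables (R : realType) (n d : nat) (x : 'I_n -> 'cV[R]_d).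

Definition nrow k := nth 0%N [seq nat_of_ord ij.1 | ij <- entries x] k.
Definition ncol k := nth 0%N [seq nat_of_ord ij.2 | ij <- entries x] k.
Definition nval k := nth 0 [seq x ij.1 ij.2 0 | ij <- entries x] k.
Definition nstart i := count (fun ij : 'I_n * 'I_d => ij.1 < i)%N (entries x).
Notation N := (size (entries x)).

Lemma big_entries (T : Type) (idx : T) (op : Monoid.com_law idx)
    (F : 'I_n * 'I_d -> T) :
  \big[op/idx]_(ij <- entries x) F ij
  = \big[op/idx]_(i < n) \big[op/idx]_(j < d | x i j 0 != 0) F (i, j).
Proof.
rewrite /entries big_filter big_mkcond big_allpairs big_enum /=.
by apply: eq_bigr => i _; rewrite big_enum [RHS]big_mkcond.
Qed.

Lemma size_entries : N = nnz x.
Proof.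
rewrite -sum1_size big_entries /nnz -sum1_card pair_big_dep /=.
by apply: eq_bigl => -[i j].
Qed.

Lemma sum_entries (P : nat -> nat -> bool) (G : nat -> nat -> R -> R) :
  \sum_(0 <= k < N | P (nrow k) (ncol k)) G (nrow k) (ncol k) (nval k)
  = \sum_(i < n) \sum_(j < d | (x i j 0 != 0) && P i j) G i j (x i j 0).
Proof.
have [/eqP e0|] := posnP N.
  have e : entries x = [::] by case: (entries x) e0.
  have h : \sum_(ij <- entries x) (if P ij.1 ij.2 then G ij.1 ij.2 (x ij.1 ij.2 0) else 0)
     = \sum_(i < n) \sum_(j < d | (x i j 0 != 0) && P i j) G i j (x i j 0).
    by rewrite big_entries; apply: eq_bigr => i _; rewrite -big_mkcondr.
  by rewrite -h e !big_nil.
move=> Np; have [ij0 _] : exists ij, ij \in entries x.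
  by case: (entries x) Np => // ij l _; exists ij; rewrite mem_head.
rewrite [LHS]big_mkcond /=.
transitivity (\sum_(ij <- entries x)
   (if P ij.1 ij.2 then G ij.1 ij.2 (x ij.1 ij.2 0) else 0)).
  rewrite (big_nth ij0); apply: eq_big_nat => k /andP[_ kN].
  by rewrite /nrow /ncol /nval !(nth_map ij0).
by rewrite big_entries; apply: eq_bigr => i _; rewrite -big_mkcondr.
Qed.

Lemma row_sum (i : 'I_n) (z : nat -> R) :
  \sum_(0 <= k < N | nrow k == i) nval k * z (ncol k) = \sum_(j < d) x i j 0 * z j.
Proof.
rewrite (sum_entries (fun a _ => a == i) (fun _ b v => v * z b)).
rewrite (bigD1 i) //= [X in _ + X]big1 ?addr0 => [|i' ii']; last first.
  by rewrite big1 // => j; rewrite [_ == _ :> nat](negPf ii') andbF.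
rewrite big_mkcond; apply: eq_bigr => j _; rewrite eqxx andbT.
by case: eqP => //= ->; rewrite mul0r.
Qed.

Lemma col_sum (j : 'I_d) (t : nat -> R) :
  \sum_(0 <= k < N | ncol k == j) nval k * t (nrow k) = \sum_(i < n) x i j 0 * t i.
Proof.
rewrite (sum_entries (fun _ b => b == j) (fun a _ v => v * t a)).
apply: eq_bigr => i _; rewrite big_mkcond (bigD1 j) //= big1 ?addr0 => [|j' jj'].
  by rewrite eqxx andbT; case: eqP => //= ->; rewrite mul0r.
by rewrite [_ == _ :> nat](negPf jj') andbF.
Qed.

Lemma row_col_sum (i : 'I_n) (j : 'I_d) c :
  \sum_(0 <= k < N | (nrow k == i) && (ncol k == j)) c * nval k = c * x i j 0.
Proof.
rewrite (sum_entries (fun a b => (a == i) && (b == j)) (fun _ _ v => c * v)).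
rewrite (bigD1 i) //= [X in _ + X]big1 ?addr0 => [|i' ii']; last first.
  by rewrite big1 // => j'; rewrite [_ == _ :> nat](negPf ii') andbF.
rewrite big_mkcond (bigD1 j) //= big1 ?addr0 => [|j' jj'].
  by rewrite !eqxx andbT; case: eqP => //= ->; rewrite mulr0.
by rewrite eqxx [_ == _ :> nat](negPf jj') !andbF.
Qed.

Lemma nrow_lt i k : (k < N)%N -> (nrow k < i)%N = (k < nstart i)%N.
Proof.
move=> kN; rewrite /nrow nth_lt_count ?size_map //; last first.
  rewrite pairwise_map /entries; apply: pairwise_filter.
  have : pairwise leq [seq val i | i <- enum 'I_n].
    rewrite -sorted_pairwise; last exact: leq_trans.
    by rewrite val_enum_ord iota_sorted.
  rewrite pairwise_map; elim: (enum 'I_n) => //= a r IH /andP[ar pr].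
  rewrite pairwise_cat IH // andbT; apply/andP; split.
    apply/allrelP => _ _ /mapP[j1 _ ->] /allpairsP[[b j2] /= [br _ ->]] /=.
    exact: (allP ar).
  by elim: (enum 'I_d) => //= j l ->; rewrite andbT; apply/allP => _ /mapP[j' _ ->] /=.
by rewrite count_map.
Qed.

Lemma nstart_le i : (nstart i <= N)%N.
Proof. exact: count_size. Qed.

Lemma nstart_leS i : (nstart i <= nstart i.+1)%N.
Proof. by apply: sub_count => ij /= h; apply: ltnW. Qed.

Lemma row_range i k : (nstart i <= k < nstart i.+1)%N = (k < N)%N && (nrow k == i).
Proof.
have [kN|Nk] := ltnP k N; last first.
  by rewrite andbC ltnNge (leq_trans (nstart_le _) Nk).
by rewrite leqNgt -!nrow_lt // -leqNgt ltnS eqn_leq andbC.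
Qed.

(** The entries are sorted by rows, so the cells delimited by [nstart] are those
    of row i. *)
Lemma big_row_range (P : nat -> bool) (F : nat -> R) i :
  \sum_(nstart i <= k < nstart i.+1 | P k) F k
  = \sum_(0 <= k < N | (nrow k == i) && P k) F k.
Proof.
rewrite (big_nat_widenl _ 0) // (big_nat_widen _ _ _ _ _ (nstart_le i.+1)).
rewrite big_nat_cond [RHS]big_nat_cond; apply: eq_bigl => k.
rewrite -!andbA; case kN: (k < N)%N => //=.
have := row_range i k; rewrite kN /= => <-.
by case: (P k); rewrite ?andbF // !andbT.
Qed.

Lemma nrow_ltn k : (k < N)%N -> (nrow k < n)%N.
Proof.
move=> kN; rewrite /nrow; have [ij0 _] : exists ij, ij \in entries x.
  by case: (entries x) kN => // ij l _; exists ij; rewrite mem_head.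
by rewrite (nth_map ij0).
Qed.

Lemma row_length i : (nstart i.+1 - nstart i <= d)%N.
Proof.
have [ni|] := leqP n i.
  suff -> : nstart i.+1 = nstart i by rewrite subnn.
  apply: eq_in_count => ij _; rewrite ltnS.
  by rewrite (leq_trans (ltnW (ltn_ord _)) ni) (leq_trans (ltn_ord _) ni).
move=> ni; rewrite -(ler_nat R) natrB ?nstart_leS //.
have -> : (nstart i.+1)%:R - (nstart i)%:R = \sum_(nstart i <= k < nstart i.+1) 1 :> R.
  by rewrite sumr_const_nat -natrB ?nstart_leS.
rewrite (big_row_range xpredT (fun _ => 1)).
under eq_bigl do rewrite andbT.
rewrite (sum_entries (fun a _ => a == i) (fun _ _ _ => 1)).
rewrite (bigD1 (Ordinal ni)) //= [X in _ + X]big1 ?addr0 => [|i' ii']; last first.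
  rewrite big1 // => j; rewrite (_ : _ == i = false) ?andbF //.
  by apply: contraNF ii' => /eqP e; apply/eqP/val_inj.
rewrite -[X in _ <= X%:R]card_ord -sumr_const [leLHS]big_mkcond.
by apply: ler_sum => j _; case: ifP.
Qed.

End Entries.

Lemma hoare_det (R : realType) fuel A c (s : state R) k (a : A) Q :
  det fuel c s k (Q a) -> hoare fuel c s k (Leaf a) Q.
Proof.
rewrite /det /hoare; move: (run _ _ _) => t; move E: (Leaf tt) => tr hs.
by elim: hs E => [[] s2 Qs2 _|//]; constructor.
Qed.

(** * The program *)

(** Memory layout, in addition to that of the input. Integer arrays hold in
    their cell 0 the parameters L (4) and T (5), the counters of the loops over
    coordinates and draws (6), entries (7), gradient steps (8), epochs (9), solves
    (10) and stages (11), the sampled row (12) and the power of two used to find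
    L (14); array 13 holds the start vector. Real arrays hold the iterate of
    the power method (2), the reference point (3), the displacement (4), the
    residual (5) and the inner products with the rows (6); and in their cell 0
    the shift (7), theta (8), the squared norm of the previous iterate (10) and
    an auxiliary sum (11). *)
Definition iv a := IGet a (ICst 0).
Definition rv a := RGet a (ICst 0).
Definition el a := RGet a (iv 6).
Definition dim := IGet 0 (ICst 1).
Definition nent := IGet 0 (ICst 2).
Definition erow := IGet 2 (iv 7).
Definition ecol := IGet 3 (iv 7).
Definition evalue := RGet 0 (iv 7).
Definition set_vec a e := For 6 (ICst 0) dim (RPut a (iv 6) e).
Definition add_to a i lo hi e := For 7 lo hi (RPut a i (RAdd (RGet a i) e)).
Definition put_real a e := RPut a (ICst 0) e.
Definition step_size := RDiv (rv 8) (RCst 352).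

Definition step_tail : cmd :=
  let lo := IGet 1 (iv 12) in let hi := IGet 1 (IAdd (iv 12) (ICst 1)) in
  Seq (put_real 11 (RCst 0))
 (Seq (add_to 11 (ICst 0) lo hi (RMul evalue (RGet 4 ecol)))
 (Seq (set_vec 4 (RAdd (RMul (RSub (RCst 1) (RMul step_size (rv 7))) (el 4))
                       (RMul step_size (el 5))))
      (add_to 4 ecol lo hi (RMul (RMul step_size (rv 11)) evalue)))).

Definition step_prog : cmd :=
  Seq (Draw 12 (ICst 0) (ISub (iv 0) (ICst 1))) step_tail.

(** Only the rows that own an entry are visited: the number of rows may be much
    larger than the number of entries. *)
Definition residual_prog : cmd :=
  Seq (For 7 (ICst 0) nent (RPut 6 erow (RCst 0)))
 (Seq (add_to 6 erow (ICst 0) nent (RMul evalue (RGet 3 ecol)))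
 (Seq (set_vec 5 (RSub (el 2) (RMul (rv 7) (el 3))))
 (Seq (add_to 5 ecol (ICst 0) nent
         (RMul evalue (RDiv (RGet 6 erow) (RNat (iv 0)))))
      (set_vec 4 (RCst 0))))).

Definition epoch_prog : cmd :=
  Seq residual_prog
 (Seq (For 8 (ICst 0) (iv 5) step_prog)
      (set_vec 3 (RAdd (el 3) (el 4)))).

Definition solve_prog : cmd :=
  Seq (set_vec 3 (RCst 0))
 (Seq (For 9 (ICst 0) (IMul (ICst 16) (iv 4)) epoch_prog)
      (set_vec 2 (el 3))).

Definition sqnorm_prog a : cmd :=
  Seq (put_real a (RCst 0))
      (For 6 (ICst 0) dim
         (RPut a (ICst 0) (RAdd (RGet a (ICst 0)) (RMul (el 2) (el 2))))).

Definition power_prog : cmd := Seq (sqnorm_prog 10) solve_prog.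

Definition stage_prog : cmd :=
  Seq (set_vec 2 (RNat (IGet 13 (iv 6))))
 (Seq (For 10 (ICst 0) (IMul (ICst 4) (iv 4)) power_prog)
 (Seq (sqnorm_prog 11)
      (put_real 7 (RAdd (RSub (rv 7) (RDiv (RSqrt (RDiv (rv 10) (rv 11))) (RCst 4)))
                        (RDiv (rv 8) (RCst 16)))))).

Section ProgramLoops.
Variables (R : realType) (n d : nat) (x : 'I_n.+1 -> 'cV[R]_d).
Variables (fuel L T : nat) (theta : R).
Notation N := (size (entries x)).
Hypothesis d_fuel : (d < fuel)%N.
Hypothesis N_fuel : (N < fuel)%N.
Hypothesis T_fuel : (T < fuel)%N.
Hypothesis L_fuel : (16 * L < fuel)%N.
Implicit Types s : state R.

(** The part of the memory that is constant after the set-up. *)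
Definition env s :=
  [/\ [/\ imem s 0%N 0%N = n.+1, imem s 0%N 1%N = d & imem s 0%N 2%N = N],
      [/\ imem s 1%N = nstart x, imem s 2%N = nrow x & imem s 3%N = ncol x],
      imem s 4%N 0%N = L /\ imem s 5%N 0%N = T
    & rmem s 0%N = nval x /\ rmem s 8%N 0%N = theta].

Lemma env_same ia ra s s' : env s -> same ia ra s s' ->
  ~~ has (mem ia) [:: 0; 1; 2; 3; 4; 5]%N -> ~~ has (mem ra) [:: 0; 8]%N -> env s'.
Proof.
move=> [[e1 e2 e3] [e4 e5 e6] [e7 e8] [e9 e10]] [hi hr].
rewrite /= !negb_or !andbT => /and5P[i0 i1 i2 i3 /andP[i4 i5]] /andP[r0 r8].
by rewrite /env !hi // !hr.
Qed.

Definition vec s a (v : 'cV[R]_d) := forall j : 'I_d, rmem s a j = v j 0.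

Lemma vec_same ia ra s s' a v : vec s a v -> same ia ra s s' -> a \notin ra ->
  vec s' a v.
Proof. by move=> va [_ hr] ha j; rewrite hr. Qed.

Lemma env_n s : env s -> imem s 0%N 0%N = n.+1. Proof. by case=> -[]. Qed.
Lemma env_d s : env s -> imem s 0%N 1%N = d. Proof. by case=> -[]. Qed.
Lemma env_N s : env s -> imem s 0%N 2%N = N. Proof. by case=> -[]. Qed.
Lemma env_start s : env s -> imem s 1%N = nstart x. Proof. by case=> _ []. Qed.
Lemma env_row s : env s -> imem s 2%N = nrow x. Proof. by case=> _ []. Qed.
Lemma env_col s : env s -> imem s 3%N = ncol x. Proof. by case=> _ []. Qed.
Lemma env_L s : env s -> imem s 4%N 0%N = L. Proof. by case=> _ _ []. Qed.
Lemma env_T s : env s -> imem s 5%N 0%N = T. Proof. by case=> _ _ []. Qed.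
Lemma env_val s : env s -> rmem s 0%N = nval x. Proof. by case=> _ _ _ []. Qed.
Lemma env_theta s : env s -> rmem s 8%N 0%N = theta. Proof. by case=> _ _ _ []. Qed.

Lemma det_set_vec a e s (f : 'cV[R]_d) k : env s ->
  (forall (j : 'I_d) s', same [:: 6%N] [:: a] s s' -> imem s' 6%N 0%N = j ->
     rmem s' a j = rmem s a j -> reval s' e = f j 0) ->
  (8 + d * (rcost e + 14) <= k)%N ->
  det fuel (set_vec a e) s k (fun s' => vec s' a f).
Proof.
move=> es he hk.
pose F i := if insub i is Some j then f j 0 else 0.
have eF (j : 'I_d) : F j = f j 0 by rewrite /F valK.
have dimE s' : same [:: 6%N] [:: a] s s' -> ieval s' dim = d.
  by case=> fi _; rewrite /= fi // env_d.
have D := @det_assign R fuel 6 a (ICst 0) dim (iv 6) e s 0 d id F k (leq0n _).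
rewrite subn0 in D.
apply: det_mono (D _ _ dimE _ _) (leqnn _) _ => //.
- move=> j s' /andP[_ jd] fr vj old; split; first by rewrite /= vj.
  rewrite (eF (Ordinal jd)); apply: he => //; apply: old.
  by rewrite map_id mem_iota subn0 /= add0n ltnn.
- by apply: leq_trans hk; rewrite /for_cost /=; clear; lia.
- by move=> s' h _ j; rewrite h map_id mem_iota /= add0n ltn_ord eF.
Qed.

Lemma det_add_to a i lo hi e s nlo nhi (key : nat -> nat) (f : nat -> R) k :
  (nlo <= nhi)%N -> (nhi - nlo < fuel)%N ->
  ieval s lo = nlo ->
  (forall s', same [:: 7%N] [:: a] s s' -> ieval s' hi = nhi) ->
  (forall j s', (nlo <= j < nhi)%N -> same [:: 7%N] [:: a] s s' -> imem s' 7%N 0%N = j ->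
     ieval s' i = key j /\ reval s' e = f j) ->
  (icost lo + icost hi + 5
   + (nhi - nlo) * (icost i + (icost i).+1 + rcost e + icost hi + 11) <= k)%N ->
  det fuel (add_to a i lo hi e) s k (fun s' => forall i,
    rmem s' a i = rmem s a i + \sum_(nlo <= j < nhi | key j == i) f j).
Proof.
move=> h1 h2 h3 h4 h5 hk; apply: det_scatter => //.
by rewrite /for_cost; move: hk; clear; lia.
Qed.

Lemma det_sqnorm a s (y : 'cV[R]_d) : env s -> vec s 2 y -> a != 2%N ->
  det fuel (sqnorm_prog a) s (20 + 40 * d) (fun s' => rmem s' a 0%N = dot y y).
Proof.
move=> es vy a2.
apply: (@hoare_le _ _ _ _ _ (3 + (17 + 40 * d))%N).
- apply: (det_seq (Q1 := fun s' => rmem s' a 0%N = 0)).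
    by apply: det_rput => // s' _ ->; rewrite /= rmorph0.
  move=> s1 a0 fr1.
  have e1 : imem s1 0%N 1%N = d by rewrite (proj1 fr1) // env_d.
  have v1 j : rmem s1 2%N j = rmem s 2%N j by rewrite (proj2 fr1) // inE eq_sym.
  pose f j := rmem s1 2%N j * rmem s1 2%N j.
  have D := @det_scatter R fuel 6 a (ICst 0) dim (ICst 0) (RMul (el 2) (el 2)) s1 0 d
    (fun _ => 0%N) f (17 + 40 * d) (leq0n _).
  rewrite subn0 in D; apply: det_mono (D _ _ _ _ _) (leqnn _) _ => //.
  + by move=> s' [fi _]; rewrite /= fi.
  + move=> j s' _ [_ fr] vj; split=> //.
    by rewrite /= vj fr // inE eq_sym.
  + by rewrite /for_cost /=; clear; lia.
  + move=> s' h _; rewrite h a0 add0r big_mkord dotE.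
    by apply: eq_big => // j _; rewrite /f !v1 vy.
- by clear; lia.
Qed.

Lemma step_tail_sim s sigma (D r : 'cV[R]_d) (i : 'I_n.+1) : env s ->
  rmem s 7%N 0%N = sigma -> vec s 4 D -> vec s 5 r -> imem s 12%N 0%N = i ->
  det fuel step_tail s (90 + d * 100) (fun s' => vec s' 4
    ((1 - theta / 352 * sigma) *: D + (theta / 352) *: r
     + (theta / 352 * dot (x i) D) *: x i)).
Proof.
move=> es es7 vD vr si.
have lo_hi := nstart_leS x i.
have len : (nstart x i.+1 - nstart x i < fuel)%N.
  exact: leq_ltn_trans (row_length x i) d_fuel.
have lend := row_length x i.
have start_cost k : ((nstart x i.+1 - nstart x i) * k <= d * k)%N by rewrite leq_mul2r lend orbT.
rewrite /step_tail /=.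
apply: (@hoare_le _ _ _ _ _ (3 + (20 + d * 27 + ((8 + d * 36) + (20 + d * 34))))%N).
- apply: (det_seq (Q1 := fun s' => rmem s' 11%N 0%N = 0)).
    by apply: det_rput => // s' _ ->; rewrite /= rmorph0.
  move=> s1 acc0 fr1; have es1 := env_same es fr1 isT isT.
  have i1 : imem s1 12%N 0%N = i by rewrite (proj1 fr1).
  have v1 := vec_same vD fr1 isT; have r1 := vec_same vr fr1 isT.
  have sg1 : rmem s1 7%N 0%N = sigma by rewrite (proj2 fr1).
  apply: (det_seq (Q1 := fun s' => rmem s' 11%N 0%N = dot (x i) D)).
    apply: det_mono (@det_add_to 11 (ICst 0) _ _ _ s1 (nstart x i) (nstart x i.+1)
      (fun _ => 0%N) (fun k => nval x k * rmem s1 4%N (ncol x k)) _ lo_hi len _ _ _ _)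
      (leqnn _) _.
    + by rewrite /= i1 env_start.
    + by move=> s' fr; have es' := env_same es1 fr isT isT;
        rewrite /= (env_start es') (proj1 fr) // i1 addn1.
    + move=> k s' _ fr vk; have es' := env_same es1 fr isT isT; split=> //.
      by rewrite /= vk (env_val es') (env_col es') (proj2 fr).
    + by have := start_cost 27%N; clear; rewrite /=; lia.
    + move=> s' h _; rewrite h acc0 add0r.
      rewrite (big_row_range x (fun _ => 0%N == 0%N)).
      under eq_bigl do rewrite andbT.
      by rewrite row_sum dotE; apply: eq_bigr => j _; rewrite v1.
  move=> s2 acc fr2; have es2 := env_same es1 fr2 isT isT.
  have i2 : imem s2 12%N 0%N = i by rewrite (proj1 fr2).
  have v2 := vec_same v1 fr2 isT; have r2 := vec_same r1 fr2 isT.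
  have sg2 : rmem s2 7%N 0%N = sigma by rewrite (proj2 fr2).
  apply: (det_seq (Q1 := fun s' => vec s' 4
     ((1 - theta / 352 * sigma) *: D + (theta / 352) *: r))).
    apply: det_set_vec => // j s' fr vj old.
    rewrite /= !vj old rmorph1 !ratr_nat !(proj2 fr) // sg2 (env_theta es2) v2 r2.
    by rewrite !mxE.
  move=> s3 v3 fr3; have es3 := env_same es2 fr3 isT isT.
  have i3 : imem s3 12%N 0%N = i by rewrite (proj1 fr3).
  have acc3 : rmem s3 11%N 0%N = dot (x i) D by rewrite (proj2 fr3).
  pose c := theta / 352 * dot (x i) D.
  apply: det_mono (@det_add_to 4 ecol _ _ _ s3 (nstart x i) (nstart x i.+1)
      (ncol x) (fun k => c * nval x k) _ lo_hi len _ _ _ _) (leqnn _) _.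
  + by rewrite /= i3 env_start.
  + by move=> s' fr; have es' := env_same es3 fr isT isT;
        rewrite /= (env_start es') (proj1 fr) // i3 addn1.
  + move=> k s' _ fr vk; have es' := env_same es3 fr isT isT; split.
      by rewrite /= vk (env_col es').
    by rewrite /= vk (env_val es') (env_theta es') ratr_nat (proj2 fr) // acc3.
  + by have := start_cost 34%N; clear; rewrite /=; lia.
  + move=> s' h _ j; rewrite h v3 (big_row_range x (fun k => ncol x k == j)).
    by rewrite (row_col_sum x i j c) [RHS]mxE; congr (_ + _); rewrite mxE.
- by clear; lia.
Qed.

Lemma step_sim s sigma (D r : 'cV[R]_d) : env s ->
  rmem s 7%N 0%N = sigma -> vec s 4 D -> vec s 5 r ->
  hoare fuel step_prog s (100 + d * 100) (svrg_step x sigma (theta / 352) r D)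
    (fun D' s' => vec s' 4 D').
Proof.
move=> es es7 vD vr.
pose body (i : 'I_n.+1) := (1 - theta / 352 * sigma) *: D + (theta / 352) *: r
     + (theta / 352 * dot (x i) D) *: x i.
rewrite [svrg_step _ _ _ _ _](_ : _ =
  tbind (Unif (fun i : 'I_n.+1 => Leaf i)) (fun i => Leaf (body i))) //.
apply: (@hoare_le _ _ _ _ _ (7 + (90 + d * 100))%N).
- apply: (hoare_seq (Q1 := fun (i : 'I_n.+1) s' => imem s' 12%N 0%N = i)).
    apply: (@hoare_draw _ _ _ _ _ _ n (fun i => Leaf i) id) => //.
    by rewrite /= (env_n es) subn1.
  move=> i s1 i1 fr1; apply: hoare_det; apply: step_tail_sim => //.
  + exact: env_same es fr1 isT isT.
  + by rewrite (proj2 fr1).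
  + exact: vec_same vD fr1 isT.
  + exact: vec_same vr fr1 isT.
- by clear; lia.
Qed.

(** First the inner products of the rows with z are collected in array 6, then
    they are spread over the columns; both sums range over the entries. *)
Lemma residual_sim s sigma (w z : 'cV[R]_d) : env s ->
  rmem s 7%N 0%N = sigma -> vec s 2 w -> vec s 3 z ->
  det fuel residual_prog s (40 + N * 76 + d * 39)
    (fun s' => vec s' 5 (w - sigma *: z + cov x *m z) /\ vec s' 4 0).
Proof.
move=> es es7 vw vz.
apply: (@hoare_le _ _ _ _ _ (8 + N * 16 + (8 + N * 28 + (8 + d * 24 +
  (8 + N * 32 + (8 + d * 15)))))%N); last by clear; lia.
have D1 := @det_assign R fuel 7 6 (ICst 0) nent erow (RCst 0) s 0 N (nrow x)
  (fun _ => 0) (8 + N * 16) (leq0n _).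
rewrite subn0 in D1; apply: (det_seq (D1 N_fuel erefl _ _ _)).
- by move=> s' fr; have := env_same es fr isT isT; apply: env_N.
- move=> k s' _ fr vk _; have es' := env_same es fr isT isT.
  by rewrite /= vk (env_row es') rmorph0.
- by rewrite /for_cost /=; clear; lia.
move=> s1 t1 fr1; have es1 := env_same es fr1 isT isT.
have w1 := vec_same vw fr1 isT; have z1 := vec_same vz fr1 isT.
have sg1 : rmem s1 7%N 0%N = sigma by rewrite (proj2 fr1).
have D2 := @det_add_to 6 erow (ICst 0) nent (RMul evalue (RGet 3 ecol)) s1 0 N
  (nrow x) (fun k => nval x k * rmem s1 3%N (ncol x k)) (8 + N * 28) (leq0n _).
rewrite subn0 in D2; apply: (det_seq (D2 N_fuel erefl _ _ _)).
- by move=> s' fr; have := env_same es1 fr isT isT; apply: env_N.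
- move=> k s' _ fr vk; have es' := env_same es1 fr isT isT.
  by rewrite /= vk (env_row es') (env_val es') (env_col es') (proj2 fr).
- by rewrite /=; clear; lia.
move=> s2 t2 fr2; have es2 := env_same es1 fr2 isT isT.
have w2 := vec_same w1 fr2 isT; have z2 := vec_same z1 fr2 isT.
have sg2 : rmem s2 7%N 0%N = sigma by rewrite (proj2 fr2).
pose t i := if insub i is Some i' then dot (x i') z / n.+1%:R else 0.
have tE k : (k < N)%N -> rmem s2 6%N (nrow x k) / n.+1%:R = t (nrow x k).
  move=> kN; rewrite /t insubT ?nrow_ltn // => kn /=; congr (_ / _).
  rewrite t2 t1 map_f ?mem_iota // add0r.
  rewrite (row_sum x (Ordinal kn)) dotE; apply: eq_bigr => j _.
  by rewrite z1.
have D3 : det fuel (set_vec 5 (RSub (el 2) (RMul (rv 7) (el 3)))) s2 (8 + d * 24)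
    (fun s' => vec s' 5 (w - sigma *: z)).
  apply: det_set_vec => // j s' fr vj _.
  by rewrite /= vj !(proj2 fr) // sg2 w2 z2 !mxE.
apply: (det_seq D3) => s3 r3 fr3; have es3 := env_same es2 fr3 isT isT.
have D4 := @det_add_to 5 ecol (ICst 0) nent
  (RMul evalue (RDiv (RGet 6 erow) (RNat (iv 0)))) s3 0 N
  (ncol x) (fun k => nval x k * t (nrow x k)) (8 + N * 32) (leq0n _).
rewrite subn0 in D4; apply: (det_seq (D4 N_fuel erefl _ _ _)).
- by move=> s' fr; have := env_same es3 fr isT isT; apply: env_N.
- move=> k s' /andP[_ kN] fr vk; have es' := env_same es3 fr isT isT.
  rewrite /= vk (env_row es') (env_val es') (env_col es') (env_n es') (proj2 fr) //.
  by rewrite (proj2 fr3) // tE.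
- by rewrite /=; clear; lia.
move=> s4 r4 fr4; have es4 := env_same es3 fr4 isT isT.
have D5 : det fuel (set_vec 4 (RCst 0)) s4 (8 + d * 15) (fun s' => vec s' 4 0).
  by apply: det_set_vec => // j s' fr vj _; rewrite /= rmorph0 mxE.
apply: det_mono D5 (leqnn _) _ => s5 d5 fr5; split=> // j.
rewrite (proj2 fr5) // r4 r3 col_sum [RHS]mxE; congr (_ + _).
rewrite covE mxE summxE mulr_sumr; apply: eq_bigr => i _.
by rewrite /t valK mxE; ring.
Qed.

Definition epoch_cost := (56 + N * 76 + d * 60 + T * (111 + d * 100))%N.

Lemma epoch_sim s sigma (w z : 'cV[R]_d) : env s ->
  rmem s 7%N 0%N = sigma -> vec s 2 w -> vec s 3 z ->
  hoare fuel epoch_prog s epoch_cost (svrg_epoch x sigma (theta / 352) T w z)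
    (fun z' s' => vec s' 3 z').
Proof.
move=> es es7 vw vz.
apply: (@hoare_le _ _ _ _ _ ((40 + N * 76 + d * 39) +
   ((8 + T * (111 + d * 100)) + (8 + d * 21)))%N); last by rewrite /epoch_cost; clear; lia.
apply: (det_seq (residual_sim es es7 vw vz)) => s1 [vr vD] fr1.
have es1 := env_same es fr1 isT isT.
have z1 := vec_same vz fr1 isT.
have sg1 : rmem s1 7%N 0%N = sigma by rewrite (proj2 fr1).
rewrite /svrg_epoch; set r := w - _ + _ in vr *.
apply: (hoare_seq (Q1 := fun D s' => vec s' 4 D)).
  apply: (hoare_le (k := 2 + 6 + T * ((100 + d * 100) + 2 + 9))); last by clear; lia.
  apply: (hoare_for0 (k := (100 + d * 100)%N) (Inv := fun D s' => vec s' 4 D)) => //.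
  - by move=> s' fr; have := env_same es1 fr isT isT; apply: env_T.
  - by move=> b s2 s3 fr vb; exact: vec_same vb fr isT.
  - move=> b s' fr vb; apply: step_sim => //.
    + exact: env_same es1 fr isT isT.
    + by rewrite (proj2 fr).
    + exact: vec_same vr fr isT.
move=> D s2 vD2 fr2; have es2 := env_same es1 fr2 isT isT.
have z2 := vec_same z1 fr2 isT.
apply/hoare_det/det_set_vec => // j s' fr vj old.
by rewrite /= vj old (proj2 fr) // z2 vD2 mxE.
Qed.

Definition solve_cost := (30 + d * 32 + 16 * L * (epoch_cost + 13))%N.

Lemma solve_sim s sigma (w : 'cV[R]_d) : env s ->
  rmem s 7%N 0%N = sigma -> vec s 2 w ->
  hoare fuel solve_prog s solve_cost (svrg_solve x sigma (theta / 352) T (16 * L) w)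
    (fun z s' => vec s' 2 z).
Proof.
move=> es es7 vw.
apply: (@hoare_le _ _ _ _ _ ((8 + d * 15) + ((10 + 16 * L * (epoch_cost + 13)) +
  (8 + d * 17)))%N); last by rewrite /solve_cost; clear; lia.
have D1 : det fuel (set_vec 3 (RCst 0)) s (8 + d * 15) (fun s' => vec s' 3 0).
  by apply: det_set_vec => // j s' fr vj _; rewrite /= rmorph0 mxE.
apply: (det_seq D1) => s1 z1 fr1; have es1 := env_same es fr1 isT isT.
have w1 := vec_same vw fr1 isT.
have sg1 : rmem s1 7%N 0%N = sigma by rewrite (proj2 fr1).
apply: (hoare_det_seq (Q1 := fun z s' => vec s' 3 z)).
  apply: (hoare_le (k := 4 + 6 + 16 * L * (epoch_cost + 4 + 9))); last by clear; lia.
  apply: (hoare_for0 (k := epoch_cost) (Inv := fun z s' => vec s' 3 z)) => //.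
  - by move=> s' fr; have := env_same es1 fr isT isT => /env_L /= ->.
  - by move=> b s2 s3 fr vb; exact: vec_same vb fr isT.
  - move=> b s' fr vb; apply: epoch_sim => //.
    + exact: env_same es1 fr isT isT.
    + by rewrite (proj2 fr).
    + exact: vec_same w1 fr isT.
move=> z s2 vz2 fr2; have es2 := env_same es1 fr2 isT isT.
apply: det_set_vec => // j s' fr vj old.
by rewrite /= vj (proj2 fr) // vz2.
Qed.

Definition power_cost := (20 + 40 * d + solve_cost)%N.

Definition holds (cb : R * 'cV[R]_d) s := rmem s 10%N 0%N = cb.1 /\ vec s 2 cb.2.

Lemma power_sim s sigma cb : env s -> rmem s 7%N 0%N = sigma -> holds cb s ->
  hoare fuel power_prog s power_cost
    (power_step (svrg_solve x sigma (theta / 352) T (16 * L)) cb) holds.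
Proof.
move=> es es7 [_ vb].
apply: (det_seq (det_sqnorm es vb (a := 10%N) isT)) => s1 c1 fr1.
have es1 := env_same es fr1 isT isT; have v1 := vec_same vb fr1 isT.
have sg1 : rmem s1 7%N 0%N = sigma by rewrite (proj2 fr1).
apply: (hoare_map (solve_sim es1 sg1 v1)) => z s2 vz fr2; split=> //=.
by rewrite (proj2 fr2).
Qed.

Definition stage_cost := (100 + d * 100 + 4 * L * (power_cost + 13))%N.

Definition holds_stage (st : R * R * 'cV[R]_d) s :=
  rmem s 7%N 0%N = st.1.1 /\ holds (st.1.2, st.2) s.

Lemma stage_sim s (l : seq nat) st : env s ->
  (forall j : 'I_d, imem s 13%N j = nth 0%N l j) -> holds_stage st s ->
  hoare fuel stage_prog s stage_cost
    (stage x theta T (16 * L) (4 * L) (gvec R d l) st) holds_stage.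
Proof.
move=> es sl [es7 [ec _]].
apply: (@hoare_le _ _ _ _ _ ((8 + d * 18) + ((10 + 4 * L * (power_cost + 13)) +
  ((20 + 40 * d) + 20)))%N); last by rewrite /stage_cost; clear; lia.
have D1 : det fuel (set_vec 2 (RNat (IGet 13 (iv 6)))) s (8 + d * 18)
    (fun s' => vec s' 2 (gvec R d l)).
  by apply: det_set_vec => // j s' fr vj _; rewrite /= vj (proj1 fr) // sl mxE.
apply: (det_seq D1) => s1 v1 fr1; have es1 := env_same es fr1 isT isT.
have sg1 : rmem s1 7%N 0%N = st.1.1 by rewrite (proj2 fr1).
have c1 : rmem s1 10%N 0%N = st.1.2 by rewrite (proj2 fr1).
apply: (hoare_seq (Q1 := holds)).
  apply: (hoare_le (k := 4 + 6 + 4 * L * (power_cost + 4 + 9))); last by clear; lia.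
  apply: (hoare_for0 (k := power_cost) (Inv := holds)) => //.
  - by apply: leq_ltn_trans L_fuel; rewrite leq_mul2r orbT.
  - by move=> s' fr; have := env_same es1 fr isT isT => /env_L /= ->.
  - move=> b s2 s3 fr [cb vb]; split; first by rewrite (proj2 fr).
    exact: vec_same vb fr isT.
  - move=> b s' fr vb; apply: power_sim => //.
    + exact: env_same es1 fr isT isT.
    + by rewrite (proj2 fr).
move=> cb s2 [c2 v2] fr2; have es2 := env_same es1 fr2 isT isT.
have sg2 : rmem s2 7%N 0%N = st.1.1 by rewrite (proj2 fr2).
apply: hoare_det; apply: (det_seq (det_sqnorm es2 v2 (a := 11%N) isT)) => s3 n3 fr3.
have es3 := env_same es2 fr3 isT isT.
apply: det_rput => // s4 fr4 upd; split=> /=.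
  rewrite upd /= n3 (env_theta es3) !ratr_nat.
  by rewrite !(proj2 fr3) // sg2 c2.
split=> /=; first by rewrite (proj2 fr4) // (proj2 fr3).
exact: vec_same (vec_same v2 fr3 isT) fr4 isT.
Qed.

End ProgramLoops.

Definition double a := IPut a (ICst 0) (IAdd (iv a) (iv a)).

(** The two loops double a power of two until T theta^2 reaches 3 * 352 * 16
    and 2^(L - l0) theta reaches d^2. With eta = theta / 352 and
    mu = theta / 16, the former is the condition eta mu T >= 3 of
    [svrg_epoch_contract]. *)
Definition setup_prog (q l0 : nat) : cmd :=
  Seq (put_real 8 (RDiv (RGet 1 (ICst 0)) (RCst q%:R)))
 (Seq (IPut 5 (ICst 0) (ICst 1))
 (Seq (While (BRLt (RMul (RNat (iv 5)) (RMul (rv 8) (rv 8)))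
                   (RMul (RMul (RCst 3) (RCst 352)) (RCst 16)))
         (double 5))
 (Seq (IPut 4 (ICst 0) (ICst l0))
 (Seq (IPut 14 (ICst 0) (ICst 1))
 (Seq (While (BRLt (RMul (RNat (iv 14)) (rv 8)) (RNat (IMul dim dim)))
         (Seq (double 14) (IPut 4 (ICst 0) (IAdd (iv 4) (ICst 1)))))
      (put_real 7 (RCst 2))))))).

Definition main_prog (m : nat) : cmd :=
  Seq (For 6 (ICst 0) dim (Draw 13 (iv 6) (ICst m)))
 (Seq (For 11 (ICst 0) (IAdd (IMul (ICst 6) (iv 4)) (ICst 1)) stage_prog)
 (Seq (sqnorm_prog 11)
      (set_vec 2 (RDiv (el 2) (RSqrt (rv 11)))))).

Definition pca_prog (q l0 m : nat) : cmd := Seq (setup_prog q l0) (main_prog m).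

Section Whole.
Variables (R : realType) (n d : nat) (x : 'I_n.+1 -> 'cV[R]_d).
Variables (fuel : nat) (theta : R).
Notation N := (size (entries x)).

Definition pca_tree m L T c y : rtree (R * R * 'cV[R]_d) :=
  tbind (start m d [::]) (fun l =>
    iterT (6 * L).+1 (stage x theta T (16 * L) (4 * L) (gvec R d l)) (2, c, y)).

Definition main_cost L T := (100 + 100 * d + (6 * L).+1 * (stage_cost x L T + 15))%N.

Lemma main_sim m L T s c y : (d < fuel)%N -> (N < fuel)%N -> (T < fuel)%N ->
  (16 * L < fuel)%N -> ((6 * L).+1 < fuel)%N -> env x L T theta s ->
  holds_stage (2, c, y) s ->
  hoare fuel (main_prog m) s (main_cost L T) (pca_tree m L T c y)
    (fun st s' => vec s' 2 ((enorm st.2)^-1 *: st.2)).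
Proof.
move=> df Nf Tf Lf Jf es hs.
apply: (@hoare_le _ _ _ _ _ ((8 + d * 15) + ((12 + (6 * L).+1 * (stage_cost x L T + 15))
  + ((20 + 40 * d) + (8 + d * 21))))%N); last by rewrite /main_cost; lia.
apply: (hoare_seq (Q1 := fun l s' => forall j : 'I_d, imem s' 13%N j = nth 0%N l j)).
  pose Inv j (l : seq nat) (s' : state R) :=
    size l = j /\ forall i, (i < j)%N -> imem s' 13%N i = nth 0%N l i.
  have := @hoare_for R fuel _ (draw_entry m) Inv 6 (ICst 0) dim
    (Draw 13 (iv 6) (ICst m)) s 4 0 d [::] (leq0n _).
  rewrite subn0 => /(_ df isT erefl) h.
  apply: (hoare_mono (h _ _ _ _)).
  - by move=> s' [fi _]; rewrite /= fi // (env_d es).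
  - by move=> j l s1 s2 [fi _] [sl hl]; split=> // i ij; rewrite fi // hl.
  - by [].
  - move=> j l s' _ _ vj [sl hl].
    apply: (@hoare_draw _ _ _ _ _ _ m _ (fun v => rcons l (val v))) => // v s'' _ upd.
    split; first by rewrite size_rcons sl.
    move=> i; rewrite ltnS leq_eqVlt upd /= vj nth_rcons sl => /orP[/eqP ->|ij].
      by rewrite ltnn !eqxx.
    by rewrite ij (ltn_eqF ij) hl.
  - by rewrite /for_cost /=; lia.
  - by move=> l s' [_ hl] _ j; apply: hl.
move=> l s1 hl fr1; have es1 := env_same es fr1 isT isT.
apply: (hoare_det_seq (Q1 := fun st s' => vec s' 2 st.2)).
  have h : hoare fuel (For 11 (ICst 0) (IAdd (IMul (ICst 6) (iv 4)) (ICst 1)) stage_prog)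
      s1 (12 + (6 * L).+1 * (stage_cost x L T + 15))
      (iterT (6 * L).+1 (stage x theta T (16 * L) (4 * L) (gvec R d l)) (2, c, y))
      (@holds_stage R d).
    apply: (hoare_le (k := 6 + 6 + (6 * L).+1 * (stage_cost x L T + 6 + 9))); last by lia.
    apply: (hoare_for0 (k := stage_cost x L T)) => //.
    - by move=> s' fr; have := env_same es1 fr isT isT => /env_L /= ->; rewrite addn1.
    - move=> st s2 s3 fr [es7 [ec vy]]; split; first by rewrite (proj2 fr).
      by split; [rewrite (proj2 fr) | exact: vec_same vy fr isT].
    - case: hs => e7 [ec vy]; split; first by rewrite (proj2 fr1).
      by split; [rewrite (proj2 fr1) | exact: vec_same vy fr1 isT].
    - move=> st s' fr hst; apply: stage_sim => //.
      + exact: env_same es1 fr isT isT.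
      + by move=> j; rewrite (proj1 fr).
  by apply: hoare_mono h (leqnn _) _ => st s' [_ [_ vy]] _.
move=> st s2 v2 fr2; have es2 := env_same es1 fr2 isT isT.
apply: (det_seq (det_sqnorm df es2 v2 (a := 11%N) isT)) => s3 n3 fr3.
have es3 := env_same es2 fr3 isT isT; have v3 := vec_same v2 fr3 isT.
apply: (det_set_vec df es3) => // j s' fr vj old.
by rewrite /= vj old (proj2 fr) // v3 n3 !mxE enormE mulrC.
Qed.

(** The hypotheses on a and b say that they are the numbers of doublings. *)
Lemma setup_det q l0 a b s :
  (a < fuel)%N -> (b < fuel)%N ->
  (forall j, (j < b)%N = ((2 ^ j)%N%:R * (theta * theta) < 3 * 352 * 16 :> R)) ->
  (forall j, (j < a)%N = ((2 ^ j)%N%:R * theta < (d * d)%N%:R :> R)) ->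
  [/\ [/\ imem s 0%N 0%N = n.+1, imem s 0%N 1%N = d & imem s 0%N 2%N = N],
      [/\ imem s 1%N = nstart x, imem s 2%N = nrow x & imem s 3%N = ncol x]
    & rmem s 0%N = nval x /\ rmem s 1%N 0%N / q%:R = theta] ->
  det fuel (setup_prog q l0) s (100 + 22 * b + 30 * a)
    (fun s' => env x (l0 + a) (2 ^ b) theta s' /\ rmem s' 7%N 0%N = 2).
Proof.
move=> af bf hb ha [[e1 e2 e3] [e4 e5 e6] [e7 e8]].
apply: (@hoare_le _ _ _ _ _ (6 + (3 + ((15 + b * (7 + 15)) + (3 + (3 +
  ((13 + a * ((7 + 6) + 13)) + 3))))))%N); last by lia.
apply: (det_seq (Q1 := fun s' => rmem s' 8%N 0%N = theta)).
  by apply: det_rput => // s' _ ->; rewrite /= ratr_nat.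
move=> s1 t1 fr1.
apply: (det_seq (Q1 := fun s' => imem s' 5%N 0%N = 1%N)).
  by apply: det_iput => // s' _ ->.
move=> s2 T2 fr2.
have t2 : rmem s2 8%N 0%N = theta by rewrite (proj2 fr2).
pose P2 j s' := same [:: 5%N] [::] s2 s' /\ imem s' 5%N 0%N = (2 ^ j)%N.
apply: (det_seq (Q1 := P2 b)).
  apply: (det_mono (det_while (k := 7) (m := b) (P := fun j s' => P2 j s' /\ (j <= b)%N)
    (Q := P2 b) bf _ _ _)) => //=.
  - move=> j s' [[fr V] jb] /=.
    rewrite V !(proj2 fr) // t2 !ratr_nat -hb => jb'; split=> //.
    apply: det_iput => // s'' fr' upd; split=> //; split.
      exact: same_trans fr fr'.
    by rewrite upd /= V expnS mul2n addnn.
  - move=> j s' [[fr V] jb] /=.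
    rewrite V !(proj2 fr) // t2 !ratr_nat -hb -leqNgt => bj.
    by split=> //; rewrite /= V; congr (2 ^ _)%N; apply/eqP; rewrite eqn_leq jb.
move=> s3 [fr3 T3] _.
apply: (det_seq (Q1 := fun s' => imem s' 4%N 0%N = l0)).
  by apply: det_iput => // s' _ ->.
move=> s4 L4 fr4.
apply: (det_seq (Q1 := fun s' => imem s' 14%N 0%N = 1%N)).
  by apply: det_iput => // s' _ ->.
move=> s5 V5 fr5.
have t5 : rmem s5 8%N 0%N = theta by rewrite (proj2 fr5) // (proj2 fr4) // (proj2 fr3).
have d5 : imem s5 0%N 1%N = d.
  by rewrite (proj1 fr5) // (proj1 fr4) // (proj1 fr3) // (proj1 fr2) // (proj1 fr1).
pose P5 j s' := [/\ same [:: 14; 4]%N [::] s5 s', imem s' 14%N 0%N = (2 ^ j)%N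
  & imem s' 4%N 0%N = (l0 + j)%N].
apply: (det_seq (Q1 := P5 a)).
  apply: (det_mono (det_while (k := 7 + 6) (m := a) (P := fun j s' => P5 j s' /\ (j <= a)%N)
    (Q := P5 a) af _ _ _)) => //=.
  - by split=> //; split=> //; rewrite (proj1 fr5) // addn0.
  - move=> j s' [[fr V Lj] ja] /=.
    rewrite V !(proj2 fr) // !(proj1 fr) // t5 d5 -ha => ja'; split=> //.
    apply: (det_seq (Q1 := fun s'' => imem s'' 14%N 0%N = (2 ^ j.+1)%N)).
      by apply: det_iput => // s'' _ ->; rewrite /= V expnS mul2n addnn.
    move=> s'' V'' fr''; apply: det_iput => // s6 fr6 upd; split=> //; split.
    + apply: same_trans fr (same_trans (same_sub _ _ fr'') (same_sub _ _ fr6)) => // z;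
      by rewrite !inE => ->; rewrite ?orbT.
    + by rewrite (proj1 fr6).
    + by rewrite upd /= (proj1 fr'') //= Lj addn1 addnS.
  - move=> j s' [[fr V Lj] ja] /=.
    rewrite V !(proj2 fr) // !(proj1 fr) // t5 d5 -ha -leqNgt => aj.
    have -> : a = j by apply/eqP; rewrite eqn_leq aj.
    by [].
move=> s6 [fr6 V6 L6] _.
apply: det_rput => // s7 fr7 upd; split; last by rewrite upd /= ratr_nat.
have fi c : c \notin [:: 4; 5; 14]%N -> imem s7 c = imem s c.
  rewrite !inE !negb_or => /and3P[c4 c5 c14].
  by rewrite (proj1 fr7) // (proj1 fr6) ?inE ?negb_or ?c4 ?c14 //
    (proj1 fr5) ?inE // (proj1 fr4) ?inE // (proj1 fr3) ?inE // (proj1 fr2) ?inE //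
    (proj1 fr1).
have fr c : c \notin [:: 7; 8]%N -> rmem s7 c = rmem s c.
  rewrite !inE !negb_or => /andP[c7 c8].
  by rewrite (proj2 fr7) ?inE // (proj2 fr6) // (proj2 fr5) // (proj2 fr4) //
    (proj2 fr3) // (proj2 fr2) // (proj2 fr1) ?inE.
split.
- by rewrite !fi.
- by rewrite !fi.
- split; first by rewrite (proj1 fr7).
  by rewrite (proj1 fr7) // (proj1 fr6) // (proj1 fr5) // (proj1 fr4).
- by rewrite fr // (proj2 fr7) // (proj2 fr6).
Qed.
End Whole.

(** * Choice of the parameters *)
Section Numerics.
Variable R : realType.

Lemma least_pow2 (y t : R) : 0 < t ->
  exists a, forall j, (j < a)%N = ((2 ^ j)%N%:R * t < y).
Proof.
move=> t0; have ex : exists a, y <= (2 ^ a)%N%:R * t.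
  exists (Num.bound `|y / t|); rewrite -ler_pdivrMr //.
  apply: le_trans (ler_norm _) _; apply: ltW; apply: lt_le_trans (archi_boundP _) _.
      exact: normr_ge0.
  by rewrite ler_nat; exact: ltnW (ltn_expl _ _).
exists (ex_minn ex) => j; case: ex_minnP => a ya mina.
apply/idP/idP => [ja|yj].
  by rewrite ltNge; apply/negP => /mina; rewrite leqNgt ja.
rewrite ltnNge; apply/negP => aj; move: yj; rewrite ltNge (le_trans ya) //.
by apply: ler_wpM2r; [exact: ltW | rewrite ler_nat leq_exp2l].
Qed.

Lemma bernoulli_pow (t : R) k : 0 <= t <= 1 -> (1 + t) ^+ k <= 1 + 2 ^+ k * t.
Proof.
move=> /andP[t0 t1]; suff : (1 + t) ^+ k <= 1 + (2 ^+ k - 1) * t.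
  by move/le_trans; apply; rewrite lerD2l ler_wpM2r // gerBl.
elim: k => [|k IH]; first by rewrite !expr0 subrr mul0r addr0.
rewrite !exprS; apply: le_trans (_ : (1 + t) * (1 + (2 ^+ k - 1) * t) <= _).
  by apply: ler_wpM2l => //; rewrite addr_ge0.
have : (1 : R) <= 2 ^+ k by rewrite exprn_ege1 // ler1n.
move: (2 ^+ k) => P P1.
have : 0 <= (P - 1) * (t * (1 - t)) by rewrite !mulr_ge0 // subr_ge0.
lra.
Qed.

Lemma nat_lt_pow (L : nat) : L%:R * 2^-1 ^+ L <= 1 :> R.
Proof.
rewrite exprVn ler_pdivrMr ?exprn_gt0 // mul1r -natrX ler_nat.
exact: ltnW (ltn_expl _ _).
Qed.

End Numerics.

Lemma stage_count_le L : (0 < L)%N -> ((6 * L).+1 <= 7 * L)%N.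
Proof. lia. Qed.

Section Success.
Variables (R : realType) (n d : nat) (x : 'I_n.+1 -> 'cV[R]_d).
Hypothesis x1 : forall i, enorm (x i) <= 1.
Variables (u : 'cV[R]_d) (lam1 delta theta eps p : R).
Let X := cov x.
Hypothesis uu : dot u u = 1.
Hypothesis Xu : X *m u = lam1 *: u.
Hypothesis top : forall v, dot v (X *m v) <= lam1 * dot v v.
Hypothesis gap : forall v, dot u v = 0 ->
  dot v (X *m v) <= (lam1 - delta) * dot v v.
Hypothesis theta_gt0 : 0 < theta.
Hypothesis theta_le : theta <= delta.
Hypothesis delta_le1 : delta <= 1.
Hypothesis eps_gt0 : 0 < eps.
Variables (m L T : nat).
Hypothesis d_gt0 : (0 < d)%N.
Hypothesis T_large : 3 * 352 * 16 <= T%:R * theta ^+ 2.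
Let V : R := 2^-1 ^+ L.
Hypothesis V8 : 8 * V <= 1.
Hypothesis Vm : 4 * m%:R * d%:R ^+ 2 * V <= 1.
Hypothesis Veps : 4 * V <= eps.
Hypothesis Vtheta : 4 * V <= theta.
Hypothesis Vp : 56 * V <= p.
Hypothesis mp : 2 * m.+1%:R^-1 <= p.

(** With V = 2^-L, the relative error tau = V^6 of the solves is amplified by at
    most 2^(4L) = V^-4 over a stage, to err = V^2; the start vector has relative
    component om = 2V along u; and each solve fails with probability at most
    q = V^4, which beats the 4L (6L + 1) <= 28 / V^2 solves. *)
Lemma pca_tree_pr c y :
  1 - p <= pr R (pca_tree x theta m L T c y)
    (fun st => accurate_vec u eps st.2).
Proof.
have V0 : 0 < V by rewrite exprn_gt0 // invr_gt0.
have V1 : V <= 1 by move: V8; lra.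
have L0 : (0 < L)%N.
  by rewrite lt0n; apply/eqP => L0; move: V8; rewrite /V L0 expr0; lra.
have LV : L%:R * V <= 1 by exact: nat_lt_pow.
pose q := V ^+ 4.
have fail : m.+1%:R^-1 + (6 * L).+1%:R * ((4 * L)%:R * q) <= p.
  have : (6 * L).+1%:R * ((4 * L)%:R * q) <= 28 * V.
    apply: le_trans (_ : 28 * (L%:R * V) ^+ 2 * V ^+ 2 <= _).
      rewrite (_ : 28 * _ * _ = (7 * L%:R) * (4 * L%:R * q)); last by rewrite /q; ring.
      rewrite -[4 * L%:R]natrM -[7 * _]natrM; apply: ler_wpM2r.
        by rewrite mulr_ge0 // exprn_ge0 // ltW.
      by rewrite ler_nat stage_count_le.
    rewrite -mulrA; apply: ler_wpM2l => //.
    rewrite -[leRHS]mul1r; apply: ler_pM => //; rewrite ?sqr_ge0 //.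
      by rewrite exprn_ile1 // mulr_ge0 // ltW.
    by rewrite expr2 ler_piMr // ltW.
  move=> h; apply: le_trans (lerD (lexx _) h) _.
  by move: mp Vp; move: (m.+1%:R^-1) => M; lra.
apply: le_trans (_ : 1 - (m.+1%:R^-1 + (6 * L).+1%:R * ((4 * L)%:R * q)) <= _).
  by rewrite lerD2l lerN2.
have q0 : 0 <= q by rewrite exprn_ge0 // ltW.
apply: pr_bind (start_pr m uu) _ _; last by do 2!apply: mulr_ge0 => //.
move=> l [a1 a2].
have [s s4] : exists s, (4 * L)%N = s.+1 by exists (4 * L).-1; rewrite prednK // muln_gt0.
rewrite s4.
have dp : 0 < d%:R :> R by rewrite ltr0n.
have u1 : enorm u = 1 by exact: enorm_u.
have y0 : 0 < enorm (gvec R d l).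
  have := ler_dot_enorm u (gvec R d l); rewrite u1 mul1r; apply: lt_le_trans.
  rewrite normr_gt0; apply/eqP => z; move: a1; rewrite z normr0 mulr0; lra.
apply: (@stages_pr _ _ _ x x1 u lam1 delta theta uu Xu top gap theta_gt0 theta_le
  delta_le1 T (16 * L) s (V ^+ 6) q T_large _ q0 _ (gvec R d l) (2 * V) (V ^+ 2) eps) => //.
- exact: exprn_gt0.
- by rewrite /q -exprM -exprD mulnC exprM.
- exact: mulr_gt0.
- have : 2 * V * enorm (gvec R d l) <= 2 * V * (m%:R * d%:R).
    by apply: ler_wpM2l => //; rewrite mulr_ge0 // ltW.
  move=> h; apply: le_trans h _.
  rewrite -(ler_pM2l (_ : 0 < 2 * d%:R)) ?mulr_gt0 //.
  by apply: le_trans a1; apply: le_trans Vm; rewrite le_eqVlt; apply/orP; left;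
    apply/eqP; ring.
- exact: sqr_ge0.
- rewrite expr2; have := ler_wpM2l (ltW V0) V8; lra.
- rewrite -s4 lerBlDl; apply: le_trans (bernoulli_pow _ _) _.
    by rewrite exprn_ge0 ?(ltW V0) // exprn_ile1 // ltW.
  rewrite lerD2l (_ : V ^+ 6 = V ^+ 4 * V ^+ 2); last by rewrite -exprD.
  rewrite mulrA ler_piMl ?sqr_ge0 //.
  have n2 : (2 : R) != 0 by rewrite pnatr_eq0.
  by rewrite mulnC exprM -exprMn /V exprVn divff ?expr1n // expf_neq0.
- rewrite -s4 exprM; apply: le_lt_trans (_ : V < _); last by lra.
  by rewrite /V; apply: lerXn2r; rewrite ?nnegrE ?exprn_ge0 ?invr_ge0 //; lra.
- exact: ltW.
- rewrite -s4 mulnC exprM -/V.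
  have VV : V ^+ 4 <= V ^+ 2.
    have -> : V ^+ 4 = V ^+ 2 * V ^+ 2 by rewrite -exprD.
    by apply: ler_piMr; rewrite ?sqr_ge0 // exprn_ile1 // ltW.
  apply: le_trans (_ : (2 * V ^+ 2) ^+ 2 <= _).
    by apply: lerXn2r; rewrite ?nnegrE ?addr_ge0 ?mulr_ge0 ?exprn_ge0 ?(ltW V0) //; lra.
  apply: le_trans (_ : eps * V ^+ 2 <= _); last first.
    apply: ler_wpM2l; first exact: ltW.
    have VV2 : V ^+ 2 <= V by rewrite expr2 ler_piMr // ltW.
    by apply: lerXn2r; rewrite ?nnegrE ?(ltW V0) //; lra.
  rewrite (_ : (2 * V ^+ 2) ^+ 2 = (4 * V) * V * V ^+ 2); last by ring.
  apply: ler_wpM2r; first exact: sqr_ge0.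
  apply: le_trans Veps; by apply: ler_piMr => //; apply: mulr_ge0 => //; exact: ltW.
- apply: le_trans Vtheta; apply: ler_wpM2l => //.
  by rewrite exprM; apply: lerXn2r; rewrite ?nnegrE ?exprn_ge0 ?invr_ge0 //; lra.
Qed.

End Success.

(** The costs are abstracted one loop level after the other; each level
    contributes one factor L. *)
Lemma cost_bound (R : realType) (n d : nat) (x : 'I_n.+1 -> 'cV[R]_d) L T a b :
  (0 < L)%N -> (0 < T)%N -> (0 < d)%N -> (a <= L)%N -> (b <= T)%N ->
  (100 + 22 * b + 30 * a + main_cost x L T
    <= 200 * 1000 * (L ^ 3 * (size (entries x) + T * d)))%N.
Proof.
rewrite /main_cost /stage_cost /power_cost /solve_cost /epoch_cost.
move: (size (entries x)) => N L0 T0 d0 aL bT {x R n}.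
have dB : (d <= T * d)%N by rewrite leq_pmull.
have TB : (T <= T * d)%N by rewrite leq_pmulr.
have e1 : (T * (111 + d * 100) = 111 * T + 100 * (T * d))%N by lia.
rewrite e1 {e1}; move: (T * d)%N dB TB => Td dB TB.
set E := (56 + _ + _ + _)%N.
have hE : (E + 13 <= 400 * (N + Td))%N by rewrite /E; lia.
move: E hE => E hE.
have hB : (d <= N + Td)%N by lia.
have hb : (b <= N + Td)%N by lia.
move: (N + Td)%N hE hB hb => B hE hB hb {N Td T bT T0 dB TB}.
have L1 k : (k <= L * k)%N by rewrite leq_pmull.
have s1 : (30 + d * 32 + 16 * L * (E + 13) <= L * (65 * 100 * B))%N.
  have := leq_mul (leqnn (16 * L)%N) hE; have := L1 B; lia.
move: (30 + _ + _)%N s1 => S s1 {E hE}.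
have s2 : (100 + d * 100 + 4 * L * (20 + 40 * d + S + 13) + 15
    <= L * (L * (270 * 100 * B)))%N.
  have h : (20 + 40 * d + S + 13 <= L * (66 * 100 * B))%N.
    by have := L1 B; lia.
  have := leq_mul (leqnn (4 * L)%N) h; have := L1 B; have := L1 (L * B)%N; lia.
move: (100 + _ + _)%N s2 => U s2 {S s1}.
have s3 : ((6 * L).+1 * (U + 15) <= 7 * L * (L * (L * (270 * 100 * B))))%N.
  by apply: leq_mul => //; lia.
have L2 k : (k <= L * (L * (L * k)))%N.
  by apply: leq_trans (L1 k) _; rewrite leq_mul2l (leq_trans (L1 k)) ?orbT // leq_mul2l L1 orbT.
have aB : (a <= L * (L * (L * B)))%N.
  apply: leq_trans aL _; rewrite -{1}[L]muln1 leq_mul2l !muln_gt0 L0 /=.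
  by rewrite (leq_trans d0 hB) orbT.
have := L2 B; rewrite !expnS expn0 muln1; lia.
Qed.

Lemma least_pow2_bounds (R : realType) (y t : R) a : 0 < t -> t <= 2 * y ->
  (forall j, (j < a)%N = ((2 ^ j)%N%:R * t < y)) ->
  y <= 2 ^+ a * t <= 2 * y.
Proof.
move=> t0 ty ha; rewrite -natrX leNgt -ha ltnn /=.
case: a ha => [|a] ha; first by rewrite expn0 mul1r.
have := ha a; rewrite ltnSn => /esym/ltW; rewrite expnS natrM -mulrA => h.
by apply: ler_wpM2l.
Qed.

(** * The theorem *)
Section SpectralFacts.
Variables (R : realType) (n d : nat) (x : 'I_n.+1 -> 'cV[R]_d).
Variables (lam : seq R) (u : 'cV[R]_d) (delta : R).
Hypothesis d_gt1 : (1 < d)%N.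
Hypothesis x1 : forall i, enorm (x i) <= 1.
Hypothesis spec : eigenvalues_of (cov x) lam.
Hypothesis deltaE : delta = lam`_0 - lam`_1.
Hypothesis delta_gt0 : 0 < delta.
Hypothesis u1 : enorm u = 1.
Hypothesis Xu : cov x *m u = lam`_0 *: u.

Lemma dot_uu1 : dot u u = 1.
Proof. by rewrite -sqr_enorm u1 expr1n. Qed.

Lemma rayleigh_gap v : dot u v = 0 ->
  dot v (cov x *m v) <= (lam`_0 - delta) * dot v v.
Proof.
move=> uv; rewrite deltaE subKr.
apply: (rayleigh_orthogonal (cov_sym x) spec _ dot_uu1 Xu uv).
by move: delta_gt0; rewrite deltaE subr_gt0.
Qed.

(** Split v into its component along u and an orthogonal one. *)
Lemma rayleigh_top v : dot v (cov x *m v) <= lam`_0 * dot v v.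
Proof.
have [w uw ->] : exists2 w, dot u w = 0 & v = dot u v *: u + w.
  exists (rejection u v); first exact: (dot_u_rejection dot_uu1).
  by rewrite /rejection addrC subrK.
move: (dot u v) => a.
have uXw : dot u (cov x *m w) = 0.
  by rewrite dot_mulmx cov_sym Xu dotZl uw mulr0.
rewrite mulmxDr -scalemxAr Xu !(dotDr, dotDl, dotZr, dotZl) uXw (dotC w u) uw dot_uu1.
have := rayleigh_gap uw.
have : 0 <= delta * dot w w by rewrite mulr_ge0 ?dotvv_ge0 // ltW.
lra.
Qed.

Lemma gap_le1 : delta <= 1.
Proof.
have [q [_ Hq]] := eigenvalue_quadratic_form (Ordinal d_gt1) (cov_sym x) spec.
have l1 : 0 <= lam`_1 by rewrite -Hq; exact: dot_cov_ge0.
have l0 : lam`_0 <= 1.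
  have := dot_cov_le x1 u; by rewrite Xu dotZr dot_uu1 mulr1.
rewrite deltaE; lra.
Qed.

End SpectralFacts.

(** 2^(l0 + a) is at most (256 / kappa) Y^4, and 256 / kappa is at most Y^h, as
    Y >= 2. *)
Lemma logarithmic_loops (R : realType) (kappa eps p delta theta d Y Z : R) (h l0 a : nat) :
  0 < kappa -> 0 < eps -> 0 < p -> 0 < delta -> 0 < theta -> 0 <= d ->
  Y = 2 + d + eps^-1 + p^-1 + delta^-1 -> Z = 8 + 4 / eps + 64 / p ->
  256 / kappa <= 2 ^+ h -> kappa * delta <= theta ->
  2 ^+ l0 <= 2 * Z -> 2 ^+ a * theta <= 2 * (d * d) ->
  (l0 + a)%N%:R <= (h + 4)%N%:R / ln 2 * ln Y.
Proof.
move=> k0 e0 p0 dl0 t0 d0 YE ZE hk kt hl ha.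
have ei : 0 < eps^-1 by rewrite invr_gt0.
have pi : 0 < p^-1 by rewrite invr_gt0.
have di : 0 < delta^-1 by rewrite invr_gt0.
have Y2 : 2 <= Y by rewrite YE; lra.
have Y0 : 0 < Y by lra.
have ZY : Z <= 64 * Y by rewrite ZE YE; lra.
have ti : theta^-1 <= kappa^-1 * Y.
  apply: le_trans (_ : kappa^-1 * delta^-1 <= _).
    by rewrite -invfM lef_pV2 ?posrE // mulr_gt0.
  by apply: ler_wpM2l; [rewrite invr_ge0 ltW | rewrite YE; lra].
have h1 : 2 ^+ l0 <= 128 * Y by lra.
have h2 : 2 ^+ a <= 2 * Y ^+ 2 * (kappa^-1 * Y).
  have : 2 ^+ a <= 2 * (d * d) * theta^-1 by rewrite ler_pdivlMr.
  move/le_trans; apply; apply: ler_pM => //.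
  - by rewrite !mulr_ge0.
  - by rewrite invr_ge0 ltW.
  - rewrite expr2; apply: ler_wpM2l => //; apply: ler_pM => //; rewrite YE; lra.
have h3 : 2 ^+ (l0 + a) <= Y ^+ (h + 4).
  rewrite exprD; apply: le_trans (ler_pM _ _ h1 h2) _; rewrite ?exprn_ge0 //.
  have -> : 128 * Y * (2 * Y ^+ 2 * (kappa^-1 * Y)) = 256 / kappa * Y ^+ 4.
    by field; rewrite gt_eqF.
  rewrite exprD; apply: ler_wpM2r; first by rewrite exprn_ge0 // ltW.
  by apply: le_trans hk _; apply: lerXn2r; rewrite ?nnegrE // ltW.
have ln2 : 0 < ln 2 :> R by rewrite ln_gt0 // ltr1n.
rewrite mulrAC ler_pdivlMr //.
have : ln (2 ^+ (l0 + a)) <= ln (Y ^+ (h + 4)).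
  by rewrite ler_ln ?posrE ?exprn_gt0.
by rewrite !lnXn // !mulr_natl.
Qed.

(** The number 2^b of gradient steps is of order theta^-2, hence of order
    delta^-2. *)
Lemma inner_steps_cost (R : realType) (kappa delta theta D E : R) b :
  0 < kappa -> kappa <= 1 -> 0 < delta -> kappa * delta <= theta ->
  2 ^+ b * (theta * theta) <= 2 * (3 * 352 * 16) -> 0 <= D -> 0 <= E ->
  E + 2 ^+ b * D <= 2 * (3 * 352 * 16) / kappa ^+ 2 * (D / delta ^+ 2 + E).
Proof.
move=> k0 k1 d0 kt hb D0 E0; rewrite mulrDr addrC; apply: lerD.
  have -> : 2 * (3 * 352 * 16) / kappa ^+ 2 * (D / delta ^+ 2)
      = 2 * (3 * 352 * 16) / (kappa * delta) ^+ 2 * D.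
    by field; rewrite !gt_eqF.
  have kd0 : 0 < kappa * delta by exact: mulr_gt0.
  apply: ler_wpM2r => //; rewrite ler_pdivlMr ?exprn_gt0 //.
  apply: le_trans hb; apply: ler_wpM2l; first exact: exprn_ge0.
  by rewrite expr2; apply: ler_pM => //; exact: ltW.
have ki : 1 <= (kappa ^+ 2)^-1.
  by rewrite invf_ge1 ?exprn_gt0 // exprn_ile1 // ltW.
by rewrite -[leLHS]mul1r; apply: ler_wpM2r => //; clear -ki; lra.
Qed.

(** Everything follows from Z d^2 V <= theta <= 1, as Z dominates each of the
    constants 8, 4m, 4/eps and 56/p. *)
Lemma precision_bounds (R : realType) (eps p theta Z : R) (d m l0 a : nat) :
  0 < eps -> 0 < p -> 0 <= theta <= 1 -> (0 < d)%N -> m%:R <= 2 / p ->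
  Z = 8 + 4 / eps + 64 / p -> Z <= 2 ^+ l0 ->
  (d * d)%N%:R <= 2 ^+ a * theta ->
  let V : R := 2^-1 ^+ (l0 + a) in
  [/\ 8 * V <= 1, 4 * m%:R * d%:R ^+ 2 * V <= 1, 4 * V <= eps, 4 * V <= theta
    & 56 * V <= p].
Proof.
move=> eps0 p0 /andP[t0 t1] d0 mp ZE hl ha V.
have ei : 0 < eps^-1 by rewrite invr_gt0.
have pi : 0 < p^-1 by rewrite invr_gt0.
have dd : 1 <= (d * d)%N%:R :> R by rewrite ler1n muln_gt0 d0.
have [Z8 [Zm [Ze Zp]]] : 8 <= Z /\ (4 * m%:R <= Z /\ (4 / eps <= Z /\ 56 / p <= Z)).
  by rewrite ZE; clear -ei pi mp; do 3!(split; first lra); lra.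
have Z0 : 0 <= Z by clear -Z8; lra.
have V0 : 0 <= V by rewrite exprn_ge0 // invr_ge0.
have ZV : Z * (d * d)%N%:R * V <= theta.
  rewrite /V exprVn ler_pdivrMr ?exprn_gt0 // exprD mulrCA.
  by apply: ler_pM => //; rewrite mulrC.
have ZV1 : Z * V <= theta.
  by apply: le_trans ZV; rewrite mulrAC ler_peMr // mulr_ge0.
have scale c : c <= Z -> c * V <= 1.
  by move=> cZ; apply: le_trans (le_trans ZV1 t1); apply: ler_wpM2r.
split.
- exact: scale.
- apply: le_trans (le_trans ZV t1); rewrite natrM expr2; apply: ler_wpM2r => //.
  by apply: ler_wpM2r => //; rewrite mulr_ge0.
- by have := scale _ Ze; rewrite mulrAC ler_pdivrMr // mul1r.
- by apply: le_trans ZV1; apply: ler_wpM2r => //; clear -Z8; lra.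
- by have := scale _ Zp; rewrite mulrAC ler_pdivrMr // mul1r.
Qed.

Lemma fuel_suffices d N T L a b :
  let fuel := (d + N + T + 16 * L + a + b).+1 in
  [/\ d < fuel, N < fuel, T < fuel & 16 * L < fuel]%N /\ (a < fuel /\ b < fuel)%N.
Proof. by split; [split | split]; lia. Qed.

Theorem theorem1p1 (R : realType) (c1 c2 : R) (c1_gt0 : 0 < c1)
    (c1_lt_c2 : c1 < c2) :
  exists (C : R) (k : nat), forall eps p : R, 0 < eps -> 0 < p ->
  exists P : cmd,
  forall (d n : nat) (x : 'I_n -> 'cV[R]_d) (lam : seq R) (u : 'cV[R]_d)
    (delta hdelta : R),
    (1 < d)%N -> (d < n)%N ->
    (forall i : 'I_n, enorm (x i) <= 1) ->
    eigenvalues_of (cov x) lam ->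
    delta = lam`_0 - lam`_1 -> 0 < delta ->
    enorm u = 1 -> cov x *m u = lam`_0 *: u ->
    c1 * delta <= hdelta -> hdelta <= c2 * delta ->
  exists fuel : nat,
    let r := run fuel P (init_state x hdelta) in
    surely r (fun s =>
      (clock s)%:R <=
        C * (d%:R / delta ^+ 2 + (nnz x)%:R)
          * ln (2 + d%:R + eps^-1 + p^-1 + delta^-1) ^+ k) /\
    1 - p <= Pr R r (fun s =>
      let w := output d s in
      (enorm w == 1) && (1 - eps <= ((w^T *m u) 0 0) ^+ 2)).
Proof.
have c2_gt0 : 0 < c2 by exact: lt_trans c1_lt_c2.
(* The program can only use rational constants: q replaces c2, and
   theta = hdelta / q satisfies kappa delta <= theta <= delta. *)
pose q := Num.bound c2.
have c2q : c2 < q%:R by apply: archi_boundP; exact: ltW.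
have q0 : 0 < q%:R :> R by exact: lt_trans c2q.
pose kappa := c1 / q%:R.
have k0 : 0 < kappa by rewrite divr_gt0.
have k1 : kappa <= 1 by rewrite ler_pdivrMr // mul1r ltW // (lt_trans c1_lt_c2).
pose h := Num.bound (256 / kappa).
have hk : 256 / kappa <= 2 ^+ h.
  apply: le_trans (ltW (archi_boundP _)) _; first by rewrite divr_ge0 // ltW.
  by rewrite -natrX ler_nat; exact: ltnW (ltn_expl _ _).
pose G : R := (h + 4)%N%:R / ln 2.
have ln2 : 0 < ln 2 :> R by rewrite ln_gt0 // ltr1n.
have G0 : 0 <= G by rewrite divr_ge0 // ltW.
exists (200 * 1000 * G ^+ 3 * (2 * (3 * 352 * 16) / kappa ^+ 2)), 3%N.
move=> eps p eps0 p0.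
(* A start vector is bad with probability 1/(m+1) < p/2. *)
pose m := Num.truncn (2 / p).
have /andP[m1 m2] : m%:R <= 2 / p < m.+1%:R.
  by apply: truncn_itv; rewrite divr_ge0 // ltW.
pose Z := 8 + 4 / eps + 64 / p.
have ei : 0 < eps^-1 by rewrite invr_gt0.
have pi : 0 < p^-1 by rewrite invr_gt0.
have Z8 : 8 <= Z by rewrite /Z; lra.
(* The constant part of the precision; the part depending on d and theta is
   found by the program. *)
have [l0 hl0] := @least_pow2 R Z 1 ltr01.
have /andP[l1 l2] : Z <= 2 ^+ l0 * 1 <= 2 * Z.
  by apply: least_pow2_bounds hl0 => //; clear -Z8; lra.
rewrite mulr1 in l1 l2.
exists (pca_prog q l0 m) => d [//|n] x lam u delta hdelta d1 dn x1 spec dE d0 u1 Xu hd1 hd2.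
pose theta := hdelta / q%:R.
have delta1 := gap_le1 d1 x1 spec dE u1 Xu.
have theta_lo : kappa * delta <= theta.
  by rewrite /kappa /theta mulrAC ler_pM2r // invr_gt0.
have theta0 : 0 < theta by apply: lt_le_trans theta_lo; exact: mulr_gt0.
have theta_hi : theta <= delta.
  rewrite /theta ler_pdivrMr //; apply: le_trans hd2 _.
  by rewrite mulrC ler_wpM2l // ltW.
have theta1 : theta <= 1 by exact: le_trans delta1.
have dp : (0 < d)%N by exact: ltnW.
have dR : 1 <= d%:R :> R by rewrite ler1n.
have dd1 : 1 <= (d * d)%N%:R :> R by rewrite ler1n muln_gt0 dp.
have [a ha] := @least_pow2 R (d * d)%N%:R theta theta0.
have t2d : theta <= 2 * (d * d)%N%:R by clear -theta1 dd1; lra.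
have /andP[a1 a2] := least_pow2_bounds theta0 t2d ha.
have tt0 : 0 < theta * theta by exact: mulr_gt0.
have tt1 : theta * theta <= 2 * (3 * 352 * 16).
  apply: le_trans (_ : 1 <= _); last by clear; lra.
  by apply: mulr_ile1 => //; exact: ltW.
have [b hb] := @least_pow2 R (3 * 352 * 16) (theta * theta) tt0.
have /andP[b1 b2] := least_pow2_bounds tt0 tt1 hb.
pose L := (l0 + a)%N; pose T := (2 ^ b)%N.
have TR : T%:R = 2 ^+ b :> R by rewrite natrX.
pose N := size (entries x).
pose fuel := (d + N + T + 16 * L + a + b).+1.
have [[df Nf Tf Lf] [af bf]] := fuel_suffices d N T L a b.
exists fuel => r.
have L0 : (0 < L)%N.
  rewrite addn_gt0; case: (posnP l0) => // l00.
  by move: l1; rewrite l00 expr0; clear -Z8; lra.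
have bT : (b <= T)%N by exact: ltnW (ltn_expl _ _).
have simr : sim (fun st s => vec s 2 ((enorm st.2)^-1 *: st.2) /\
    (clock s <= 100 + 22 * b + 30 * a + main_cost x L T)%N) r
    (pca_tree x theta m L T 0 0).
  suff H : hoare fuel (pca_prog q l0 m) (init_state x hdelta)
      ((100 + 22 * b + 30 * a) + main_cost x L T) (pca_tree x theta m L T 0 0)
      (fun st s => vec s 2 ((enorm st.2)^-1 *: st.2)).
    by apply: sim_mono H _ => st s [vs ck].
  apply: (det_seq (Q1 := fun s' => env x L T theta s' /\ rmem s' 7%N 0%N = 2)).
    apply: setup_det => //.
    by split; split=> //=; rewrite size_entries.
  move=> s1 [es1 sg1] fr1; apply: main_sim => //.
    by apply: leq_ltn_trans Lf; apply: leq_trans (stage_count_le L0) _; rewrite leq_mul2r orbT.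
  split=> //; split=> [|j] /=; first by rewrite (proj2 fr1).
  by rewrite (proj2 fr1) // mxE.
split.
  apply: (sim_surely simr) => st s [_ ck].
  set Y := 2 + _ + _ + _ + _.
  have LY : L%:R <= G * ln Y.
    apply: (logarithmic_loops k0 eps0 p0 d0 theta0 (ler0n R d) (erefl Y) (erefl Z) hk
      theta_lo l2).
    by rewrite -natrM.
  have cb : (clock s)%:R <= 200 * 1000 * (L%:R ^+ 3 * (N%:R + T%:R * d%:R)) :> R.
    rewrite -!natrX -!natrM -natrD -!natrM ler_nat; apply: leq_trans ck _.
    apply: cost_bound => //; [by rewrite expn_gt0 | exact: leq_addl].
  apply: le_trans cb _.
  have TB : N%:R + T%:R * d%:R
      <= 2 * (3 * 352 * 16) / kappa ^+ 2 * (d%:R / delta ^+ 2 + (nnz x)%:R).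
    by rewrite /N size_entries TR; apply: inner_steps_cost theta_lo b2 _ _.
  have LY3 : (L%:R : R) ^+ 3 <= G ^+ 3 * ln Y ^+ 3
    by rewrite -exprMn lerXn2r ?nnegrE // (le_trans _ LY).
  apply: le_trans (_ : 200 * 1000 * (G ^+ 3 * ln Y ^+ 3 *
    (2 * (3 * 352 * 16) / kappa ^+ 2 * (d%:R / delta ^+ 2 + (nnz x)%:R))) <= _).
    apply: ler_wpM2l; first by clear; lra.
    by apply: ler_pM => //; rewrite ?exprn_ge0 ?addr_ge0 ?mulr_ge0.
  by rewrite le_eqVlt; apply/orP; left; apply/eqP; ring.
apply: le_trans (sim_Pr (P := fun st => accurate_vec u eps st.2) _ simr _).
  have dot1 := dot_uu1 u1.
  have t01 : 0 <= theta <= 1 by rewrite ltW.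
  have [V8 Vm Ve Vt Vp] := precision_bounds eps0 p0 t01 dp m1 (erefl Z) l1 a1.
  apply: (@pca_tree_pr _ _ _ x x1 u lam`_0 delta theta eps p dot1 Xu
    (rayleigh_top spec dE d0 u1 Xu) (rayleigh_gap spec dE d0 u1 Xu)) => //.
    by rewrite TR expr2.
  by rewrite ler_pdivrMr ?ltr0n // mulrC -ler_pdivrMr //; exact: ltW.
move=> st s [vs _] [y0 acc] /=.
have -> : output d s = (enorm st.2)^-1 *: st.2.
  by apply/colP => j; rewrite mxE vs.
have yn : enorm st.2 != 0 by rewrite gt_eqF.
rewrite enormZ gtr0_norm ?invr_gt0 // mulVf // eqxx /=.
rewrite -[X in X ^+ 2]/(dot _ _) dotZl exprMn exprVn mulrC.
by rewrite ler_pdivlMr ?exprn_gt0 // dotC.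
Qed.
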